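(* Let $A$ be a finite alphabet and $L\subseteq A^*$. Then $L$ is definable by a sentence of $FO^2[<,\mathrm{bet}]$ if and only if its syntactic monoid $M(L)$ belongs to $\mathbf{M}_e\mathbf{DA}$.
   Context: $FO^2[<,\mathrm{bet}]$: first-order logic over finite words (the empty word allowed, where existential sentences are false) using only two reusable variables, with $<$, unary predicates $a(x)$ (letter at $x$ is $a$) and binary predicates $a(x,y)$ ($a\in A$) meaning some position strictly between $x$ and $y$ carries $a$. $M(L)$ is the syntactic monoid of $L$ (the transition monoid of its minimal deterministic automaton). For a finite monoid $M$: $s_1\le_{\mathcal J}s_2$ iff $s_1=rs_2t$ for some $r,t\in M$; for an idempotent $e$, $M_e$ is the submonoid generated by $\{m: e\le_{\mathcal J}m\}$; for a class $\mathbf V$ of finite monoids, $\mathbf{M}_e\mathbf{V}$ is the class of finite monoids $M$ with $eM_ee\in\mathbf V$ for every idempotent $e\in M$. $\mathbf{DA}=\mathbf{M}_e\mathbf{I}$, where $\mathbf I$ is the class containing only the trivial monoid; i.e. $\mathbf{DA}$ consists of the finite monoids with $eM_ee=\{e\}$ for all idempotents $e$. Thus $\mathbf{M}_e\mathbf{DA}$ is the class of finite monoids $M$ such that $eM_ee\in\mathbf{DA}$ for all idempotents $e\in M$. *)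

(* Defs.v *)
From HB Require Import structures.
From mathcomp Require Import all_boot.
From mathcomp Require Import boolp classical_sets functions cardinality.

Set Implicit Arguments.
Unset Strict Implicit.
Unset Printing Implicit Defensive.

Local Open Scope classical_set_scope.

(* The two variables are [false] and [true]; they can be requantified. *)
Inductive fo2 (A : Type) : Type :=
| Lt of bool & bool
| Eq of bool & bool
| Letter of A & bool
| Bet of A & bool & bool
| Not of fo2 A
| And of fo2 A & fo2 A
| Or of fo2 A & fo2 A
| Ex of bool & fo2 A
| All of bool & fo2 A.

Arguments Lt {A}.
Arguments Eq {A}.

Fixpoint free_in (A : Type) (v : bool) (phi : fo2 A) : bool :=
  match phi with
  | Lt u t | Eq u t | Bet _ u t => (v == u) || (v == t)
  | Letter _ u => v == u
  | Not psi => free_in v psi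
  | And psi1 psi2 | Or psi1 psi2 => free_in v psi1 || free_in v psi2
  | Ex u psi | All u psi => (v != u) && free_in v psi
  end.

Definition sentence (A : Type) (phi : fo2 A) : Prop :=
  forall v : bool, ~~ free_in v phi.

Definition update (s : bool -> nat) (v : bool) (i : nat) : bool -> nat :=
  fun u => if u == v then i else s u.

(* Positions of [w] are 0, ..., size w - 1. Valuations take values in [nat] so
   that they exist also for the empty word; quantifiers range over positions. *)
Fixpoint sat (A : eqType) (w : seq A) (s : bool -> nat) (phi : fo2 A) : bool :=
  match phi with
  | Lt u t => s u < s t
  | Eq u t => s u == s t
  | Letter a u => onth w (s u) == Some a
  | Bet a u t =>
      [exists k : 'I_(size w), [&& s u < k, k < s t & onth w k == Some a]]
  | Not psi => ~~ sat w s psi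
  | And psi1 psi2 => sat w s psi1 && sat w s psi2
  | Or psi1 psi2 => sat w s psi1 || sat w s psi2
  | Ex u psi => [exists k : 'I_(size w), sat w (update s u k) psi]
  | All u psi => [forall k : 'I_(size w), sat w (update s u k) psi]
  end.

(* The valuation is irrelevant for sentences, see [sat_free]. *)
Definition models (A : eqType) (w : seq A) (phi : fo2 A) : bool :=
  sat w (fun=> 0) phi.

Definition fo2_bet_definable (A : eqType) (L : set (seq A)) : Prop :=
  exists2 phi : fo2 A, sentence phi & forall w : seq A, L w <-> models w phi.

Lemma sat_free (A : eqType) (w : seq A) (phi : fo2 A) (s s' : bool -> nat) :
  (forall v, free_in v phi -> s v = s' v) -> sat w s phi = sat w s' phi.
Proof.
elim: phi s s' => /= [u t|u t|a u|a u t|psi IH|p IHp q IHq|p IHp q IHq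
  |u psi IH|u psi IH] s s' ss'.
- by rewrite !ss' ?eqxx ?orbT.
- by rewrite !ss' ?eqxx ?orbT.
- by rewrite ss' ?eqxx.
- by rewrite !ss' ?eqxx ?orbT.
- by rewrite (IH s s').
- by rewrite (IHp s s') 1?(IHq s s') // => v vf; apply: ss'; rewrite vf ?orbT.
- by rewrite (IHp s s') 1?(IHq s s') // => v vf; apply: ss'; rewrite vf ?orbT.
- apply: eq_existsb => k; apply: IH => v vf; rewrite /update.
  by case: eqVneq => // vu; apply: ss'; rewrite vu.
- apply: eq_forallb => k; apply: IH => v vf; rewrite /update.
  by case: eqVneq => // vu; apply: ss'; rewrite vu.
Qed.

(* Deterministic complete automata, possibly with infinitely many states. *)
Record dfa (A : Type) := DFA {
  state : choiceType;
  init : state;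
  step : state -> A -> state;
  final : set state
}.

Definition run (A : Type) (D : dfa A) (q : state D) (w : seq A) : state D :=
  foldl (@step A D) q w.

Definition lang (A : Type) (D : dfa A) : set (seq A) :=
  [set w | final (run (init D) w)].

Definition transition (A : Type) (D : dfa A) (w : seq A) : state D -> state D :=
  fun q => run q w.

Definition transition_monoid (A : Type) (D : dfa A) : Type :=
  {f : state D -> state D | f \in range (@transition A D)}.

HB.instance Definition _ (A : Type) (D : dfa A) :=
  Choice.copy (transition_monoid D)
    {f : state D -> state D | f \in range (@transition A D)}.

Section TransitionMonoid.
Variables (A : Type) (D : dfa A).
Implicit Types f g h : transition_monoid D.

Lemma transition1_subproof : id \in range (@transition A D).
Proof. by rewrite inE; exists [::]. Qed.

(* Transitions act on the right: [f * g] is [f] followed by [g]. *)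
Lemma transitionM_subproof f g : val g \o val f \in range (@transition A D).
Proof.
case: f g => [f /= /set_mem[u _ <-]] [g /= /set_mem[v _ <-]].
rewrite inE; exists (u ++ v) => //; apply/funext => q.
by rewrite /transition /run foldl_cat.
Qed.

Definition transition_one : transition_monoid D := Sub id transition1_subproof.
Definition transition_mul f g : transition_monoid D :=
  Sub (val g \o val f) (transitionM_subproof f g).

Lemma transition_mulA : associative transition_mul.
Proof. by move=> f g h; apply/val_inj. Qed.
Lemma transition_mul1g : left_id transition_one transition_mul.
Proof. by move=> f; apply/val_inj. Qed.
Lemma transition_mulg1 : right_id transition_one transition_mul.
Proof. by move=> f; apply/val_inj. Qed.

HB.instance Definition _ := isMonoid.Build (transition_monoid D)
  transition_mulA transition_mul1g transition_mulg1.
End TransitionMonoid.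

(* The states of the minimal automaton of [L] are the left quotients of [L]. *)
Definition lquo (A : Type) (L : set (seq A)) (u : seq A) : set (seq A) :=
  [set v | L (u ++ v)].

Section Minimal.
Variables (A : Type) (L : set (seq A)).

Definition minimal_state : choiceType := {q : set (seq A) | q \in range (lquo L)}.

Lemma minimal_init_subproof : L \in range (lquo L).
Proof. by rewrite inE; exists [::]. Qed.

Lemma minimal_step_subproof (q : minimal_state) (a : A) :
  lquo (val q) [:: a] \in range (lquo L).
Proof.
case: q => [q /= /set_mem[u _ <-]]; rewrite inE; exists (rcons u a) => //.
by apply/funext => v; rewrite /lquo /= cat_rcons.
Qed.

Definition minimal_dfa : dfa A := {|
  state := minimal_state;
  init := Sub L minimal_init_subproof;
  step := fun q a => Sub (lquo (val q) [:: a]) (minimal_step_subproof q a);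
  final := [set q | val q [::]]
|}.

Lemma val_run_minimal (q : state minimal_dfa) (w : seq A) :
  val (run q w) = lquo (val q) w.
Proof. by elim: w q => //= a w IH q; rewrite -/(run _ w) IH. Qed.

Lemma lang_minimal : lang minimal_dfa = L.
Proof.
by apply/funext => w; rewrite /lang /= val_run_minimal /lquo /= cats0.
Qed.

Lemma minimal_reachable (q : state minimal_dfa) :
  exists w, run (init minimal_dfa) w = q.
Proof.
case: (set_mem (valP q)) => w _ wq; exists w.
by apply: val_inj; rewrite val_run_minimal.
Qed.

Lemma minimal_reduced (p q : state minimal_dfa) :
  (forall w, final (run p w) <-> final (run q w)) -> p = q.
Proof.
move=> pq; apply: val_inj; apply/funext => w; apply/propext.
by move: (pq w); rewrite /= !val_run_minimal /lquo /= cats0.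
Qed.

End Minimal.

Definition syntactic_monoid (A : Type) (L : set (seq A)) : monoidType :=
  transition_monoid (minimal_dfa L).

Local Open Scope group_scope.

Definition leJ (M : monoidType) (s1 s2 : M) : Prop :=
  exists r t : M, s1 = r * s2 * t.

Definition submonoid (M : monoidType) (N : set M) : Prop :=
  N 1 /\ forall x y : M, N x -> N y -> N (x * y).

(* The submonoid M_e. *)
Definition gen_above (M : monoidType) (e : M) : set M :=
  smallest (@submonoid M) [set m | leJ e m].

Definition local_set (M : monoidType) (e : M) : set M :=
  [set e * m * e | m in gen_above e].

(* The monoid e M_e e; its unit is e, not 1. *)
Definition local_monoid (M : monoidType) (e : M) (he : e * e = e) : Type :=
  {x : M | x \in local_set e}.

HB.instance Definition _ (M : monoidType) (e : M) (he : e * e = e) :=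
  Choice.copy (local_monoid he) {x : M | x \in local_set e}.

Section LocalMonoid.
Variables (M : monoidType) (e : M) (he : e * e = e).
Implicit Types x y : local_monoid he.

Lemma gen_above_submonoid : submonoid (gen_above e).
Proof.
split=> [N [[N1 _] _] //|x y xN yN N HN].
by case: (HN) => -[_ NM] _; apply: NM; [exact: xN|exact: yN].
Qed.

Lemma local_one_subproof : e \in local_set e.
Proof.
by rewrite inE; exists 1; rewrite ?mulg1 //; case: gen_above_submonoid.
Qed.

Lemma local_mul_subproof x y : val x * val y \in local_set e.
Proof.
case: x y => [x /= /set_mem[m Mm <-]] [y /= /set_mem[n Mn <-]].
have [_ genM] := gen_above_submonoid.
rewrite inE; exists (m * e * n); last first.
  by rewrite !mulgA -(mulgA _ e e) he.
apply: (genM) => //; apply: (genM) => //.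
by apply: sub_gen_smallest; exists 1, 1; rewrite mul1g mulg1.
Qed.

Definition local_one : local_monoid he := Sub e local_one_subproof.
Definition local_mul x y : local_monoid he :=
  Sub (val x * val y) (local_mul_subproof x y).

Lemma local_mulA : associative local_mul.
Proof. by move=> x y z; apply/val_inj; rewrite /= mulgA. Qed.

Lemma local_mul1g : left_id local_one local_mul.
Proof.
move=> [x xP]; apply/val_inj => /=; case: (set_mem xP) => m _ <-.
by rewrite !mulgA he.
Qed.

Lemma local_mulg1 : right_id local_one local_mul.
Proof.
move=> [x xP]; apply/val_inj => /=; case: (set_mem xP) => m _ <-.
by rewrite -mulgA he.
Qed.

HB.instance Definition _ := isMonoid.Build (local_monoid he)
  local_mulA local_mul1g local_mulg1.
End LocalMonoid.

Definition monoid_class := monoidType -> Prop.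

(* The operator V |-> M_e V on classes of finite monoids. *)
Definition MeV (V : monoid_class) : monoid_class := fun M =>
  finite_set [set: M] /\ forall (e : M) (he : e * e = e), V (local_monoid he).

Definition trivial_monoid : monoid_class := fun M => [set: M] = [set 1].

Definition DA : monoid_class := MeV trivial_monoid.

Definition MeDA : monoid_class := MeV DA.

(* Main.v *)
(* Definable implies M_eDA: a formula only distinguishes finitely many types of
   words, and types are compatible with concatenation, so that M(L) is finite.
   If e = [U] and f = [Y], where Y is a product of blocks U x U with U long, then
   in a word Y^K z Y^K, with z a product of some of these blocks, every long factor
   has the same letters as U and every short factor occurs in Y. Hence Duplicator
   wins the game on s Y^K z Y^K t and s Y^K Y^K t, and f [z] f = f.

   M_eDA implies definable: by induction on the content B of the word w. Call a
   position good if its letter does not reappear before all the other letters of B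
   do. A factor without good position misses a letter of B, so that its value in M
   is definable by induction; and the good positions in a factor that misses a
   letter of B carry distinct letters, so that "no good position lies between x and
   y" is definable. Hence w is coded by a word over M with one letter per good
   position, and order and successor on the code are expressible on w. Boundedly
   many consecutive letters of a code come from a factor with content B, whose
   value s satisfies e M_e e in DA for the idempotent power e of s. For such codes
   the value in M is definable by induction on the set of windows of a fixed length
   that occur in the code: the position at which the R-class of the prefixes drops
   is the first occurrence of some window. Dually for the L-class, and the
   H-classes of M are trivial. *)

From HB Require Import structures.
Require Import Defs.
From mathcomp Require Import all_boot.
From mathcomp Require Import boolp classical_sets cardinality.
From mathcomp Require Import zify.

Set Implicit Arguments.
Unset Strict Implicit.
Unset Printing Implicit Defensive.

(** * Definability with order and successor *)

(** Two variables give direct access only to the set of letters between two positions, so the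
    induction on content needs cut points whose absence from a factor can be expressed. Good
    positions qualify because the two ends can compare finite memories: in a factor without [c], the
    set of letters of the good positions seen since the last [c] grows exactly when a good position
    is passed. The hypothesis on M enters through content. If [u] has all the letters of [B] and e
    is an idempotent power of its value, then the values of all words over [B] lie in M_e, so that
    DA controls what may follow a factor that fixes the current prefix. In DA itself the R-class of
    the prefixes drops at the first occurrence of a letter. Here a letter is not enough: it is
    preceded by a window in which the pigeonhole principle finds a long factor that fixes the
    prefix. In the converse direction the obstacle is a move to a nearby position, for which the
    exact set of letters in between matters. A reply must preserve a whole neighbourhood, whose
    radius shrinks at each round. *)

Lemma onth_take (T : Type) (s : seq T) p i :
  onth (take p s) i = if i < p then onth s i else None.
Proof. by elim: s p i => [|x s IH] [|p] [|i] //=; rewrite ?IH // if_same. Qed.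

Lemma onth_drop (T : Type) (s : seq T) p i : onth (drop p s) i = onth s (p + i).
Proof. by elim: s p i => [|x s IH] [|p] i //=; rewrite ?IH // onth0n. Qed.

Lemma onth_rev (T : Type) (s : seq T) i :
  i < size s -> onth (rev s) i = onth s (size s - i.+1).
Proof.
by move=> ilt; rewrite !onthE map_rev nth_rev size_map.
Qed.

Lemma onth_size (T : Type) (s : seq T) i x : onth s i = Some x -> i < size s.
Proof. by move=> e; rewrite -onthTE e. Qed.

Lemma onth_some (T : Type) (s : seq T) i :
  i < size s -> exists x, onth s i = Some x.
Proof. by rewrite -onthTE; case: onth => // x _; exists x. Qed.

Lemma takeS_onth (T : Type) (s : seq T) i x :
  onth s i = Some x -> take i.+1 s = rcons (take i s) x.
Proof. by elim: s i => [|y s IH] [|i] //= => [[->]|/IH ->]; rewrite ?take0. Qed.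

Section LocalPredicates.
Variable C : finType.
Implicit Types (P Q theta : seq C -> nat -> Prop) (K X : seq C -> Prop).
Implicit Types (w : seq C).

(* Unary two-variable logic with successor and order. The position [size w] is
   a legal argument: it serves as a right endmarker, at which languages are
   evaluated, but it is never quantified over. *)
Inductive ldef : (seq C -> nat -> Prop) -> Prop :=
| ldef_true : ldef (fun _ _ => True)
| ldef_letter c : ldef (fun w i => onth w i = Some c)
| ldef_not P : ldef P -> ldef (fun w i => ~ P w i)
| ldef_and P Q : ldef P -> ldef Q -> ldef (fun w i => P w i /\ Q w i)
| ldef_fut P : ldef P ->
    ldef (fun w i => exists j, [/\ i < j, j < size w & P w j])
| ldef_past P : ldef P ->
    ldef (fun w i => exists j, [/\ j < i, j < size w & P w j])
| ldef_next P : ldef P -> ldef (fun w i => i.+1 < size w /\ P w i.+1)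
| ldef_prev P : ldef P ->
    ldef (fun w i => [/\ 0 < i, i.-1 < size w & P w i.-1]).

Lemma ldef_ext P Q : (forall w i, P w i <-> Q w i) -> ldef P -> ldef Q.
Proof.
by move=> PQ; have -> : P = Q by apply/funext => w; apply/funext => i; apply/propext.
Qed.

Lemma ldef_or P Q : ldef P -> ldef Q -> ldef (fun w i => P w i \/ Q w i).
Proof.
move=> hP hQ; apply: ldef_ext (ldef_not (ldef_and (ldef_not hP) (ldef_not hQ))).
by move=> w i; rewrite not_andE !notE.
Qed.

(** Definability under a promise: the predicate has to be correct only on [X]. A formula may thus
    rely on a restriction of the windows without having to check it. *)
Definition ldef_on X K :=
  exists2 P, ldef P & forall w, X w -> K w <-> P w (size w).

Lemma ldef_on_ext X K K' :
  (forall w, X w -> K w <-> K' w) -> ldef_on X K -> ldef_on X K'.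
Proof. by move=> KK [P hP e]; exists P => // w Xw; rewrite -KK // e. Qed.

Lemma ldef_on_not X K : ldef_on X K -> ldef_on X (fun w => ~ K w).
Proof.
by move=> [P hP e]; exists (fun w i => ~ P w i); [exact: ldef_not|move=> w /e ->].
Qed.

Lemma ldef_on_and X K K' :
  ldef_on X K -> ldef_on X K' -> ldef_on X (fun w => K w /\ K' w).
Proof.
move=> [P hP e] [P' hP' e']; exists (fun w i => P w i /\ P' w i).
  exact: ldef_and.
by move=> w Xw; rewrite e ?e'.
Qed.

Lemma ldef_on_or X K K' :
  ldef_on X K -> ldef_on X K' -> ldef_on X (fun w => K w \/ K' w).
Proof.
move=> [P hP e] [P' hP' e']; exists (fun w i => P w i \/ P' w i).
  exact: ldef_or.
by move=> w Xw; rewrite e ?e'.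
Qed.

Lemma ldef_on_false X : ldef_on X (fun=> False).
Proof.
exists (fun w i => ~ True); first exact: ldef_not ldef_true.
by move=> w _; split.
Qed.

Lemma ldef_on_exists X (I : finType) (c : I -> Prop) (K : I -> seq C -> Prop) :
  (forall i, c i -> ldef_on X (K i)) ->
  ldef_on X (fun w => exists i, c i /\ K i w).
Proof.
move=> hK; suff [P hP e] : ldef_on X
    (fun w => exists i, i \in enum I /\ (c i /\ K i w)).
  exists P => // w /e <-; split=> [[i iK]|[i [_ iK]]]; exists i => //.
  by rewrite mem_enum.
elim: (enum I) => [|i s IH].
  by apply: ldef_on_ext (ldef_on_false X) => w _; split=> // -[i []].
have hi : ldef_on X (fun w => c i /\ K i w).
  have [ci|nci] := pselect (c i).
    by apply: ldef_on_ext (hK _ ci) => w _; split=> [|[]].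
  by apply: ldef_on_ext (ldef_on_false X) => w _; split=> // -[].
apply: ldef_on_ext (ldef_on_or hi IH) => w _; split=> [[iK|[j [js jK]]]|].
- by exists i; rewrite mem_head.
- by exists j; rewrite in_cons js orbT.
- by move=> [j []]; rewrite in_cons => /orP[/eqP->|js] jK; [left|right; exists j].
Qed.

Definition first_at theta w p :=
  [/\ p < size w, theta w p & forall j, j < p -> ~ theta w j].

(** Being before the first [theta] is recognized by [bef], which looks to the left only; it guards
    the modalities that look to the right. *)
Lemma ldef_relativize_take theta P : ldef theta -> ldef P ->
  exists2 P', ldef P' & forall w p i, first_at theta w p -> i <= p ->
    P' w i <-> P (take p w) i.
Proof.
move=> ht.
pose bef w i := ~ theta w i /\ ~ exists j, [/\ j < i, j < size w & theta w j].
have hb : ldef bef by apply: ldef_and; [|have := ldef_past ht]; exact: ldef_not.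
have befE w p i : first_at theta w p -> bef w i <-> i < p.
  move=> [pw tp np]; split=> [[ni nj]|ip].
    rewrite ltnNge; apply/negP; rewrite leq_eqVlt => /orP[/eqP pi|pi].
      by move: ni; rewrite -pi.
    by apply: nj; exists p.
  split; first exact: np.
  by move=> [j [ji _ tj]]; apply: (np j) => //; lia.
have st w p : first_at theta w p -> size (take p w) = p.
  by move=> [pw _ _]; rewrite size_takel // ltnW.
elim=> [|c|{}P _ [P' hP' e]|{}P Q _ [P' hP' e] _ [Q' hQ' e']|{}P _ [P' hP' e]
  |{}P _ [P' hP' e]|{}P _ [P' hP' e]|{}P _ [P' hP' e]].
- by exists (fun _ _ => True); first exact: ldef_true.
(* At [i = p] the position is the endmarker of [take p w], which carries no letter although [w] has
   one there. *)
- exists (fun w i => onth w i = Some c /\ bef w i).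
    by apply: ldef_and => //; exact: ldef_letter.
  move=> w p i fp ip; rewrite (befE _ _ _ fp) onth_take.
  by case: ifP => _; split=> // -[].
- exists (fun w i => ~ P' w i); first exact: ldef_not.
  by move=> w p i fp ip; rewrite (e _ p).
- exists (fun w i => P' w i /\ Q' w i); first exact: ldef_and.
  by move=> w p i fp ip; rewrite (e _ p) ?(e' _ p).
- eexists; first exact: ldef_fut (ldef_and hb hP').
  move=> w p i fp ip /=; rewrite (st _ _ fp); split=> -[j].
    by case=> ij jw []; rewrite (befE _ _ _ fp) => jp /(e _ _ _ fp (ltnW jp)); exists j.
  move=> [ij jp Pj]; exists j; split=> //; first by case: fp; lia.
  by split; [apply/(befE _ p)|apply/(e _ p) => //; exact: ltnW].
- eexists; first exact: ldef_past hP'.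
  move=> w p i fp ip /=; rewrite (st _ _ fp); split=> -[j [ji jw Pj]]; exists j.
    by split=> //; [lia|apply/(e _ p) => //; lia].
  by split=> //; [case: fp; lia|apply/(e _ p); rewrite //; lia].
- eexists; first exact: ldef_next (ldef_and hb hP').
  move=> w p i fp ip /=; rewrite (st _ _ fp) (befE _ _ _ fp).
  split=> [[iw [jp /(e _ _ _ fp (ltnW jp))]]|[jp Pj]] //; split; first by case: fp; lia.
  by split=> //; apply/(e _ p) => //; exact: ltnW.
- eexists; first exact: ldef_prev hP'.
  move=> w p i fp ip /=; rewrite (st _ _ fp); split=> -[i0 iw Pj]; split=> //.
  + lia.
  + by apply/(e _ p) => //; lia.
  + by case: fp; lia.
  + by apply/(e _ p); rewrite //; lia.
Qed.

(** Guards are needed only for the modalities that look to the left, since moving right never leaves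
    the suffix. *)
Lemma ldef_relativize_drop theta P : ldef theta -> ldef P ->
  exists2 P', ldef P' & forall w p i, first_at theta w p -> p < i ->
    P' w i <-> P (drop p.+1 w) (i - p.+1).
Proof.
move=> ht.
pose aft w i := exists j, [/\ j < i, j < size w & theta w j].
have ha : ldef aft by exact: ldef_past.
have aftE w p i : first_at theta w p -> aft w i <-> p < i.
  move=> [pw tp np]; split=> [[j [ji jw tj]]|pi]; last by exists p.
  by rewrite ltnNge; apply/negP => ip; apply: (np j) => //; lia.
elim=> [|c|{}P _ [P' hP' e]|{}P Q _ [P' hP' e] _ [Q' hQ' e']|{}P _ [P' hP' e]
  |{}P _ [P' hP' e]|{}P _ [P' hP' e]|{}P _ [P' hP' e]].
- by exists (fun _ _ => True); first exact: ldef_true.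
- eexists; first exact: (ldef_letter c).
  by move=> w p i fp pi /=; rewrite onth_drop subnKC.
- exists (fun w i => ~ P' w i); first exact: ldef_not.
  by move=> w p i fp ip; rewrite (e _ p).
- exists (fun w i => P' w i /\ Q' w i); first exact: ldef_and.
  by move=> w p i fp ip; rewrite (e _ p) ?(e' _ p).
- eexists; first exact: ldef_fut hP'.
  move=> w p i fp pi /=; rewrite size_drop; split=> -[j [ij jw Pj]].
    by exists (j - p.+1); split; [lia|lia|apply/(e _ p) => //; lia].
  exists (j + p.+1); split; [lia|lia|apply/(e _ p) => //; first lia].
  by rewrite addnK.
- eexists; first exact: ldef_past (ldef_and ha hP').
  move=> w p i fp pi /=; rewrite size_drop; split=> -[j].
    move=> [ij jw []]; rewrite (aftE _ _ _ fp) => pj /e Pj.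
    by exists (j - p.+1); split; [lia|lia|exact: Pj].
  move=> [ij jw Pj]; exists (j + p.+1); split; [lia|lia|split].
    by rewrite (aftE _ _ _ fp); lia.
  by apply/(e _ p) => //; [lia|rewrite addnK].
- eexists; first exact: ldef_next hP'.
  move=> w p i fp pi /=; rewrite size_drop -subSn // (e _ p) //; last lia.
  by split=> -[? ?]; split=> //; lia.
- eexists; first exact: ldef_prev (ldef_and ha hP').
  move=> w p i fp pi /=; rewrite size_drop (propext (aftE _ _ i.-1 fp)).
  have -> : (i - p.+1).-1 = i.-1 - p.+1 by lia.
  split=> [[i0 iw [pj /(e _ _ _ fp pj) Pj]]|[i0 iw Pj]].
    by split; [lia|lia|exact: Pj].
  by split; [lia|lia|split; [lia|apply/(e _ p) => //; lia]].
Qed.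

(** The endmarker of the suffix is that of [w], so [K2] is tested in place; [K1] is tested at [p],
    the endmarker of the prefix. *)
Lemma ldef_on_cut X X1 theta K1 K2 : ldef theta -> ldef_on X1 K1 -> ldef_on X K2 ->
  (forall w p, X w -> X (drop p w)) ->
  (forall w p, X w -> first_at theta w p -> X1 (take p w)) ->
  ldef_on X (fun w => exists p,
    [/\ first_at theta w p, K1 (take p w) & K2 (drop p.+1 w)]).
Proof.
move=> ht [P1 hP1 e1] [P2 hP2 e2] Xd Xt.
have [P1' hP1' {}e1'] := ldef_relativize_take ht hP1.
have [P2' hP2' {}e2'] := ldef_relativize_drop ht hP2.
eexists; first exact: (ldef_and (ldef_past
  (ldef_and (ldef_and ht (ldef_not (ldef_past ht))) hP1')) hP2').
move=> w Xw /=; split.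
  move=> [p [fp K1p K2p]]; case: (fp) => pw tp np; split.
    exists p; split=> //; split; last first.
      apply/(e1' _ p) => //; have /e1 := Xt _ _ Xw fp.
      by rewrite size_takel; [case=> + _; apply|exact: ltnW].
    by split=> // -[j [jp _]]; exact: np.
  apply/(e2' _ p) => //; have /e2 := Xd _ p.+1 Xw.
  by rewrite size_drop => -[+ _]; apply.
move=> [[p [_ pw [[tp np] Pp]]] Pe].
have fp : first_at theta w p.
  by split=> // j jp tj; apply: np; exists j; split=> //; exact: ltn_trans pw.
exists p; split=> //.
  apply: (e1 _ (Xt _ _ Xw fp)).2.
  by rewrite size_takel; [apply/(e1' _ p)|exact: ltnW].
apply: (e2 _ (Xd _ p.+1 Xw)).2.
by rewrite size_drop; apply/(e2' _ p).
Qed.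

(** Reversal mirrors the positions but leaves the endmarker on the right, so the two need separate
    translations. *)
Lemma ldef_rev P : ldef P ->
  (exists2 P', ldef P' & forall w i, i < size w ->
    P' w i <-> P (rev w) (size w - i.+1)) /\
  (exists2 P', ldef P' & forall w, P' w (size w) <-> P (rev w) (size w)).
Proof.
elim=> [|c|{}P _ [[P' hP' e] [Pe hPe ee]]|
  {}P Q _ [[P' hP' e] [Pe hPe ee]] _ [[Q' hQ' e'] [Qe hQe ee']]
  |{}P _ [[P' hP' e] [Pe hPe ee]]|{}P _ [[P' hP' e] [Pe hPe ee]]
  |{}P _ [[P' hP' e] [Pe hPe ee]]|{}P _ [[P' hP' e] [Pe hPe ee]]].
- by split; exists (fun _ _ => True); try exact: ldef_true.
- split.
    eexists; first exact: ldef_letter c.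
    move=> w i iw /=; rewrite onth_rev; last lia.
    by have -> : size w - (size w - i.+1).+1 = i by lia.
  exists (fun _ _ => ~ True); first exact: ldef_not ldef_true.
  by move=> w; rewrite onth_default ?size_rev.
- split; [exists (fun w i => ~ P' w i)|exists (fun w i => ~ Pe w i)];
    try exact: ldef_not.
    by move=> w i iw; rewrite e.
  by move=> w; rewrite ee.
- split; [exists (fun w i => P' w i /\ Q' w i)|exists (fun w i => Pe w i /\ Qe w i)];
    try exact: ldef_and.
    by move=> w i iw; rewrite e // e'.
  by move=> w; rewrite ee ee'.
- split.
    eexists; first exact: ldef_past hP'.
    move=> w i iw /=; rewrite size_rev; split=> -[j [ij jw Pj]];
      exists (size w - j.+1); split; try lia.
      by apply/e.
    apply/e; first lia.
    by have -> : size w - (size w - j.+1).+1 = j by lia.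
  exists (fun _ _ => ~ True); first exact: ldef_not ldef_true.
  by move=> w; rewrite size_rev; split=> // -[j []]; lia.
- split.
    eexists; first exact: ldef_fut hP'.
    move=> w i iw /=; rewrite size_rev; split=> -[j [ij jw Pj]];
      exists (size w - j.+1); split; try lia.
      by apply/e.
    apply/e; first lia.
    by have -> : size w - (size w - j.+1).+1 = j by lia.
  eexists; first exact: ldef_past hP'.
  move=> w /=; rewrite size_rev; split=> -[j [ij jw Pj]];
      exists (size w - j.+1); split; try lia.
    by apply/e.
  apply/e; first lia.
  by have -> : size w - (size w - j.+1).+1 = j by lia.
- split.
    eexists; first exact: ldef_prev hP'.
    move=> w i iw /=; rewrite size_rev; split=> [[i0 iw' Pi]|[iw' Pi]].
      split; first lia.
      by have := (e w _ iw').1 Pi; congr (P _ _); lia.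
    split; [lia|lia|apply/e; first lia].
    by move: Pi; congr (P _ _); lia.
  exists (fun _ _ => ~ True); first exact: ldef_not ldef_true.
  by move=> w; rewrite size_rev; split=> // -[]; lia.
- split.
    eexists; first exact: ldef_next hP'.
    move=> w i iw /=; rewrite size_rev; split=> [[iw' Pi]|[i0 iw' Pi]].
      split; [lia|lia|].
      by have := (e w _ iw').1 Pi; congr (P _ _); lia.
    split; [lia|apply/e; first lia].
    by move: Pi; congr (P _ _); lia.
  (* The last position of [rev w] is the first one of [w], recognized as the position without
     predecessor. *)
  eexists; first exact: ldef_past (ldef_and (ldef_not (ldef_prev ldef_true)) hP').
  move=> w /=; rewrite size_rev; split=> [[j [_ jw [j0 Pj]]]|[w0 _ Pe0]].
    have {}j0 : j = 0.
      by case: j jw j0 Pj => // j jw j0; case: j0; split=> //; lia.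
    move: jw Pj; rewrite {}j0 => w0 Pj; split; [lia|lia|].
    by have := (e w _ w0).1 Pj; rewrite subn1.
  by exists 0; split=> //; split; [case|apply/e => //; rewrite subn1].
Qed.

Lemma ldef_on_rev X K :
  ldef_on (fun w => X (rev w)) K -> ldef_on X (fun w => K (rev w)).
Proof.
move=> [P hP e]; have [_ [P' hP' e']] := ldef_rev hP; exists P' => // w Xw.
by rewrite e ?revK // e' size_rev.
Qed.

End LocalPredicates.

(** * Products of long stable words *)

Lemma onth_split (T : Type) (s : seq T) i x :
  onth s i = Some x -> s = take i s ++ x :: drop i.+1 s.
Proof. by move=> sx; rewrite -cat_rcons -(takeS_onth sx) cat_take_drop. Qed.

(** The fixed word [t] is read backwards from [i], one predecessor step per letter. [P0] constrains
    where it begins, which later tells entire prefixes from arbitrary windows. *)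
Lemma ldef_before (C : finType) (P0 : seq C -> nat -> Prop) (t : seq C) :
  ldef P0 ->
  exists2 P, ldef P & forall w i, i <= size w ->
    P w i <-> exists k, [/\ P0 w k, k + size t = i & take i w = take k w ++ t].
Proof.
move=> h0; elim/last_ind: t => [|t c [P hP e]].
  exists P0 => // w i iw; split=> [Pi|[k [Pk <- _]]]; last by rewrite addn0.
  by exists i; rewrite cats0 addn0.
eexists; first exact: (ldef_prev (ldef_and (ldef_letter c) hP)).
move=> w [|i] iw /=; split.
- by case.
- by move=> [k [_]]; rewrite size_rcons addnS.
- move=> [_ _ [ic /(e _ _ (ltnW iw))[k [Pk ki tk]]]]; exists k.
  by rewrite size_rcons addnS ki (takeS_onth ic) tk rcons_cat.
- move=> [k [Pk]]; rewrite size_rcons addnS => -[ki].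
  have [x ix] := onth_some iw.
  rewrite (takeS_onth ix) -rcons_cat => /rcons_inj[tk xc]; split=> //.
  by split; [rewrite ix xc|apply/e; [exact: ltnW|exists k]].
Qed.

Section RClasses.
Variables (F : finType) (one : F) (op : Monoid.law one).
Local Notation "x ** y" := (op x y) (at level 40, left associativity).
Local Notation prod w := (\big[op/one]_(x <- w) x).
Variables (S : F -> Prop) (S1 : S one).
Hypothesis SM : forall x y : F, S x -> S y -> S (x ** y).
Implicit Types (u m s : F) (w v t : seq F).

Definition Rle m u := exists2 r, S r & m = u ** r.

Definition Req m u := Rle m u /\ Rle u m.

(* Multiplication by [y] stays in the R-class of [g = g s], and so does
   multiplication by [x]; then multiplying by [y] does not affect whether
   multiplication by [x] stays in the R-class. *)
Definition Rstable s := forall g x y r r' : F, S g -> S x -> S y -> S r -> S r' ->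
  g ** s = g -> g ** y ** s = g ** y -> g ** x ** r = g -> g ** y ** r' = g ->
  Rle g (g ** y ** x).

Let opA x y z : x ** (y ** z) = x ** y ** z.
Proof. exact: Monoid.mulmA. Qed.

Let opx1 x : x ** one = x.
Proof. exact: Monoid.mulm1. Qed.

Lemma Rle_refl u : Rle u u.
Proof. by exists one => //; rewrite opx1. Qed.

Lemma Rle_trans u m s : Rle u m -> Rle m s -> Rle u s.
Proof.
by move=> [r Sr ->] [r' Sr' ->]; exists (r' ** r); [exact: SM|rewrite opA].
Qed.

Lemma Rle_mul u r : S r -> Rle (u ** r) u.
Proof. by exists r. Qed.

Lemma S_prod w : (forall x, x \in w -> S x) -> S (prod w).
Proof.
elim: w => [|x w IH] h; first by rewrite big_nil.
rewrite big_cons; apply: SM; first by apply: h; rewrite mem_head.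
by apply: IH => y yw; apply: h; rewrite in_cons yw orbT.
Qed.

Lemma prod_cat w v : prod (w ++ v) = prod w ** prod v.
Proof. exact: big_cat. Qed.

Lemma prod_rcons w x : prod (rcons w x) = prod w ** x.
Proof. by rewrite -cats1 prod_cat big_seq1. Qed.

Lemma R_descent u w : ~ Rle u (u ** prod w) ->
  exists x a v, [/\ w = x ++ a :: v, Rle u (u ** prod x) &
    ~ Rle u (u ** prod (rcons x a))].
Proof.
elim/last_ind: w => [|w a IH]; first by case; rewrite big_nil opx1; exact: Rle_refl.
have [le_u nle|/IH[x [b [v [-> le_u nle]]]] _] := pselect (Rle u (u ** prod w)).
  by exists w, a, [::]; rewrite cats1.
by exists x, b, (rcons v a); rewrite rcons_cat rcons_cons.
Qed.

Variables (N : nat) (G : seq F -> Prop).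
Hypothesis G_infix : forall w v, G w -> infix v w -> G v.
Hypothesis G_S : forall w x, G w -> x \in w -> S x.
Hypothesis G_stable : forall w, G w -> N <= size w -> Rstable (prod w).

Local Notation l := (#|F| * N)%N.

(** Pigeonhole on the [#|F|.+1] prefixes of [t] whose lengths are multiples of [N]: two of them have
    the same product, and the factor [t2] that separates them is long enough to be stable. *)
Lemma prefix_repetition t : size t = l ->
  exists t1 t2 t3, [/\ t = t1 ++ t2 ++ t3, N <= size t2 &
    prod (t1 ++ t2) = prod t1].
Proof.
move=> st; pose f (i : 'I_#|F|.+1) := prod (take (i * N) t).
have /injectivePn[i [j ij fij]] : ~~ injectiveb f.
  by apply/negP => /injectiveP /leq_card; rewrite card_ord ltnn.
wlog lt_ij : i j ij fij / i < j.
  move=> h; case: (ltngtP i j) => [|ji|/ord_inj e].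
  - exact: h.
  - by apply: (h j i) => //; rewrite eq_sym.
  - by rewrite e eqxx in ij.
have jl : j * N <= l by rewrite leq_mul2r -ltnS ltn_ord orbT.
exists (take (i * N) t), (drop (i * N) (take (j * N) t)), (drop (j * N) t).
have ijN : i * N + N <= j * N by rewrite -mulSnr leq_mul2r lt_ij orbT.
have e : take (i * N) t ++ drop (i * N) (take (j * N) t) = take (j * N) t.
  by rewrite -{2}(cat_take_drop (i * N) (take (j * N) t)) take_takel //; lia.
split; first by rewrite catA e cat_take_drop.
  by rewrite size_drop size_takel ?st //; lia.
by rewrite e; exact/esym.
Qed.

(* The window [t a] at which the R-class of the prefixes drops does not occur
   earlier: [t] is long enough to contain a stable factor. *)
Lemma R_descent_window u x a t x1 x2 x3 v : G (x ++ a :: v) -> S u ->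
  Rle u (u ** prod x) -> ~ Rle u (u ** prod (rcons x a)) -> size t = l ->
  x = x3 ++ t -> x = x1 ++ t ++ a :: x2 -> False.
Proof.
move=> Gw Su le_u nle st ex3 ex1; apply: nle.
have [t1 [t2 [t3 [et Nt2 e12]]]] := prefix_repetition st.
(* The two occurrences of [t] may overlap; [y] leads from the end of [t1] in the earlier one to its
   end in the later one. *)
have [y ey] : exists y, x3 ++ t1 = (x1 ++ t1) ++ y.
  exists (drop (size (x1 ++ t1)) (x3 ++ t1)).
  rewrite -{1}(cat_take_drop (size (x1 ++ t1)) (x3 ++ t1)); congr (_ ++ _).
  have sz : size (x1 ++ t1) <= size (x3 ++ t1).
    rewrite !size_cat leq_add2r.
    by have := congr1 size ex1; rewrite ex3 !size_cat /=; lia.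
  have -> : take (size (x1 ++ t1)) (x3 ++ t1) = take (size (x1 ++ t1)) x.
    by rewrite ex3 et (catA x3) [RHS]takel_cat.
  by rewrite ex1 et -!catA catA take_size_cat.
have Sp w' : {subset w' <= x ++ a :: v} -> S (prod w').
  by move=> sw; apply: S_prod => z /sw; exact: G_S Gw.
have xw : {subset x <= x ++ a :: v} by move=> z zx; rewrite mem_cat zx.
have aw : a \in x ++ a :: v by rewrite mem_cat mem_head orbT.
have Ginf w' : infix w' x -> G w'.
  move=> w'x; apply: G_infix Gw _; exact: infix_catr.
have Gt2 : G t2.
  apply: Ginf; rewrite ex3 et; apply/infixP.
  by exists (x3 ++ t1), t3; rewrite -!catA.
have sub1 : {subset x1 ++ t1 <= x}.
  by move=> z; rewrite ex1 et !mem_cat => /orP[]->; rewrite ?orbT.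
have sub3 : {subset x3 ++ t1 <= x}.
  by move=> z; rewrite ex3 et !mem_cat => /orP[]->; rewrite ?orbT.
have subt3 : {subset t3 <= x}.
  by move=> z; rewrite ex3 et !mem_cat => ->; rewrite ?orbT.
have suby : {subset y <= x}.
  by move=> z zy; apply: sub3; rewrite ey mem_cat zy orbT.
(* Both g and g y are fixed by [t2]. Reading [t3 a] after g stays in the R-class, because the
   earlier occurrence lies inside [x]; stability carries this over to g y. *)
set g := u ** prod (x1 ++ t1).
have gs : g ** prod t2 = g.
  by rewrite /g -!opA -prod_cat -catA prod_cat e12 -prod_cat.
have gy : g ** prod y = u ** prod (x3 ++ t1).
  by rewrite /g -opA -prod_cat -ey.
have gys : g ** prod y ** prod t2 = g ** prod y.
  by rewrite gy -!opA -prod_cat -catA prod_cat e12 -prod_cat.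
have [r0 Sr0 er0] := le_u.
have ex : x = x1 ++ t1 ++ t2 ++ rcons t3 a ++ x2.
  by rewrite ex1 et -!catA cat_rcons.
have gx : g ** prod (rcons t3 a) ** (prod x2 ** r0 ** prod (x1 ++ t1)) = g.
  transitivity (u ** prod x ** r0 ** prod (x1 ++ t1)); last by rewrite -er0.
  by rewrite -{1}gs /g ex !prod_cat !opA.
have gyr : g ** prod y ** (prod (t2 ++ t3) ** r0 ** prod (x1 ++ t1)) = g.
  transitivity (u ** prod x ** r0 ** prod (x1 ++ t1)); last by rewrite -er0.
  by rewrite gy ex3 et !prod_cat !opA.
have [|||||z Sz ez] := G_stable Gt2 Nt2 _ _ _ _ _ gs gys gx gyr.
- by apply: SM => //; apply: Sp => z /sub1 /xw.
- by apply: Sp => z; rewrite mem_rcons in_cons => /orP[/eqP->|/subt3/xw].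
- by apply: Sp => z /suby /xw.
- apply: SM; last by apply: Sp => z /sub1 /xw.
  by apply: SM => //; apply: Sp => z zx2; apply: xw; rewrite ex !mem_cat zx2 !orbT.
- apply: SM; last by apply: Sp => z /sub1 /xw.
  by apply: SM => //; apply: Sp => z zx2; apply: xw; rewrite ex3 et mem_cat mem_cat zx2 !orbT.
apply: (Rle_trans (m := g)).
  exists (prod (drop (size (x1 ++ t1)) x) ** r0).
    by apply: SM => //; apply: Sp => z' /mem_drop /xw.
  rewrite /g opA -(opA u) -prod_cat.
  suff -> : (x1 ++ t1) ++ drop (size (x1 ++ t1)) x = x by [].
  by rewrite ex (catA x1) drop_size_cat.
exists z => //; rewrite {1}ez.
suff -> : g ** prod y ** prod (rcons t3 a) = u ** prod (rcons x a) by [].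
by rewrite -gys gy ex3 et !prod_rcons !prod_cat !opA.
Qed.

Definition windows_in (W : {set (l.+1).-tuple F}) w :=
  G w /\ forall t : (l.+1).-tuple F, infix t w -> t \in W.

Lemma windows_in_infix W w v : windows_in W w -> infix v w -> windows_in W v.
Proof.
move=> [Gw hw] vw; split; first exact: G_infix Gw vw.
by move=> t tv; apply: hw; exact: infix_trans tv vw.
Qed.

Lemma prod_split w p a : onth w p = Some a ->
  prod w = prod (take p w) ** a ** prod (drop p.+1 w).
Proof.
by move=> ha; rewrite {1}(onth_split ha) prod_cat big_cons opA.
Qed.

Let at_start w (k : nat) := ~ [/\ 0 < k, k.-1 < size w & True].

Let ldef_at_start : ldef at_start.
Proof. exact: ldef_not (ldef_prev (ldef_true F)). Qed.

Definition occurs (P0 : seq F -> nat -> Prop) t a w i :=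
  onth w i = Some a /\
  exists k, [/\ P0 w k, k + size t = i & take i w = take k w ++ t].

Lemma ldef_occurs P0 t a : ldef P0 -> ldef (occurs P0 t a).
Proof.
move=> /(ldef_before t)[P hP e]; apply: ldef_ext (ldef_and (ldef_letter a) hP).
move=> w i; split=> -[iw Pi]; split=> //; move: Pi;
  by rewrite e // ltnW // (onth_size iw).
Qed.

Variable W : {set (l.+1).-tuple F}.
Hypothesis IH : forall (t : (l.+1).-tuple F) m, t \in W ->
  ldef_on (windows_in (W :\ t)) (fun w => prod w = m).

(** The R-class must drop, and the letter [a] at which it first does is located either by the entire
    prefix before it, if this has length at most [l] ([K1]), or by the first occurrence of a window
    [t a] ([K2]). In the second case the prefix avoids [t a], so that [IH] defines its product;
    [IHu] handles the rest of the word. *)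
Lemma ldef_Rclass_descent u m : S u -> ~ Rle u m ->
  (forall a, S a -> ~ Rle u (u ** a) ->
    ldef_on (windows_in W) (fun w => Req (u ** a ** prod w) m)) ->
  ldef_on (windows_in W) (fun w => Req (u ** prod w) m).
Proof.
move=> Su num IHu.
pose c1 (i : l.-bseq F * F) := [/\ S (prod i.1), S i.2,
  Rle u (u ** prod i.1) & ~ Rle u (u ** prod (rcons i.1 i.2))].
pose K1 (i : l.-bseq F * F) w := exists p, [/\ first_at (occurs at_start i.1 i.2) w p,
  True & Req (u ** (prod i.1 ** i.2) ** prod (drop p.+1 w)) m].
pose c2 (i : l.-tuple F * F * F) := [/\ [tuple of rcons i.1.1 i.1.2] \in W,
  S i.1.2, S i.2, Rle u (u ** i.2) & ~ Rle u (u ** (i.2 ** i.1.2))].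
pose K2 (i : l.-tuple F * F * F) w := exists p,
  [/\ first_at (occurs (fun _ _ => True) i.1.1 i.1.2) w p,
  prod (take p w) = i.2 & Req (u ** (i.2 ** i.1.2) ** prod (drop p.+1 w)) m].
have X_drop w p : windows_in W w -> windows_in W (drop p w).
  by move=> Xw; apply: windows_in_infix Xw _; exact: infix_drop.
have hK1 i : c1 i -> ldef_on (windows_in W) (K1 i).
  case: i => s a [/= Ss Sa le_u nle].
  apply: (@ldef_on_cut F (windows_in W) (fun=> True) (occurs at_start s a)
    (fun=> True) (fun v => Req (u ** (prod s ** a) ** prod v) m)) => //.
  - by apply: ldef_occurs.
  - by exists (fun _ _ => True) => //; exact: ldef_true.
  - apply: IHu; first exact: SM.
    by move: nle; rewrite prod_rcons.
have hK2 i : c2 i -> ldef_on (windows_in W) (K2 i).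
  case: i => -[t a] m1 [/= tW Sa Sm le_u nle].
  apply: (@ldef_on_cut F (windows_in W) (windows_in (W :\ [tuple of rcons t a]))
    (occurs (fun _ _ => True) t a) (fun v => prod v = m1)
    (fun v => Req (u ** (m1 ** a) ** prod v) m)) => //.
  - by apply: ldef_occurs; exact: ldef_true.
  - exact: IH.
  - by apply: IHu => //; exact: SM.
  (* An occurrence of [t a] inside the prefix would end before [p], against the choice of [p] as the
     first one. *)
  - move=> w p [Gw hw] [pw tp np]; split.
      by apply: G_infix Gw _; exact: infix_take.
    move=> t' t'w; rewrite in_setD1 hw ?andbT; last first.
      by apply: infix_trans t'w _; exact: infix_take.
    apply/eqP => e; move: t'w; rewrite {}e /= => /infixP[y [z eyz]].
    have sz : size y + size t < p.
      have := congr1 size eyz; rewrite !size_cat size_rcons size_take pw => ->.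
      by rewrite addSn addnS ltnS addnA leq_addr.
    have [z' ew] : exists z', w = y ++ t ++ a :: z'.
      by exists (z ++ drop p w); rewrite -{1}(cat_take_drop p w) eyz -!catA cat_rcons.
    apply: (np _ sz); split.
      by rewrite ew catA onth_cat size_cat ltnn subnn.
    exists (size y); split=> //.
    by rewrite ew [in RHS]take_size_cat // catA -size_cat take_size_cat.
apply: ldef_on_ext (ldef_on_or (ldef_on_exists hK1) (ldef_on_exists hK2)).
move=> w [Gw hw]; split.
- move=> [[[s a] [[/= Ss Sa le_u nle] [p [[pw [ap [k [k0 kp tk]]] _] _ eq_m]]]]|
          [[[t a] m1] [[/= tW Sa Sm le_u nle] [p [[pw [ap _] _] pm eq_m]]]]].
    move: eq_m; rewrite (prod_split ap).
    suff -> : take p w = s by rewrite !opA.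
    rewrite tk; case: k k0 kp tk => [|k k0 kp tk]; first by rewrite take0.
    by case: k0; split=> //; lia.
  by move: eq_m; rewrite (prod_split ap) pm !opA.
- move=> eq_m.
  have : ~ Rle u (u ** prod w).
    by move=> le_u; apply: num; apply: Rle_trans le_u _; case: eq_m.
  move=> /R_descent[x [a [v [ew le_u nle]]]].
  have Sx : S (prod x).
    by apply: S_prod => z zx; apply: (G_S Gw); rewrite ew mem_cat zx.
  have Sa : S a by apply: (G_S Gw); rewrite ew mem_cat mem_head orbT.
  have xa : onth w (size x) = Some a by rewrite ew onth_cat ltnn subnn.
  have tx : take (size x) w = x by rewrite ew take_size_cat.
  have ep : u ** prod w = u ** (prod x ** a) ** prod (drop (size x).+1 w).
    by rewrite (prod_split xa) tx !opA.
  have [xl|/ltnW lx] := leqP (size x) l.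
    left; exists (Bseq xl, a); split=> //; exists (size x); split=> //.
      split=> /=.
      + by rewrite ew size_cat /=; lia.
      + by split=> //; exists 0; rewrite take0 tx; split=> // -[].
      + move=> j jx [_ [k [k0 kj _]]]; move: kj jx => /= <-; lia.
    by rewrite /= -ep.
  pose t := drop (size x - l) x.
  have st : size t = l by rewrite size_drop; lia.
  right; exists (Tuple (introT eqP st), a, prod x); split.
    split=> //=; last by rewrite -prod_rcons.
    apply: hw; apply/infixP; exists (take (size x - l) x), v.
    by rewrite /= cat_rcons catA cat_take_drop.
  exists (size x); split=> //; first last.
  - by rewrite /= -ep.
  - by rewrite tx.
  - split=> /=; first by rewrite ew size_cat /=; lia.
      split=> //; exists (size x - l); split=> //; first by lia.
      have <- : take (size x - l) x = take (size x - l) w.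
        by rewrite -{2}tx take_takel ?leq_subr.
      by rewrite tx cat_take_drop.
    move=> j jx [ja [k [_ kj tk]]].
    apply: (@R_descent_window u x a t (take k w) (drop j.+1 x)
      (take (size x - l) x) v) => //.
    + by rewrite -ew.
    + by rewrite cat_take_drop.
    + have xja : onth x j = Some a by rewrite -tx onth_take jx.
      rewrite catA -tk {1}(onth_split xja); congr (_ ++ _).
      by rewrite -{1}tx take_takel // ltnW.
Qed.

(** Induction on the number of elements below [u]. The class of [u] itself is reached exactly when
    there is no descent, so it is the complement of the union of the classes covered by
    [ldef_Rclass_descent]. *)
Lemma ldef_Rclass u m : S u ->
  ldef_on (windows_in W) (fun w => Req (u ** prod w) m).
Proof.
have [n] := ubnP #|[pred v | `[<Rle v u>]]|.
elim: n => // n IHn in u m *; rewrite ltnS => un Su.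
have key m' : ~ Rle u m' -> ldef_on (windows_in W) (fun w => Req (u ** prod w) m').
  move=> num; apply: ldef_Rclass_descent => // a Sa nle.
  apply: IHn; last exact: SM.
  apply: leq_trans un; apply: proper_card; apply/properP; split.
    apply/fintype.subsetP => v; rewrite !inE => le_v.
    exact: (Rle_trans le_v (Rle_mul _ Sa)).
  by exists u; [rewrite inE; exact: Rle_refl|apply/negP; rewrite inE].
have [um|] := pselect (Rle u m); last exact: key.
have le_w w : windows_in W w -> Rle (u ** prod w) u.
  by move=> [Gw _]; apply: Rle_mul; apply: S_prod => x; exact: G_S Gw.
have [mu|nmu] := pselect (Rle m u); last first.
  apply: ldef_on_ext (ldef_on_false _) => w /le_w wu; split=> // -[_ mw].
  by apply: nmu; apply: Rle_trans mw wu.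
apply: ldef_on_ext (ldef_on_not (ldef_on_exists key)) => w /le_w wu; split.
  move=> nex; have [uw|nuw] := pselect (Rle u (u ** prod w)).
    by split; [exact: Rle_trans wu um|exact: Rle_trans mu uw].
  by case: nex; exists (u ** prod w); split=> //; split; exact: Rle_refl.
move=> [wm mw] [m' [num [wm' m'w]]]; apply: num.
by apply: Rle_trans um _; apply: Rle_trans mw _.
Qed.

End RClasses.

Lemma ldef_on_sub (C : finType) (X X' K : seq C -> Prop) :
  (forall w, X' w -> X w) -> ldef_on X K -> ldef_on X' K.
Proof. by move=> XX [P hP e]; exists P => // w /XX; exact: e. Qed.

Section ReverseLaw.
Variables (F : Type) (one : F) (op : Monoid.law one).

(** R-classes for the opposite law are L-classes, so the preceding section applied to reversed words
    yields its own dual. *)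
Definition revop (x y : F) := op y x.

Let revopA : associative revop.
Proof. by move=> x y z; rewrite /revop Monoid.mulmA. Qed.
Let revop1x : left_id one revop.
Proof. by move=> x; rewrite /revop Monoid.mulm1. Qed.
Let revopx1 : right_id one revop.
Proof. by move=> x; rewrite /revop Monoid.mul1m. Qed.

HB.instance Definition _ := Monoid.isLaw.Build F one revop revopA revop1x revopx1.

Lemma prod_rev w :
  \big[revop/one]_(x <- rev w) x = \big[op/one]_(x <- w) x.
Proof.
elim: w => [|x w IH]; first by rewrite !big_nil.
by rewrite rev_cons -cats1 big_cat /= big_seq1 big_cons IH.
Qed.
End ReverseLaw.

Section StableProducts.
Variables (F : finType) (one : F) (op : Monoid.law one).
Local Notation "x ** y" := (op x y) (at level 40, left associativity).
Local Notation prod w := (\big[op/one]_(x <- w) x).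
Local Notation rop := (revop op : Monoid.law one).
Variables (S : F -> Prop) (S1 : S one).
Hypothesis SM : forall x y : F, S x -> S y -> S (x ** y).
Hypothesis H_trivial : forall x y : F,
  Req op S x y -> Req rop S x y -> x = y.
Variables (N : nat) (G : seq F -> Prop).
Hypothesis G_infix : forall w v, G w -> infix v w -> G v.
Hypothesis G_S : forall w x, G w -> x \in w -> S x.
Hypothesis G_stable : forall w, G w -> N <= size w ->
  Rstable op S (prod w) /\ Rstable rop S (prod w).

Local Notation windows_in := (@windows_in F N).

(** The R-class and the L-class determine the product as H-classes are trivial. Defining either one
    uses the products over fewer windows, whence the induction on [#|W|]. *)
Lemma ldef_prod_windows W m : ldef_on (windows_in G W) (fun w => prod w = m).
Proof.
have [n] := ubnP #|W|; elim: n => // n IHn in W m *; rewrite ltnS => Wn.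
have IH t m' : t \in W -> ldef_on (windows_in G (W :\ t)) (fun w => prod w = m').
  by move=> tW; apply: IHn; move: Wn; rewrite (cardsD1 t) tW.
have hR : ldef_on (windows_in G W) (fun w => Req op S (one ** prod w) m).
  by apply: ldef_Rclass => // w Gw Nw; case: (G_stable Gw Nw).
pose G' w := G (rev w).
pose W' := [set t : (#|F| * N).+1.-tuple F | [tuple of rev t] \in W].
have hL : ldef_on (windows_in G' W') (fun w =>
    Req rop S (revop op one (\big[rop/one]_(x <- w) x)) m).
  apply: ldef_Rclass => //.
  - by move=> x y Sx Sy; exact: SM.
  - by move=> w v Gw vw; apply: G_infix Gw _; rewrite infix_rev.
  - by move=> w x Gw xw; apply: (G_S Gw); rewrite mem_rev.
  - move=> w Gw; rewrite -(size_rev w) -{2}(revK w) prod_rev => Nw.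
    by case: (G_stable Gw Nw).
  - move=> t m'; rewrite inE => tW.
    have h : ldef_on (fun w => windows_in G' (W' :\ t) (rev w))
        (fun w => prod w = m').
      apply: ldef_on_sub (IH _ m' tW) => w [Gw hw]; split.
        by move: Gw; rewrite /G' revK.
      move=> u uw; have := hw [tuple of rev u]; rewrite /= infix_rev => /(_ uw).
      rewrite !inE => /andP[ut]; have -> : [tuple of rev [tuple of rev u]] = u.
        by apply: val_inj; rewrite /= revK.
      move=> ->; rewrite andbT; apply: contra ut => /eqP ->; apply/eqP.
      by apply: val_inj; rewrite /= revK.
    apply: ldef_on_ext (ldef_on_rev h) => w _.
    by rewrite -(prod_rev op) revK.
have {}hL : ldef_on (fun w => windows_in G W (rev w)) (fun w =>
    Req rop S (revop op one (\big[rop/one]_(x <- w) x)) m).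
  apply: ldef_on_sub hL => w [Gw hw]; split=> // t tw; rewrite inE; apply: hw.
  by rewrite /= infix_rev.
apply: ldef_on_ext (ldef_on_and hR (ldef_on_rev hL)) => w _.
rewrite prod_rev /revop Monoid.mulm1 Monoid.mul1m; split=> [[]|->].
  exact: H_trivial.
by split; split; apply: Rle_refl.
Qed.

Lemma ldef_prod m : ldef_on G (fun w => prod w = m).
Proof.
apply: ldef_on_sub (ldef_prod_windows [set: _] m) => w Gw; split=> // t _.
by rewrite inE.
Qed.

End StableProducts.

(** * Good positions and the factorization they induce *)

Section BetweennessPredicates.
Variable A : finType.
Implicit Types (P Q : seq A -> nat -> Prop) (w : seq A) (B S X : {set A}).

Definition avoids S w i j :=
  forall k a, i < k -> k < j -> onth w k = Some a -> a \notin S.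

Definition fut S P w i :=
  exists j, [/\ i < j, j < size w, avoids S w i j & P w j].
Definition past S P w i :=
  exists j, [/\ j < i, j < size w, avoids S w j i & P w j].

(* As for [ldef], the position [size w] serves as a right endmarker. *)
Inductive tdef : (seq A -> nat -> Prop) -> Prop :=
| tdef_true : tdef (fun _ _ => True)
| tdef_letter a : tdef (fun w i => onth w i = Some a)
| tdef_not P : tdef P -> tdef (fun w i => ~ P w i)
| tdef_and P Q : tdef P -> tdef Q -> tdef (fun w i => P w i /\ Q w i)
| tdef_fut S P : tdef P -> tdef (fut S P)
| tdef_past S P : tdef P -> tdef (past S P).

Lemma tdef_ext P Q : (forall w i, P w i <-> Q w i) -> tdef P -> tdef Q.
Proof.
by move=> PQ; have -> : P = Q by apply/funext => w; apply/funext => i; apply/propext.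
Qed.

Lemma tdef_or P Q : tdef P -> tdef Q -> tdef (fun w i => P w i \/ Q w i).
Proof.
move=> hP hQ; apply: tdef_ext (tdef_not (tdef_and (tdef_not hP) (tdef_not hQ))).
by move=> w i; rewrite not_andE !notE.
Qed.

Lemma tdef_const (c : Prop) : tdef (fun _ _ => c).
Proof.
have [hc|nc] := pselect c.
  by apply: tdef_ext tdef_true => w i; split.
by apply: tdef_ext (tdef_not tdef_true) => w i; split=> // -[].
Qed.

Lemma tdef_iff P (c : Prop) : tdef P -> tdef (fun w i => P w i <-> c).
Proof.
move=> hP; have [hc|nc] := pselect c.
  by apply: tdef_ext hP => w i; tauto.
by apply: tdef_ext (tdef_not hP) => w i; tauto.
Qed.

Lemma tdef_exists (I : finType) (P : I -> seq A -> nat -> Prop) :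
  (forall i, tdef (P i)) -> tdef (fun w k => exists i, P i w k).
Proof.
move=> hP; suff : tdef (fun w k => exists i, i \in enum I /\ P i w k).
  apply: tdef_ext => w k; split=> [[i [_ iP]]|[i iP]]; exists i => //.
  by rewrite mem_enum.
elim: (enum I) => [|i s IH].
  by apply: tdef_ext (tdef_const False) => w k; split=> // -[i []].
apply: tdef_ext (tdef_or (hP i) IH) => w k; split=> [[Pi|[j [js Pj]]]|].
- by exists i; rewrite mem_head.
- by exists j; rewrite in_cons js orbT.
- by move=> [j []]; rewrite in_cons => /orP[/eqP->|js] Pj; [left|right; exists j].
Qed.

Lemma tdef_forall (I : finType) (P : I -> seq A -> nat -> Prop) :
  (forall i, tdef (P i)) -> tdef (fun w k => forall i, P i w k).
Proof.
move=> hP; apply: tdef_ext (tdef_not (tdef_exists (fun i => tdef_not (hP i)))).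
move=> w k; split=> [nex i|all_P [i]]; last exact.
by apply: contrapT => nP; apply: nex; exists i.
Qed.

Variable B : {set A}.

(* The letter [b] at a good position does not reappear before all the other
   letters of [B] have been seen (or before the end of the word). *)
Definition good w t := exists b, onth w t = Some b /\
  forall c, c \in B /\ c != b -> fut [set b] (fun w i => onth w i = Some c) w t.

Lemma tdef_good : tdef good.
Proof.
apply: tdef_exists => b; apply: tdef_and; first exact: tdef_letter.
apply: tdef_forall => c.
apply: tdef_ext (tdef_or (tdef_not (tdef_const (c \in B /\ c != b)))
  (tdef_fut [set b] (tdef_letter c))) => w i; split.
  by move=> [h /h|].
by move=> h; have [/h|] := pselect (c \in B /\ c != b); [right|left].
Qed.

(** Goodness of [t] puts an occurrence of [c] before the next occurrence of its letter [d]. *)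
Lemma good_neq c d w t t' : c \in B -> d != c -> good w t -> t < t' ->
  onth w t = Some d -> onth w t' = Some d -> ~ avoids [set c] w t t'.
Proof.
move=> cB dc [b [-> h]] tt' [bd]; subst b => wd av.
have [|z [tz zw av' zc]] := h c; first by rewrite eq_sym.
have zt' : z < t'.
  rewrite ltnNge; apply/negP; rewrite leq_eqVlt => /orP[/eqP e|t'z].
    by move: zc dc; rewrite -e wd => -[->]; rewrite eqxx.
  by have := av' _ _ tt' t'z wd; rewrite inE eqxx.
by have := av _ _ tz zt' zc; rewrite inE eqxx.
Qed.

(* The good position is the last occurrence in [i, j) of the letter whose next
   occurrence from [j] on comes last; among several letters that do not occur
   from [j] on, it is the one whose last occurrence in [i, j) comes first. *)
Lemma full_good w i j c0 : j <= size w -> c0 \in B ->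
  (forall c, c \in B -> exists k, [/\ i <= k, k < j & onth w k = Some c]) ->
  exists k, [/\ i <= k, k < j & good w k].
Proof.
move=> jw c0B full.
pose f c := \max_(k < j | onth w k == Some c) k.
have fP c : c \in B -> [/\ i <= f c, f c < j, onth w (f c) = Some c &
    forall k, f c < k -> k < j -> onth w k <> Some c].
  move=> /full[k [ik kj kc]].
  have [|m mc em] := @eq_bigmax_cond _ [pred m : 'I_j | onth w m == Some c] (fun m => m : nat).
    by apply/card_gt0P; exists (Ordinal kj); rewrite inE /= kc.
  have fm : f c = m by exact: em.
  split.
  - apply: leq_trans ik _; apply: (@leq_bigmax_cond _ _ (fun m : 'I_j => m : nat) (Ordinal kj)).
    by rewrite /= kc.
  - by rewrite fm.
  - by rewrite fm; apply/eqP.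
  - move=> k' fk' k'j k'c; move: fk'; rewrite ltnNge => /negP; apply.
    apply: (@leq_bigmax_cond _ _ (fun m : 'I_j => m : nat) (Ordinal k'j)).
    by rewrite /= k'c.
pose n c := find (pred1 c) (drop j w).
(* Letters that do not occur from [j] on get keys above all the others, and larger ones the earlier
   their last occurrence is. *)
pose key c := if n c < size (drop j w) then n c else size w + (size w - f c).
have nP c : n c < size (drop j w) -> onth w (j + n c) = Some c.
  move=> h; have /(nth_find c) /= /eqP : has (pred1 c) (drop j w) by rewrite has_find.
  rewrite -/(n c) => e; have [x] := onth_some h.
  by rewrite -onth_drop => hx; rewrite hx -(@onth_nth _ c _ _ _ hx) e.
have nlt c k : k < size w -> j <= k -> onth w k = Some c -> n c <= k - j.
  move=> kw jk kc; rewrite leqNgt; apply/negP => /(before_find c) /=.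
  rewrite nth_drop subnKC // => /eqP; apply; exact: onth_nth.
case: (@arg_maxnP _ c0 (mem B) key c0B) => d dB dmax.
have [id dj dd dlast] := fP d dB.
exists (f d); split=> //; exists d; split=> // c [cB cd].
have [ic cj cc clast] := fP c cB.
have := dmax c cB; rewrite /key /geq /=; have [nc|nc] := ltnP (n c) (size (drop j w)).
  move=> key_d; exists (j + n c); split.
  - by rewrite ltn_addr.
  - by have := onth_size (nP _ nc).
  - move=> k a fk kn ka; rewrite inE; apply/eqP => e; subst a.
    case: (ltnP k j) => [kj|jk]; first exact: dlast _ fk kj ka.
    have := nlt _ _ (onth_size ka) jk ka; move: key_d.
    have [_|nd nle] := ltnP (n d) (size (drop j w)); first lia.
    by move: nc nd; rewrite size_drop; have := onth_size ka; lia.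
  - exact: nP.
move=> key_d.
have fdc : f d <= f c.
  move: key_d; have [nd|nd] := ltnP (n d) (size (drop j w)); last lia.
  by move: nd; rewrite size_drop; lia.
have {}fdc : f d < f c.
  rewrite ltn_neqAle fdc andbT; apply: contra cd => /eqP e.
  by move: cc; rewrite -e dd => -[->].
exists (f c); split=> //; first exact: leq_trans cj jw.
move=> k a fk kf ka; rewrite inE; apply/eqP => e; subst a.
by apply: (dlast _ fk _ ka); exact: ltn_trans cj.
Qed.

Definition no_good w i j := forall k, i < k -> k < j -> ~ good w k.

Definition futU S Q w i :=
  exists j, [/\ i < j, j < size w, avoids S w i j, no_good w i j & Q w j].
Definition pastU S Q w i :=
  exists j, [/\ j < i, j < size w, avoids S w j i, no_good w j i & Q w j].

(** The set of such [d] is the finite memory that the two ends of a factor without [c] compare;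
    [good_upto] is the same memory just after [z], with [z] itself counted. *)
Definition good_before c d w j := d != c /\
  past [set c] (fun w t => good w t /\ onth w t = Some d) w j.
Definition good_upto c d w z := onth w z <> Some c /\
  (good_before c d w z \/ good w z /\ onth w z = Some d).

Lemma tdef_good_before c d : tdef (good_before c d).
Proof.
apply: tdef_and; first exact: tdef_const.
by apply: tdef_past; apply: tdef_and; [exact: tdef_good|exact: tdef_letter].
Qed.

Lemma tdef_good_upto c d : tdef (good_upto c d).
Proof.
apply: tdef_and; first exact: tdef_not (tdef_letter c).
apply: tdef_or; first exact: tdef_good_before.
by apply: tdef_and; [exact: tdef_good|exact: tdef_letter].
Qed.

Lemma avoidsW S S' w i j i' j' : S' \subset S -> i <= i' -> j' <= j ->
  avoids S w i j -> avoids S' w i' j'.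
Proof.
move=> SS ii jj av k a ik kj ka; have ik' : i < k by lia.
have kj' : k < j by lia.
by apply: contra (av k a ik' kj' ka) => /(fintype.subsetP SS).
Qed.

(* In a factor without [c] good positions carry distinct letters, so that the
   set of their letters shows whether a good position has been passed. *)
Lemma no_goodE c w z j : c \in B -> z < j -> j <= size w ->
  avoids [set c] w z j ->
  no_good w z j <-> forall d, good_before c d w j <-> good_upto c d w z.
Proof.
move=> cB zj jw av; split=> [ng d|same t zt tj gt]; first split.
- move=> [dc [t [tj tw avt [gt td]]]].
  have tz : t <= z by rewrite leqNgt; apply/negP => zt; exact: (ng t).
  move: tz; rewrite leq_eqVlt => /orP[/eqP tz|tz].
    subst t; split; last by right.
    by rewrite td => -[e]; move: dc; rewrite e eqxx.
  split; last first.
    by left; split=> //; exists t; split=> //; apply: avoidsW avt => //; exact: ltnW.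
  by move=> zc; have := avt _ _ tz zj zc; rewrite inE eqxx.
- move=> [nzc [[dc [t [tz tw avt [gt td]]]]|[gz zd]]].
    split=> //; exists t; split=> //; first exact: ltn_trans zj.
    move=> k a tk kj ka; case: (ltngtP k z) => [kz|zk|e]; first exact: avt ka.
      exact: av ka.
    by subst k; rewrite inE; apply/eqP => e; subst a.
  split; last by exists z; split=> //; lia.
  by apply/eqP => e; subst d.
- have [d [td _]] := gt.
  have dc : d != c by have := av _ _ zt tj td; rewrite inE.
  have /same[nzc] : good_before c d w j.
    split=> //; exists t; split=> //; first exact: leq_trans jw.
    by apply: avoidsW av => //; exact: ltnW.
  case=> [[_ [t' [t'z t'w avt [gt' t'd]]]]|[gz zd]].
    apply: (good_neq cB dc gt' (ltn_trans t'z zt) t'd td) => k a tk kt ka.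
    case: (ltngtP k z) => [kz|zk|e]; first exact: avt ka.
      by apply: av ka => //; exact: ltn_trans tj.
    by subst k; rewrite inE; apply/eqP => e; subst a.
  apply: (good_neq cB dc gz zt zd td).
  by apply: avoidsW av => //; exact: ltnW.
Qed.

Definition over w := {subset w <= B}.

Lemma avoidsU S S' w i j :
  avoids (S :|: S') w i j <-> avoids S w i j /\ avoids S' w i j.
Proof.
split=> [av|[av av'] k a ik kj ka]; last first.
  by rewrite inE negb_or (av _ _ ik kj ka) (av' _ _ ik kj ka).
by split=> k a ik kj ka; have := av _ _ ik kj ka; rewrite inE negb_or => /andP[].
Qed.

Lemma no_good_missing w z j : over w -> z < j -> j <= size w -> no_good w z j ->
  exists2 c, c \in B & avoids [set c] w z j.
Proof.
move=> ow zj jw ng; apply: contrapT => nex.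
(* The letter at [z] shows that [B] is nonempty, as [full_good] requires. *)
have [x zx] := onth_some (leq_trans zj jw).
have xB : x \in B by apply: ow; apply/onthP; exists z.
have [|k [zk kj gk]] := @full_good w z.+1 j x jw xB; last exact: (ng k).
move=> c cB; apply: contrapT => nk; apply: nex; exists c => // k a zk kj ka.
by rewrite inE; apply/eqP => e; apply: nk; exists k; rewrite -e.
Qed.

(** [no_good w z j] relates two positions. Guessing a letter [c] missing from the factor and the
    memory [X] splits it into one condition on [z] and one on [j]. *)
Lemma tdef_futU S Q : tdef Q ->
  exists2 P, tdef P & forall w z, over w -> P w z <-> futU S Q w z.
Proof.
move=> hQ; exists (fun w z => exists c, (c \in B) /\ exists X : {set A},
  (forall d, good_upto c d w z <-> d \in X) /\
  fut (S :|: [set c]) (fun w j => (forall d, good_before c d w j <-> d \in X) /\ Q w j) w z).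
  apply: tdef_exists => c; apply: tdef_and; first exact: tdef_const.
  apply: tdef_exists => X; apply: tdef_and.
    by apply: tdef_forall => d; apply: tdef_iff; exact: tdef_good_upto.
  apply: tdef_fut; apply: tdef_and => //.
  by apply: tdef_forall => d; apply: tdef_iff; exact: tdef_good_before.
move=> w z ow; split.
  move=> [c [cB [X [eX [j [zj jw /avoidsU[avS avc] [eX' Qj]]]]]]].
  exists j; split=> //; apply/(no_goodE cB zj (ltnW jw) avc) => d.
  by rewrite eX eX'.
move=> [j [zj jw avS ng Qj]].
have [c cB avc] := no_good_missing ow zj (ltnW jw) ng.
exists c; split=> //; exists [set d | `[<good_upto c d w z>]]%SET.
have e := (no_goodE cB zj (ltnW jw) avc).1 ng.
split=> [d|]; first by rewrite inE asboolE.
exists j; split=> //; first by apply/avoidsU.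
by split=> // d; rewrite inE asboolE.
Qed.

Lemma tdef_pastU S Q : tdef Q ->
  exists2 P, tdef P & forall w z, over w -> z <= size w -> P w z <-> pastU S Q w z.
Proof.
move=> hQ; exists (fun w z => exists c, (c \in B) /\ exists X : {set A},
  (forall d, good_before c d w z <-> d \in X) /\
  past (S :|: [set c]) (fun w j => (forall d, good_upto c d w j <-> d \in X) /\ Q w j) w z).
  apply: tdef_exists => c; apply: tdef_and; first exact: tdef_const.
  apply: tdef_exists => X; apply: tdef_and.
    by apply: tdef_forall => d; apply: tdef_iff; exact: tdef_good_before.
  apply: tdef_past; apply: tdef_and => //.
  by apply: tdef_forall => d; apply: tdef_iff; exact: tdef_good_upto.
move=> w z ow zw; split.
  move=> [c [cB [X [eX [j [jz jw /avoidsU[avS avc] [eX' Qj]]]]]]].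
  exists j; split=> //; apply/(no_goodE cB jz zw avc) => d.
  by rewrite eX eX'.
move=> [j [jz jw avS ng Qj]].
have [c cB avc] := no_good_missing ow jz zw ng.
exists c; split=> //; exists [set d | `[<good_before c d w z>]]%SET.
have e := (no_goodE cB jz zw avc).1 ng.
split=> [d|]; first by rewrite inE asboolE.
exists j; split=> //; first by apply/avoidsU.
by split=> // d; rewrite inE asboolE e.
Qed.

Definition gap w p q := [/\ p <= q, q <= size w,
  forall k, p <= k -> k < q -> ~ good w k, q = size w \/ good w q &
  p = 0 \/ good w p.-1].

Lemma onth_slice w p q i :
  onth (drop p (take q w)) i = if p + i < q then onth w (p + i) else None.
Proof. by rewrite onth_drop onth_take. Qed.

Lemma avoids_slice S w p q i j : p <= i -> j <= q ->
  avoids S (drop p (take q w)) (i - p) (j - p) <-> avoids S w i j.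
Proof.
move=> pi jq; split=> av k a ik kj ka.
  apply: (av (k - p)); [lia|lia|rewrite onth_slice subnKC; last lia].
  by rewrite (leq_trans kj).
move: ka; rewrite onth_slice; case: ifP => // pk; apply: av; lia.
Qed.

(** [futU] and [pastU] cannot leave a gap, since it is delimited by good positions or by the ends of
    the word. The endmarker of the slice is [q], where [w] may carry a letter and continue to the
    right; the guards [~ good] hide both. *)
Lemma tdef_gap P : tdef P -> exists2 P', tdef P' &
  forall w p q z, over w -> gap w p q -> p <= z -> z <= q ->
    P' w z <-> P (drop p (take q w)) (z - p).
Proof.
have sz w p q : gap w p q -> size (drop p (take q w)) = q - p.
  by move=> [pq qw _ _ _]; rewrite size_drop size_takel.
elim=> [|a|{}P _ [P' hP' e]|{}P Q _ [P' hP' e] _ [Q' hQ' e']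
  |S {}P _ [P' hP' e]|S {}P _ [P' hP' e]].
- by exists (fun _ _ => True); first exact: tdef_true.
- exists (fun w z => onth w z = Some a /\ ~ good w z).
    by apply: tdef_and; [exact: tdef_letter|exact: tdef_not tdef_good].
  move=> w p q z ow [pq qw ng gq gp] pz zq; rewrite onth_slice subnKC //.
  case: ltnP => [lt_zq|qz]; first by split=> [[]|za] //; split=> //; exact: ng.
  have -> : z = q by lia.
  split=> // -[qa]; case: gq => // qs; move: qa; rewrite onth_default //; lia.
- exists (fun w i => ~ P' w i); first exact: tdef_not.
  by move=> w p q z ow g pz zq; rewrite (e _ _ _ _ ow g).
- exists (fun w i => P' w i /\ Q' w i); first exact: tdef_and.
  by move=> w p q z ow g pz zq; rewrite (e _ _ _ _ ow g) // (e' _ _ _ _ ow g).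
- have [R hR eR] := tdef_futU S (tdef_and (tdef_not tdef_good) hP').
  exists (fun w z => ~ good w z /\ R w z).
    by apply: tdef_and => //; exact: tdef_not tdef_good.
  move=> w p q z ow g pz zq; have [pq qw ng gq gp] := g.
  rewrite eR //; split.
    move=> [ngz [j [zj jw av ngj [nj Pj]]]].
    have jq : j < q.
      rewrite ltnNge; apply/negP => qj.
      have [|gq'] := gq; first lia.
      case: (ltngtP z q) => [lt_zq||ezq]; [|lia|by rewrite ezq in ngz].
      move: qj; rewrite leq_eqVlt => /orP[/eqP ej|]; first by rewrite ej in gq'.
      by move=> qj; exact: (ngj q).
    exists (j - p); rewrite sz //; split; [lia|lia| |].
      by apply/avoids_slice => //; exact: ltnW.
    by apply/(e _ _ _ _ ow g) => //; [lia|exact: ltnW].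
  move=> [j]; rewrite sz // => -[zj jq av Pj].
  have {}zj : z < p + j by lia.
  have {}jq : p + j < q by lia.
  split; first by apply: ng => //; lia.
  exists (p + j); split=> //.
  + exact: leq_trans qw.
  + by apply/(@avoids_slice _ _ p q) => //; [exact: ltnW|rewrite addKn].
  + by move=> k zk kj; apply: ng; lia.
  + split; first by apply: ng => //; lia.
    by apply/(e _ p q) => //; [lia|lia|rewrite addKn].
- have [R hR eR] := tdef_pastU S (tdef_and (tdef_not tdef_good) hP').
  exists R => // w p q z ow g pz zq; have [pq qw ng gq gp] := g.
  rewrite eR //; last exact: leq_trans qw.
  split.
    move=> [j [jz jw av ngj [nj Pj]]].
    have pj : p <= j.
      rewrite leqNgt; apply/negP => jp.
      have [|gp'] := gp; first lia.
      have : j <= p.-1 by lia.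
      rewrite leq_eqVlt => /orP[/eqP ej|]; first by rewrite ej in nj.
      by move=> jp'; apply: (ngj p.-1) => //; lia.
    exists (j - p); rewrite sz //; split; [lia|lia| |].
      exact/avoids_slice.
    by apply/(e _ _ _ _ ow g) => //; lia.
  move=> [j]; rewrite sz // => -[jz jq av Pj].
  exists (p + j); split; [lia|lia| | |].
  + by apply/(@avoids_slice _ _ p q) => //; [lia|rewrite addKn].
  + by move=> k zk kj; apply: ng; lia.
  + split; first by apply: ng => //; lia.
    by apply/(e _ p q) => //; [lia|lia|rewrite addKn].
Qed.

End BetweennessPredicates.

Lemma map_filter_iota_cat (T : Type) (f : nat -> T) (p : pred nat) a n s1 s2 :
  [seq f i | i <- iota a n & p i] = s1 ++ s2 ->
  exists n1, [/\ n1 <= n, s1 = [seq f i | i <- iota a n1 & p i] &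
    s2 = [seq f i | i <- iota (a + n1) (n - n1) & p i]].
Proof.
elim: n a s1 => [|n IH] a s1.
  by case: s1 => // /= <-; exists 0.
case: s1 => [e|x s1] /=; first by exists 0; rewrite addn0 subn0 e.
case: (ifP (p a)) => pa /= => [[<-] /IH|/(IH _ (x :: s1))] [n1 [n1n e1 ->]];
  exists n1.+1; by rewrite /= pa /= -e1 addSnnS.
Qed.

Section GoodFactorization.
Variables (A F : finType) (one : F) (op : Monoid.law one) (h : A -> F).
Local Notation "x ** y" := (op x y) (at level 40, left associativity).
Local Notation prod c := (\big[op/one]_(x <- c) x).
Definition value (w : seq A) := \big[op/one]_(a <- w) h a.
Variable B : {set A}.
Local Notation good := (good B).
Local Notation over := (over B).
Implicit Types (w : seq A).

Lemma value_cat w w' : value (w ++ w') = value w ** value w'.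
Proof. exact: big_cat. Qed.

Lemma value_rcons w a : value (rcons w a) = value w ** h a.
Proof. by rewrite -cats1 value_cat /value big_seq1. Qed.

Definition image_of x := exists2 w, over w & value w = x.

Lemma image_one : image_of one.
Proof. by exists [::]; rewrite /value ?big_nil. Qed.

Lemma image_mul x y : image_of x -> image_of y -> image_of (x ** y).
Proof.
move=> [u ou <-] [v ov <-]; exists (u ++ v); last exact: value_cat.
by move=> a; rewrite mem_cat => /orP[/ou|/ov].
Qed.

Fixpoint gap_start w g :=
  if g is g'.+1 then if `[<good w g'>] then g else gap_start w g' else 0.

Lemma gap_start_le w g : gap_start w g <= g.
Proof. by elim: g => //= g IH; case: ifP => // _; exact: leqW. Qed.

Lemma gap_start_bad w g k : gap_start w g <= k -> k < g -> ~ good w k.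
Proof.
elim: g => //= g IH; case: ifP => [_|/negbT/asboolPn ng] gk.
  by rewrite ltnS leqNgt gk.
by rewrite ltnS leq_eqVlt => /orP[/eqP->|]; [|exact: IH].
Qed.

Lemma gap_start_good w g : gap_start w g = 0 \/ good w (gap_start w g).-1.
Proof. by elim: g => [|g IH] /=; [left|case: ifP => // /asboolP; right]. Qed.

Lemma good_gap_start w g t : good w t -> t < g -> t < gap_start w g.
Proof. by move=> gt tg; rewrite ltnNge; apply/negP => gk; exact: (gap_start_bad gk tg gt). Qed.

Lemma good_size w t : good w t -> t < size w.
Proof. by move=> [b [tb _]]; exact: onth_size tb. Qed.

Lemma gap_startP w g : g = size w \/ good w g -> gap B w (gap_start w g) g.
Proof.
move=> hg; split=> //.
- exact: gap_start_le.
- by case: hg => [->|/good_size/ltnW].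
- by move=> k; exact: gap_start_bad.
- exact: gap_start_good.
Qed.

Definition block w g := value (drop (gap_start w g) (take g.+1 w)).

Definition goods w a n := [seq i <- iota a n | `[<good w i>]].

Definition code w := [seq block w g | g <- goods w 0 (size w)].

(** The default [size w] sends the endmarker of the code to that of the word, so that
    [tdef_pullback] also covers evaluation at the end. *)
Definition pos w j := nth (size w) (goods w 0 (size w)) j.

(** Consecutive blocks are adjacent factors: each begins just after the good position that ends the
    preceding one. *)
Lemma prod_blocks w a n : a + n <= size w ->
  prod [seq block w g | g <- goods w a n] =
  value (drop (gap_start w a) (take (gap_start w (a + n)) w)).
Proof.
elim: n => [|n IH] aw.
  rewrite addn0 big_nil drop_oversize /value ?big_nil //.
  by rewrite size_take; case: ltnP.
rewrite /goods -addn1 iotaD filter_cat map_cat big_cat /= IH; last lia.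
rewrite addn1 addnS /=; case: ifP => _ /=; last by rewrite big_nil Monoid.mulm1.
rewrite big_seq1 /block -value_cat; congr value.
have le1 : gap_start w a <= gap_start w (a + n).
  elim: n {IH aw} => [|n IH]; first by rewrite addn0.
  rewrite addnS /=; case: ifP => // _.
  by apply: leq_trans (gap_start_le _ _) _; rewrite -addnS leq_addr.
have le2 : gap_start w (a + n) <= (a + n).+1 by apply: leqW; exact: gap_start_le.
set p := gap_start w a in le1 *; set q := gap_start w (a + n) in le1 le2 *.
have -> : take q w = take q (take (a + n).+1 w) by rewrite take_takel.
have qs : q <= size (take (a + n).+1 w) by rewrite size_takel //; lia.
rewrite -{3}(cat_take_drop q (take (a + n).+1 w)) drop_cat size_takel //.
case: ltnP => // qp; have -> : p = q by lia.
by rewrite subnn drop0 drop_oversize // size_takel.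
Qed.

Lemma value_code w :
  value w = prod (code w) ** value (drop (gap_start w (size w)) w).
Proof.
rewrite /code prod_blocks // drop0 add0n -value_cat.
by rewrite cat_take_drop.
Qed.

Lemma mem_goods w a n t : (t \in goods w a n) = (a <= t < a + n) && `[<good w t>].
Proof. by rewrite mem_filter mem_iota andbC. Qed.

Lemma size_code w : size (code w) = size (goods w 0 (size w)).
Proof. exact: size_map. Qed.

Lemma pos_good w j : j < size (code w) -> good w (pos w j).
Proof.
rewrite size_code => jk; have := mem_nth (size w) jk.
by rewrite mem_goods => /andP[_ /asboolP].
Qed.

Lemma pos_size w : pos w (size (code w)) = size w.
Proof. by rewrite /pos size_code nth_default. Qed.

Lemma pos_le w j : j <= size (code w) -> pos w j <= size w.
Proof.
rewrite leq_eqVlt => /orP[/eqP->|/pos_good/good_size/ltnW //].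
by rewrite pos_size.
Qed.

Lemma pos_onto w i : good w i -> exists2 j, j < size (code w) & pos w j = i.
Proof.
move=> gi; have ig : i \in goods w 0 (size w).
  by rewrite mem_goods /= add0n good_size //; apply/asboolP.
by exists (index i (goods w 0 (size w))); [rewrite size_code index_mem|exact: nth_index].
Qed.

Lemma pos_lt w j j' : j < j' -> j' <= size (code w) -> pos w j < pos w j'.
Proof.
move=> jj'; rewrite leq_eqVlt => /orP[/eqP e|j'k].
  by rewrite e pos_size; apply: good_size; apply: pos_good; rewrite -e.
have s : sorted ltn (goods w 0 (size w)).
  by apply: sorted_filter; [exact: ltn_trans|exact: iota_ltn_sorted].
rewrite size_code in j'k; apply: (sorted_ltn_nth ltn_trans _ s) => //.
by rewrite inE; exact: ltn_trans j'k.
Qed.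

Lemma pos_ltE w j j' : j <= size (code w) -> j' <= size (code w) ->
  (pos w j < pos w j') = (j < j').
Proof.
move=> jk j'k; case: (ltngtP j j') => [lt|lt|->].
- exact: pos_lt.
- by apply/negbTE; rewrite -leqNgt ltnW // pos_lt.
- by rewrite ltnn.
Qed.

Lemma no_good_pos w j : j < size (code w) -> no_good B w (pos w j) (pos w j.+1).
Proof.
move=> jk k jlt ltj /pos_onto[i ik e].
by move: jlt ltj; rewrite -e !pos_ltE //; lia.
Qed.

Lemma pos_next w j j' : j < j' -> j' < size (code w) ->
  no_good B w (pos w j) (pos w j') -> j' = j.+1.
Proof.
move=> jj' j'k ng; apply/eqP; rewrite eqn_leq jj' andbT leqNgt; apply/negP => lt.
by apply: (ng (pos w j.+1)); rewrite ?pos_ltE //; try lia; apply: pos_good; lia.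
Qed.

Hypothesis gap_values : forall m, exists V, tdef V /\
  forall w p q, over w -> gap B w p q ->
    V w q <-> value (drop p (take q w)) = m.

(** A letter of the code is the value of a gap, definable by [gap_values], times the value of the
    letter at the good position. *)
Lemma tdef_block m : exists2 V, tdef V & forall w j, over w ->
  j <= size (code w) -> V w (pos w j) <-> onth (code w) j = Some m.
Proof.
have [V hV] := choice gap_values.
exists (fun w i => good w i /\ exists a, onth w i = Some a /\
  exists m', m' ** h a = m /\ V m' w i).
  apply: tdef_and; first exact: tdef_good.
  apply: tdef_exists => a; apply: tdef_and; first exact: tdef_letter.
  apply: tdef_exists => m'; apply: tdef_and; first exact: tdef_const.
  by case: (hV m').
move=> w j ow; rewrite leq_eqVlt => /orP[/eqP->|jk].
  rewrite pos_size [onth (code w) _]onth_default //; split=> // -[gs _].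
  by have := good_size gs; rewrite ltnn.
have gj := pos_good jk; have gp := gap_startP (or_intror gj).
have [a ja] := onth_some (good_size gj).
have bj : block w (pos w j) =
    value (drop (gap_start w (pos w j)) (take (pos w j) w)) ** h a.
  rewrite /block (takeS_onth ja) -value_rcons drop_rcons //.
  by rewrite size_takel ?gap_start_le // ltnW // good_size.
have -> : onth (code w) j = Some (block w (pos w j)).
  rewrite onth_map; rewrite size_code in jk; have [x jx] := onth_some jk.
  by rewrite jx /pos (@onth_nth _ (size w) _ _ _ jx).
split.
  move=> [_ [a' [ja' [m' [<- Vm]]]]]; move: ja'; rewrite ja => -[<-].
  rewrite bj; congr (Some (_ ** _)).
  by have [_ /(_ _ _ _ ow gp)[]] := hV m'; auto.
move=> [em]; split=> //; exists a; split=> //.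
exists (value (drop (gap_start w (pos w j)) (take (pos w j) w))).
split; first by rewrite -bj.
exact/((hV _).2 _ _ _ ow gp).
Qed.

Lemma avoids0 w i j : avoids finset.set0 w i j.
Proof. by move=> k a _ _ _; rewrite inE. Qed.

(** Positions of the code become good positions. The order is inherited, and successor and
    predecessor become [futU] and [pastU], with no good position in between. *)
Lemma tdef_pullback (Q : seq F -> nat -> Prop) : ldef Q ->
  exists2 P, tdef P & forall w j, over w -> j <= size (code w) ->
    P w (pos w j) <-> Q (code w) j.
Proof.
elim=> [|m|{}Q _ [P hP e]|Q1 Q2 _ [P1 hP1 e1] _ [P2 hP2 e2]
  |{}Q _ [P hP e]|{}Q _ [P hP e]|{}Q _ [P hP e]|{}Q _ [P hP e]].
- by exists (fun _ _ => True); first exact: tdef_true.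
- exact: tdef_block.
- exists (fun w i => ~ P w i); first exact: tdef_not.
  by move=> w j ow jk; rewrite e.
- exists (fun w i => P1 w i /\ P2 w i); first exact: tdef_and.
  by move=> w j ow jk; rewrite e1 // e2.
- eexists; first exact: (tdef_fut finset.set0 (tdef_and (tdef_good B) hP)).
  move=> w j ow jk; split=> [[i [ji iw _ [gi Pi]]]|[j' [jj' j'k Qj']]].
    have [j' j'k ij'] := pos_onto gi; subst i.
    exists j'; split=> //; last by apply/e => //; exact: ltnW.
    by move: ji; rewrite pos_ltE // ltnW.
  have gj' := pos_good j'k.
  exists (pos w j'); split; [|exact: good_size|exact: avoids0|split=> //].
    by rewrite pos_ltE // ltnW.
  by apply/e => //; exact: ltnW.
- eexists; first exact: (tdef_past finset.set0 (tdef_and (tdef_good B) hP)).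
  move=> w j ow jk; split=> [[i [ji iw _ [gi Pi]]]|[j' [jj' j'k Qj']]].
    have [j' j'k ij'] := pos_onto gi; subst i.
    exists j'; split=> //; last by apply/e => //; exact: ltnW.
    by move: ji; rewrite pos_ltE // ltnW.
  have gj' := pos_good j'k.
  exists (pos w j'); split; [|exact: good_size|exact: avoids0|split=> //].
    by rewrite pos_ltE // ltnW.
  by apply/e => //; exact: ltnW.
- have [R hR eR] := tdef_futU B finset.set0 (tdef_and (tdef_good B) hP).
  exists R => // w j ow jk; rewrite eR //.
  split=> [[i [ji iw _ ng [gi Pi]]]|[jk' Qj']].
    have [j' j'k ij'] := pos_onto gi; subst i.
    move: ji; rewrite pos_ltE ?(ltnW j'k) // => jj'.
    have ej := pos_next jj' j'k ng; subst j'.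
    by split=> //; apply/e => //; exact: ltnW.
  have gj' := pos_good jk'.
  exists (pos w j.+1); split; [|exact: good_size|exact: avoids0| |split=> //].
  + by rewrite pos_ltE // ltnW.
  + by apply: no_good_pos; exact: ltnW.
  + by apply/e => //; exact: ltnW.
- have [R hR eR] := tdef_pastU B finset.set0 (tdef_and (tdef_good B) hP).
  exists R => // w j ow jk; rewrite eR ?pos_le //.
  split=> [[i [ji iw _ ng [gi Pi]]]|[j0 jk' Qj']].
    have [j' j'k ij'] := pos_onto gi; subst i.
    move: ji; rewrite pos_ltE ?(ltnW j'k) // => jj'.
    have ej : j.-1 = j'.
      apply/eqP; rewrite eqn_leq; apply/andP; split; last lia.
      rewrite leqNgt; apply/negP => lt.
      by apply: (ng (pos w j'.+1)); rewrite ?pos_ltE //; try lia; apply: pos_good; lia.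
    by rewrite ej; split=> //; [lia|apply/e => //; exact: ltnW].
  have gj' := pos_good jk'.
  exists (pos w j.-1); split; [|exact: good_size|exact: avoids0| |split=> //].
  + by rewrite (pos_ltE (ltnW jk') jk); lia.
  + by have := no_good_pos jk'; rewrite prednK.
  + by apply/e => //; exact: ltnW.
Qed.

(** If the factor missed [c], then by [good_neq] its good positions would carry distinct letters,
    all different from [c], and there would be fewer than [#|B|] of them. *)
Lemma goods_full w a n : over w -> a + n <= size w ->
  #|B| <= size (goods w a n) ->
  {subset B <= drop (gap_start w a) (take (gap_start w (a + n)) w)}.
Proof.
move=> ow aw le_size c cB; apply: contraTT le_size => cslice; rewrite -ltnNge.
have nc k : gap_start w a <= k -> k < gap_start w (a + n) -> onth w k <> Some c.
  move=> ak ka kc; move/negP: cslice; apply; apply/onthP.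
  by exists (k - gap_start w a); rewrite onth_slice subnKC // ka.
have range t : t \in goods w a n ->
    [/\ good w t, gap_start w a <= t & t < gap_start w (a + n)].
  rewrite mem_goods => /andP[/andP[at_ ta] /asboolP gt]; split=> //.
    exact: leq_trans (gap_start_le _ _) at_.
  exact: good_gap_start.
pose letter t := odflt c (onth w t).
have letterE t : t \in goods w a n -> onth w t = Some (letter t).
  by move=> /range[[b [tb _]] _ _]; rewrite /letter tb.
have letter_neq t : t \in goods w a n -> letter t != c.
  move=> tg; have [_ at_ ta] := range _ tg; apply/eqP => e.
  by apply: (nc t at_ ta); rewrite letterE // e.
have : uniq [seq letter t | t <- goods w a n].
  rewrite map_inj_in_uniq; first by apply: filter_uniq; exact: iota_uniq.
  move=> t t' tg tg'; wlog : t t' tg tg' / t < t'.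
    move=> wl; case: (ltngtP t t') => // lt e; first exact: wl e.
    by apply/esym/wl.
  move=> tt' e; have [gt at_ _] := range _ tg; have [_ _ t'a] := range _ tg'.
  case: (@good_neq _ B c (letter t) w t t') => //.
  - exact: letter_neq.
  - exact: letterE.
  - by rewrite e; exact: letterE.
  - move=> k b tk kt' kb; rewrite inE; apply/eqP => eb; subst b.
    by apply: (nc k _ _ kb); [apply: leq_trans at_ (ltnW tk)|exact: ltn_trans t'a].
move=> /uniq_leq_size -/(_ (enum (B :\ c))) le_s.
rewrite (cardsD1 c B) cB add1n ltnS -(size_map letter) cardE; apply: le_s.
move=> _ /mapP[t tg ->]; rewrite mem_enum in_setD1 letter_neq //=.
by apply: ow; apply/onthP; exists t; exact: letterE.
Qed.

Lemma tdef_value_step :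
  (forall u, over u -> {subset B <= u} ->
    Rstable op image_of (value u) /\ Rstable (revop op) image_of (value u)) ->
  (forall x y, Req op image_of x y -> Req (revop op) image_of x y -> x = y) ->
  forall m, exists2 P, tdef P &
    forall w, over w -> value w = m <-> P w (size w).
Proof.
move=> stable triv m.
(* Factors of codes rather than arbitrary words over [F]: only these are known to be stable, and
   [ldef_prod] asks for closure under factors. *)
pose G c := exists2 w, over w & infix c (code w).
have G_blocks c : G c -> exists w a n, [/\ over w, a + n <= size w &
    c = [seq block w g | g <- goods w a n]].
  move=> [w ow /infixP[s1 [s2]]]; rewrite /code /goods.
  move=> /map_filter_iota_cat[n1 [n1w _]] /esym/map_filter_iota_cat[n2 [n2w ec _]].
  by exists w, n1, n2; split=> //; lia.
have hG m1 : ldef_on G (fun c => prod c = m1).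
  (* By [goods_full], [#|B|] consecutive letters of a code come from a factor with all the letters
     of [B], to which [stable] applies. *)
  apply: (@ldef_prod F one op image_of image_one image_mul triv #|B|).
  - by move=> c v [w ow cw] vc; exists w => //; exact: infix_trans cw.
  - move=> c x Gc /(nthP one)[i]; have [w [a [n [ow aw ->]]]] := G_blocks _ Gc.
    rewrite size_map => ig <-; rewrite (nth_map 0) //.
    exists (drop (gap_start w (nth 0 (goods w a n) i)) (take (nth 0 (goods w a n) i).+1 w)) => //.
    by move=> b /mem_drop /mem_take; exact: ow.
  - move=> c Gc; have [w [a [n [ow aw ->]]]] := G_blocks _ Gc.
    rewrite size_map => le_size; rewrite prod_blocks //; apply: stable.
      by move=> b /mem_drop /mem_take; exact: ow.
    exact: goods_full.
have pull m1 : exists P, tdef P /\ forall w, over w ->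
    prod (code w) = m1 <-> P w (size w).
  have [Q hQ eQ] := hG m1; have [P hP eP] := tdef_pullback hQ.
  exists P; split=> // w ow; rewrite -{1}pos_size eP //; apply: eQ.
  by exists w => //; exact: infix_refl.
have [P hP] := choice pull.
have [V hV] := choice gap_values.
exists (fun w i => exists m1, exists m2, m1 ** m2 = m /\ (P m1 w i /\ V m2 w i)).
  apply: tdef_exists => m1; apply: tdef_exists => m2.
  apply: tdef_and; first exact: tdef_const.
  by apply: tdef_and; [case: (hP m1)|case: (hV m2)].
move=> w ow; have gp := gap_startP (or_introl (erefl (size w))).
rewrite value_code; split=> [<-|[m1 [m2 [<- []]]]].
  exists (prod (code w)), (value (drop (gap_start w (size w)) w)); split=> //.
  split; first by apply/(hP _).2.
  by apply/((hV _).2 w _ _ ow gp); rewrite take_size.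
move=> /((hP _).2 w ow)-> /((hV _).2 w _ _ ow gp).
by rewrite take_size => ->.
Qed.

End GoodFactorization.

(** * Induction on the content *)

Section ContentInduction.
Variables (A F : finType) (one : F) (op : Monoid.law one) (h : A -> F).
Local Notation value := (value op h).
Local Notation image_of := (image_of op h).
Hypothesis stable : forall (B : {set A}) u, over B u -> {subset B <= u} ->
  Rstable op (image_of B) (value u) /\ Rstable (revop op) (image_of B) (value u).
Hypothesis triv : forall (B : {set A}) x y,
  Req op (image_of B) x y -> Req (revop op) (image_of B) x y -> x = y.

Lemma gap_missing (B : {set A}) w p q c0 : c0 \in B -> gap B w p q ->
  exists2 c, c \in B & c \notin drop p (take q w).
Proof.
move=> c0B [pq qw ng _ _]; apply: contrapT => nex.
have [|k [pk kq gk]] := @full_good _ B w p q c0 qw c0B; last exact: (ng k).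
move=> c cB; have : c \in drop p (take q w).
  by apply: contrapT => /negP nc; apply: nex; exists c.
move=> /onthP[i]; rewrite onth_slice; case: ifP => // iq ic.
by exists (p + i); rewrite leq_addr.
Qed.

(** By [gap_missing] each gap is a word over some [B :\ c], whose value [IHn] defines; [tdef_gap]
    moves this predicate from the gap to [w]. *)
Lemma tdef_value (B : {set A}) m : exists2 P, tdef P &
  forall w, over B w -> value w = m <-> P w (size w).
Proof.
have [n] := ubnP #|B|; elim: n => // n IHn in B m *; rewrite ltnS => Bn.
have [/eqP B0|/card_gt0P[c0 c0B]] := posnP #|B|.
  exists (fun _ _ => value [::] = m); first exact: tdef_const.
  move=> [|a w] //= ow; have := ow a (mem_head _ _).
  by move: B0; rewrite cards_eq0 => /eqP ->; rewrite inE.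
apply: tdef_value_step => //; [|exact: stable|exact: triv] => {}m.
have IH c : exists P, tdef P /\ (c \in B -> forall w, over (B :\ c) w ->
    value w = m <-> P w (size w)).
  have [cB|] := boolP (c \in B); last by exists (fun _ _ => True); split=> //; exact: tdef_true.
  have [|P hP eP] := IHn (B :\ c) m; last by exists P.
  by move: Bn; rewrite (cardsD1 c) cB.
have [P hP] := choice IH.
(* At the endmarker of the gap, absence of [c] from the past means that the whole gap misses [c]. *)
have hK : tdef (fun w i => exists c, c \in B /\
    (~ past finset.set0 (fun w i => onth w i = Some c) w i /\ P c w i)).
  apply: tdef_exists => c; apply: tdef_and; first exact: tdef_const.
  by apply: tdef_and; [apply: tdef_not; apply: tdef_past; exact: tdef_letter|case: (hP c)].
have [V hV eV] := tdef_gap B hK; exists V; split=> // w p q ow g.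
have [pq qw ng _ _] := g.
rewrite (eV _ _ _ _ ow g) //.
set v := drop p (take q w).
have sv : size v = q - p by rewrite size_drop size_takel.
have ov : over B v by move=> a /mem_drop /mem_take; exact: ow.
rewrite -sv; split.
  move=> [c [cB [nc]]]; have [_ /(_ cB v) e] := hP c.
  move=> Pv; apply/e => // a av; rewrite in_setD1 ov // andbT; apply/eqP => eac.
  have /onthP[i ic] := av; apply: nc; exists i.
  by rewrite (onth_size ic); split=> //; [exact: avoids0|rewrite ic eac].
move=> em; have [c cB cv] := gap_missing c0B g.
exists c; split=> //; split.
  by move=> [i [_ _ _ ic]]; move/negP: cv; apply; apply/onthP; exists i.
have [_ /(_ cB v) e] := hP c; apply/e => // a av.
rewrite in_setD1 ov // andbT; apply/eqP => eac.
by move: cv; rewrite -eac av.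
Qed.

End ContentInduction.

(** * Aperiodicity and stability in M_eDA *)

Section MonoidFacts.
Local Open Scope group_scope.
Variable M : monoidType.
Implicit Types (e f n x y g r : M).

Lemma idempotent_power x : finite_set [set: M] ->
  exists2 k, 0 < k & x ^+ k * x ^+ k = x ^+ k.
Proof.
move=> /finite_seqP[s Es].
pose t := [seq x ^+ i | i <- iota 0 (size s).+1].
have ts : {subset t <= s}.
  by move=> y _; have : [set: M]%classic y by []; rewrite Es.
have nu : ~~ uniq t.
  apply/negP => /uniq_leq_size /(_ ts).
  by rewrite size_map size_iota ltnn.
have [i [p [p0 e]]] : exists i p, 0 < p /\ x ^+ (i + p) = x ^+ i.
  move: nu => /(uniqPn 1)[i [j [ij]]]; rewrite size_map size_iota => js.
  rewrite !(nth_map 0) ?size_iota ?nth_iota ?add0n //; try lia.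
  move=> e; exists i, (j - i); split; first by lia.
  by rewrite subnKC // ltnW.
have step q m : i <= m -> x ^+ (m + q * p) = x ^+ m.
  move=> im; elim: q => [|q IH]; first by rewrite addn0.
  have -> : m + q.+1 * p = (i + p) + (m - i + q * p) by lia.
  by rewrite expgnDr e -expgnDr addnA subnKC.
(* A positive multiple of the period [p] that is at least the preperiod [i]. *)
exists (i.+1 * p)%N; first by rewrite muln_gt0.
rewrite -expgnDr step //.
by apply: leq_trans (leqnSn i) _; rewrite leq_pmulr.
Qed.

Lemma leJ_refl x : leJ x x.
Proof. by exists 1, 1; rewrite mul1g mulg1. Qed.

Lemma gen_aboveT e x : leJ e x -> gen_above e x.
Proof. by move=> ex N [_ /(_ x ex)]. Qed.

Lemma gen_above1 e : gen_above e 1.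
Proof. by have [] := gen_above_submonoid e. Qed.

Lemma gen_aboveM e x y : gen_above e x -> gen_above e y -> gen_above e (x * y).
Proof. by have [_] := gen_above_submonoid e; apply. Qed.

Lemma DA_idempotent f n : DA M -> f * f = f -> gen_above f n -> f * n * f = f.
Proof.
move=> [_ tr] ff fn; have := tr f ff; rewrite /trivial_monoid => tr1.
have h : f * n * f \in local_set f by rewrite inE; exists n.
have : [set: local_monoid ff]%classic (Sub (f * n * f) h) by [].
by rewrite tr1 => /(congr1 val).
Qed.

Section Local.
Variables (e : M) (ee : e * e = e).

Lemma to_local_subproof x : gen_above e x -> e * x * e \in local_set e.
Proof. by move=> ex; rewrite inE; exists x. Qed.

Definition to_local x (ex : gen_above e x) : local_monoid ee :=
  Sub (e * x * e) (to_local_subproof ex).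

(** The exponent is positive because the two monoids have different units, [e] and [1]. *)
Lemma val_localX (z : local_monoid ee) k : 0 < k -> val (z ^+ k) = val z ^+ k.
Proof.
case: k => // k _; elim: k => [|k IH]; first by rewrite !expg1.
by rewrite !(expgSr _ k.+1) -IH.
Qed.

Lemma val_local_absorb (z : local_monoid ee) : e * val z = val z /\ val z * e = val z.
Proof.
have h1 : 1 * z = z := mul1g z; have h2 : z * 1 = z := mulg1 z.
by split; [have := congr1 val h1|have := congr1 val h2].
Qed.

End Local.

Lemma finite_local e (ee : e * e = e) :
  finite_set [set: M] -> finite_set [set: local_monoid ee].
Proof.
move=> finM; pose g (m : M) : local_monoid ee :=
  @odflt {x : M | x \in local_set e} (1 : local_monoid ee) (insub m).
apply: sub_finite_set (finite_image g finM) => x _; exists (val x) => //.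
by rewrite /g valK.
Qed.

End MonoidFacts.

Section MeDAFacts.
Local Open Scope group_scope.
Variable M : monoidType.
Hypothesis MDA : MeDA M.
Implicit Types (e x y g r : M).

(** In e M_e e the element e x has k-th power e, so it is J-above the unit; DA at the unit then
    forces e x = e. *)
Lemma MeDA_aperiodic x : exists k, x ^+ k * x = x ^+ k.
Proof.
have [fin DAe] := MDA; have [k k0 ee] := idempotent_power x fin; exists k.
set e := x ^+ k in ee *.
have ex : gen_above e x.
  apply: gen_aboveT; exists 1, (x ^+ k.-1).
  by rewrite mul1g -expgS prednK.
have cx : e * x = x * e by rewrite /e -expgSr -expgS.
pose n := to_local ee ex.
have vn : val n = e * x by rewrite /= -mulgA -cx mulgA ee.
have ek : e ^+ k = e.
  case: (k) k0 => // j _; elim: j => [|j IH]; first by rewrite expg1.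
  by rewrite expgSr IH.
have nk : n ^+ k = 1.
  by apply: val_inj; rewrite val_localX // vn expgMn // ek.
have n1 : gen_above 1 n.
  apply: gen_aboveT; exists 1, (n ^+ k.-1).
  by rewrite mul1g -expgS prednK.
have := DA_idempotent (DAe e ee) (mulg1 1) n1.
rewrite mul1g mulg1 => /(congr1 val); rewrite vn => -> //.
Qed.

Lemma fix_expg_r g x k : g * x = g -> g * x ^+ k = g.
Proof. by move=> gx; elim: k => [|k IH]; rewrite ?mulg1 // expgS mulgA gx. Qed.

Lemma fix_expg_l g x k : x * g = g -> x ^+ k * g = g.
Proof. by move=> gx; elim: k => [|k IH]; rewrite ?mul1g // expgSr -mulgA gx. Qed.

Lemma leJ_expg_l (N : monoidType) (a b c : N) k : 0 < k -> leJ ((a * (b * c)) ^+ k) b.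
Proof.
case: k => // k _; exists a, (c * (a * (b * c)) ^+ k).
by rewrite expgS !mulgA.
Qed.

Section Stability.
Variables (e x y r r' g : M) (ee : e * e = e).
Hypotheses (ex : gen_above e x) (ey : gen_above e y).
Hypotheses (er : gen_above e r) (er' : gen_above e r').

(** Let f be an idempotent power of [n1 * (ny * nr)]. Both [n1] and [ny] are J-above f, so DA gives
    f ny n1 f = f. As [g] is fixed by [n1] and by [ny * nr], it is fixed by f, and g = g ny n1 f
    leads from g y x back to [g]. *)
Lemma MeDA_stable_r :
  g * e = g -> g * y * e = g * y -> g * x * r = g -> g * y * r' = g ->
  exists k, g * y * x * (r * (e * (x * r) * e * (e * y * e * (e * r' * e))) ^+ k) = g.
Proof.
move=> ge gye gxr gyr; have [_ DAe] := MDA; have [finN _] := DAe e ee.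
pose n1 := to_local ee (gen_aboveM ex er).
pose ny := to_local ee ey; pose nr := to_local ee er'.
have [k k0 ff] := idempotent_power (n1 * (ny * nr)) finN.
set f := (_ ^+ k) in ff; exists k.
have fy : gen_above f ny by apply: gen_aboveT; exact: leJ_expg_l.
have f1 : gen_above f n1.
  apply: gen_aboveT; have := leJ_expg_l 1 n1 (ny * nr) k0.
  by rewrite mul1g.
have := DA_idempotent (DAe e ee) ff (gen_aboveM fy f1) => /(congr1 val).
have -> : val (f * (ny * n1) * f) = val f * (e * y * e * (e * (x * r) * e)) * val f by [].
have vf : val f = (e * (x * r) * e * (e * y * e * (e * r' * e))) ^+ k.
  by rewrite /f val_localX.
rewrite -vf => fxf.
have gf : g * val f = g.
  rewrite vf; apply: fix_expg_r.
  by rewrite !mulgA ge gxr ge ge gye gye gyr.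
have [ef _] := val_local_absorb f.
have E : g = g * (e * y * e * (e * (x * r) * e)) * val f.
  by rewrite -{1}gf -{1}fxf !mulgA gf.
by rewrite [RHS]E !mulgA ge gye gye -(mulgA _ e (val f)) ef.
Qed.

Lemma MeDA_stable_l :
  e * g = g -> e * (y * g) = y * g -> r * (x * g) = g -> r' * (y * g) = g ->
  exists k, (e * (r * x) * e * (e * r' * e * (e * y * e))) ^+ k * r * (x * (y * g)) = g.
Proof.
move=> ge gye gxr gyr; have [_ DAe] := MDA; have [finN _] := DAe e ee.
pose n1 := to_local ee (gen_aboveM er ex).
pose ny := to_local ee ey; pose nr := to_local ee er'.
have [k k0 ff] := idempotent_power (n1 * (nr * ny)) finN.
set f := (_ ^+ k) in ff; exists k.
have fy : gen_above f ny.
  apply: gen_aboveT; have := leJ_expg_l (n1 * nr) ny 1 k0.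
  by rewrite mulg1 -mulgA.
have f1 : gen_above f n1.
  apply: gen_aboveT; have := leJ_expg_l 1 n1 (nr * ny) k0.
  by rewrite mul1g.
have := DA_idempotent (DAe e ee) ff (gen_aboveM f1 fy) => /(congr1 val).
have -> : val (f * (n1 * ny) * f) = val f * (e * (r * x) * e * (e * y * e)) * val f by [].
have vf : val f = (e * (r * x) * e * (e * r' * e * (e * y * e))) ^+ k.
  by rewrite /f val_localX.
rewrite -vf => fxf.
have gf : val f * g = g.
  rewrite vf; apply: fix_expg_l.
  by rewrite -!mulgA ge gye gye gyr ge ge gxr ge.
have [_ fe] := val_local_absorb f.
have E : g = val f * ((e * (r * x) * e * (e * y * e)) * g).
  by rewrite -{1}gf -{1}fxf -!mulgA gf.
by rewrite [RHS]E -!mulgA ge gye gye (mulgA (val f) e) fe.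
Qed.

End Stability.

(** From x = l x r' one gets x = l^k x r'^k, where by aperiodicity the last factor absorbs one more
    r'. *)
Lemma MeDA_H_trivial x y l l' r r' :
  x = y * r -> y = x * r' -> x = l * y -> y = l' * x -> x = y.
Proof.
move=> exr eyr exl _; have [k ek] := MeDA_aperiodic r'.
have lxr j : x = l ^+ j * x * r' ^+ j.
  elim: j => [|j IH]; first by rewrite mul1g mulg1.
  by rewrite expgSr expgS !mulgA -(mulgA _ l) -(mulgA _ _ r') -(mulgA l) -eyr -exl.
by rewrite eyr {2}(lxr k) -mulgA ek -lxr.
Qed.

End MeDAFacts.

(** * From predicates to formulas *)

Section ToFormulas.
Variable A : finType.
Implicit Types (phi psi : fo2 A) (w : seq A) (s : bool -> nat).

(** Lets a subformula speak about the newly quantified position, which frees the other variable for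
    further quantification. *)
Fixpoint swap phi : fo2 A :=
  match phi with
  | Lt u t => Lt (~~ u) (~~ t)
  | Eq u t => Eq (~~ u) (~~ t)
  | Letter a u => Letter a (~~ u)
  | Bet a u t => Bet a (~~ u) (~~ t)
  | Not psi => Not (swap psi)
  | And p q => And (swap p) (swap q)
  | Or p q => Or (swap p) (swap q)
  | Ex u psi => Ex (~~ u) (swap psi)
  | All u psi => All (~~ u) (swap psi)
  end.

Lemma sat_swap w s phi : sat w s (swap phi) = sat w (fun v => s (~~ v)) phi.
Proof.
have upd s' u i : (fun v => update s' (~~ u) i (~~ v)) = update (fun v => s' (~~ v)) u i.
  by apply/funext => v; rewrite /update (inj_eq negb_inj).
elim: phi s => //= [psi IH|p IHp q IHq|p IHp q IHq|u psi IH|u psi IH] s.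
- by rewrite IH.
- by rewrite IHp IHq.
- by rewrite IHp IHq.
- by apply: eq_existsb => k; rewrite IH upd.
- by apply: eq_forallb => k; rewrite IH upd.
Qed.

Definition truth : fo2 A := All false (Eq false false).

Lemma sat_truth w s : sat w s truth.
Proof. by apply/forallP => k; rewrite /= eqxx. Qed.

Lemma sentence_truth : sentence truth.
Proof. by case. Qed.

Definition conj_over (S : {set A}) (f : A -> fo2 A) : fo2 A :=
  foldr (fun a phi => And (f a) phi) truth (enum S).

Lemma sat_conj w s S f : sat w s (conj_over S f) <-> forall a, a \in S -> sat w s (f a).
Proof.
rewrite /conj_over; split=> [h a|h].
  rewrite -mem_enum; elim: (enum S) h => //= b l IH /andP[hb /IH{}IH].
  by rewrite in_cons => /orP[/eqP->|].
have : forall a, a \in enum S -> sat w s (f a) by move=> a; rewrite mem_enum; exact: h.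
elim: (enum S) => [|b l IH] hl; first exact: sat_truth.
rewrite /= hl ?mem_head //=; apply: IH => a al; apply: hl.
by rewrite in_cons al orbT.
Qed.

Lemma free_in_conj v S f : free_in v (conj_over S f) -> exists a, free_in v (f a).
Proof.
rewrite /conj_over; elim: (enum S) => [|b l IH] /=; first by rewrite orbb andNb.
by move=> /orP[fb|/IH //]; exists b.
Qed.

Lemma satBet w s a u t : sat w s (Bet a u t) <->
  exists k, [/\ s u < k, k < s t & onth w k = Some a].
Proof.
split=> [/existsP[k /and3P[? ? /eqP ?]]|[k [uk kt ka]]]; first by exists k.
by apply/existsP; exists (Ordinal (onth_size ka)); rewrite /= uk kt ka eqxx.
Qed.

Lemma satEx w s u phi : sat w s (Ex u phi) <->
  exists k, k < size w /\ sat w (update s u k) phi.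
Proof.
split=> [/existsP[k hk]|[k [kw hk]]]; first by exists k; split.
by apply/existsP; exists (Ordinal kw).
Qed.

Lemma sat_avoids w s (S : {set A}) u t :
  sat w s (conj_over S (fun a => Not (Bet a u t))) <-> avoids S w (s u) (s t).
Proof.
rewrite sat_conj; split=> [h k a uk kt ka|av a aS].
  apply/negP => aS; have /= := h a aS; apply/negP; rewrite negbK.
  by apply/satBet; exists k.
by apply/negP => /satBet[k [uk kt ka]]; have := av k a uk kt ka; rewrite aS.
Qed.

(** No quantified variable takes the value [size w], so each predicate yields two formulas: one for
    genuine positions, and a sentence for the endmarker. *)
Lemma tdef_fo2 (P : seq A -> nat -> Prop) : tdef P -> exists phi psi,
  [/\ forall v, free_in v phi -> v = false, sentence psi,
    forall w s, s false < size w -> sat w s phi <-> P w (s false) &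
    forall w s, sat w s psi <-> P w (size w)].
Proof.
elim=> [|a|{}P _ [phi [psi [f1 c1 e1 g1]]]|
  {}P Q _ [phi [psi [f1 c1 e1 g1]]] _ [phi' [psi' [f2 c2 e2 g2]]]
  |S {}P _ [phi [psi [f1 c1 e1 g1]]]|S {}P _ [phi [psi [f1 c1 e1 g1]]]].
- exists truth, truth; split=> //; try exact: sentence_truth; first by case.
  + by move=> w s _; split=> // _; exact: sat_truth.
  + by move=> w s; split=> // _; exact: sat_truth.
- exists (Letter a false), (Not truth); split.
  + by case.
  + exact: sentence_truth.
  + by move=> w s _; split=> [/eqP|/= ->].
  + move=> w s; rewrite onth_default //; split=> //.
    by rewrite /= => /negP; case; exact: sat_truth.
- exists (Not phi), (Not psi); split=> //.
  + by move=> w s sw; rewrite -(e1 w s sw); split=> /negP.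
  + by move=> w s; rewrite -(g1 w s); split=> /negP.
- exists (And phi phi'), (And psi psi'); split=> [v /orP[/f1|/f2] //|v|w s sw|w s] /=.
  + by rewrite negb_or c1 c2.
  + by rewrite -(e1 w s sw) -(e2 w s sw); split=> /andP.
  + by rewrite -(g1 w s) -(g2 w s); split=> /andP.
- exists (Ex true (And (Lt false true)
    (And (conj_over S (fun a => Not (Bet a false true))) (swap phi)))), (Not truth).
  split.
  + by case.
  + exact: sentence_truth.
  + move=> w s sw; rewrite satEx; split.
      move=> [k [kw /= /and3P[sk /sat_avoids av]]]; rewrite sat_swap => /e1 -/(_ kw) Pk.
      by exists k.
    move=> [j [sj jw av Pj]]; exists j; split=> //=; rewrite sj /=.
    apply/andP; split; first exact/sat_avoids.
    by rewrite sat_swap; apply/e1.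
  + move=> w s; split=> [/= /negP|]; first by case; exact: sat_truth.
    by move=> [j [jw]]; rewrite ltnNge ltnW.
- exists (Ex true (And (Lt true false)
    (And (conj_over S (fun a => Not (Bet a true false))) (swap phi)))),
   (* The endmarker cannot be an argument of [Bet]; instead, no position to the right of the witness
      may carry a letter of [S]. *)
   (Ex false (And (conj_over S (fun a => Not (Ex true (And (Lt false true) (Letter a true)))))
     phi)).
  split.
  + by case.
  + move=> v; apply/negP => /= /andP[vf /orP[/free_in_conj[a]|/f1 //]].
      by case: v vf.
    by move=> ev; rewrite ev in vf.
  + move=> w s sw; rewrite satEx; split.
      move=> [k [kw /= /and3P[sk /sat_avoids av]]]; rewrite sat_swap => /e1 -/(_ kw) Pk.
      by exists k.
    move=> [j [sj jw av Pj]]; exists j; split=> //=; rewrite sj /=.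
    apply/andP; split; first exact/sat_avoids.
    by rewrite sat_swap; apply/e1.
  + move=> w s; rewrite satEx; split.
      move=> [k [kw /= /andP[/sat_conj av /e1 -/(_ kw) Pk]]]; exists k; split=> //.
      move=> j a kj jw ja; apply/negP => aS; have /= /negP := av a aS; apply.
      by apply/existsP; exists (Ordinal jw); rewrite /= kj ja /=.
    move=> [j [_ jw av Pj]]; exists j; split=> //=.
    apply/andP; split; last by apply/e1.
    apply/sat_conj => a aS /=; apply/negP => /existsP[k /andP[jk /eqP ka]].
    by have := av _ _ jk (ltn_ord k) ka; rewrite aS.
Qed.

Lemma tdef_definable (L : set (seq A)) (P : seq A -> nat -> Prop) : tdef P ->
  (forall w, L w <-> P w (size w)) -> fo2_bet_definable L.
Proof.
move=> /tdef_fo2[phi [psi [_ c1 _ g1]]] e; exists psi => // w.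
by rewrite e -(g1 w (fun=> 0)).
Qed.

End ToFormulas.

(** * M_eDA implies definable *)

Section FiniteCopy.
Local Open Scope group_scope.
Variables (M : monoidType) (s : seq M) (sT : forall x, x \in s).

(** Finiteness of [M] is only a statement about sets; the enumeration [s] provides the [finType] on
    which the preceding sections work. *)
Definition to_copy (x : M) : seq_sub s := SeqSub (sT x).
Definition copy_mul (x y : seq_sub s) := to_copy (ssval x * ssval y).

Let copy_mulA : associative copy_mul.
Proof. by move=> x y z; apply: val_inj; rewrite /= mulgA. Qed.
Let copy_mul1x : left_id (to_copy 1) copy_mul.
Proof. by move=> x; apply: val_inj; rewrite /= mul1g. Qed.
Let copy_mulx1 : right_id (to_copy 1) copy_mul.
Proof. by move=> x; apply: val_inj; rewrite /= mulg1. Qed.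

HB.instance Definition _ :=
  Monoid.isLaw.Build (seq_sub s) (to_copy 1) copy_mul copy_mulA copy_mul1x copy_mulx1.

Variables (A : finType) (mu : seq A -> M).
Hypotheses (mu_nil : mu [::] = 1) (mu_cat : forall u v, mu (u ++ v) = mu u * mu v).
Hypothesis MDA : MeDA M.
Implicit Types (B : {set A}) (u v w : seq A).

Let h a := to_copy (mu [:: a]).
Local Notation op := (copy_mul : Monoid.law (to_copy 1)).
Local Notation copy_value := (value op h).
Local Notation image_of := (image_of op h).

Lemma ssval_value w : ssval (copy_value w) = mu w.
Proof.
rewrite /value; elim: w => [|a w IH]; first by rewrite big_nil mu_nil.
by rewrite big_cons /= IH -mu_cat.
Qed.

Let img B x := exists2 v, over B v & mu v = x.

Lemma img_mul B x y : img B x -> img B y -> img B (x * y).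
Proof.
move=> [u ou <-] [v ov <-]; exists (u ++ v) => //.
by move=> a; rewrite mem_cat => /orP[/ou|/ov].
Qed.

Lemma img_expg B x k : img B x -> img B (x ^+ k).
Proof.
move=> ix; elim: k => [|k IH]; first by exists [::].
by rewrite expgS; exact: img_mul.
Qed.

Lemma img_image_of B x : img B x -> image_of B (to_copy x).
Proof. by move=> [v ov ev]; exists v => //; apply: val_inj; rewrite /= ssval_value. Qed.

Lemma image_of_img B x : image_of B x -> img B (ssval x).
Proof. by move=> [v ov <-]; exists v; rewrite ?ssval_value. Qed.

(** Each letter of [B] occurs in [u], so its value is J-above every positive power of [mu u]. This
    is how full content puts the values of all words over [B] into M_e. *)
Lemma img_gen_above B u e k x : 0 < k -> e = mu u ^+ k -> {subset B <= u} ->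
  img B x -> gen_above e x.
Proof.
move=> k0 -> Bu [v ov <-]; elim: v ov => [|a v IH] ov.
  by rewrite mu_nil; exact: gen_above1.
rewrite -cat1s mu_cat; apply: gen_aboveM; last first.
  by apply: IH => b bv; apply: ov; rewrite in_cons bv orbT.
apply: gen_aboveT; have /Bu au : a \in B by apply: ov; rewrite mem_head.
have /splitPr[u1 u2] := au.
have := leJ_expg_l (mu u1) (mu [:: a]) (mu u2) k0.
by rewrite -!mu_cat.
Qed.

Lemma copy_stable B u : over B u -> {subset B <= u} ->
  Rstable op (image_of B) (copy_value u) /\ Rstable (revop op) (image_of B) (copy_value u).
Proof.
move=> ou Bu; have [fin _] := MDA.
have [k k0] := idempotent_power (mu u) fin; set e := _ ^+ k => ee.
have ie : img B e by apply: img_expg; exists u.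
have above := img_gen_above k0 (erefl e) Bu.
split=> g x y r r' Sg /image_of_img Sx /image_of_img Sy /image_of_img Sr /image_of_img Sr'.
- move=> /(congr1 (@ssval _ _)) /=; rewrite ssval_value => gs.
  move=> /(congr1 (@ssval _ _)) /=; rewrite ssval_value => gys.
  move=> /(congr1 (@ssval _ _)) /= gxr /(congr1 (@ssval _ _)) /= gyr.
  have [j ej] := MeDA_stable_r MDA ee (above _ Sx) (above _ Sy) (above _ Sr)
    (above _ Sr') (fix_expg_r k gs) (fix_expg_r k gys) gxr gyr.
  exists (to_copy (ssval r * (e * (ssval x * ssval r) * e *
    (e * ssval y * e * (e * ssval r' * e))) ^+ j)); last exact/val_inj/esym.
  by apply: img_image_of; apply: img_mul => //; apply: img_expg; do !apply: img_mul.
- move=> /(congr1 (@ssval _ _)) /=; rewrite ssval_value => gs.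
  move=> /(congr1 (@ssval _ _)) /=; rewrite ssval_value => gys.
  move=> /(congr1 (@ssval _ _)) /= gxr /(congr1 (@ssval _ _)) /= gyr.
  have [j ej] := MeDA_stable_l MDA ee (above _ Sx) (above _ Sy) (above _ Sr)
    (above _ Sr') (fix_expg_l k gs) (fix_expg_l k gys) gxr gyr.
  exists (to_copy ((e * (ssval r * ssval x) * e *
    (e * ssval r' * e * (e * ssval y * e))) ^+ j * ssval r)); last exact/val_inj/esym.
  by apply: img_image_of; apply: img_mul => //; apply: img_expg; do !apply: img_mul.
Qed.

Lemma copy_H_trivial B x y :
  Req op (image_of B) x y -> Req (revop op) (image_of B) x y -> x = y.
Proof.
move=> [[r _ /(congr1 (@ssval _ _)) /= exr] [r' _ /(congr1 (@ssval _ _)) /= eyr]].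
move=> [[l _ /(congr1 (@ssval _ _)) /= exl] [l' _ /(congr1 (@ssval _ _)) /= eyl]].
by apply: val_inj; apply: (MeDA_H_trivial MDA exr eyr exl eyl).
Qed.

Lemma MeDA_definable (L : set (seq A)) :
  (forall u v, mu u = mu v -> L u -> L v) -> fo2_bet_definable L.
Proof.
move=> sat_L.
have ex m : exists P, tdef P /\ forall w, copy_value w = m <-> P w (size w).
  have [P hP e] := tdef_value copy_stable copy_H_trivial [set: A]%SET m.
  by exists P; split=> // w; apply: e => a _; rewrite inE.
have [P hP] := choice ex.
apply: (@tdef_definable _ _ (fun w i => exists m, (exists2 u, L u & copy_value u = m) /\ P m w i)).
  by apply: tdef_exists => m; apply: tdef_and; [exact: tdef_const|case: (hP m)].
move=> w; split=> [Lw|[m [[u Lu um]]]].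
  by exists (copy_value w); split; [exists w|apply/(hP _).2].
move=> /(hP m).2; rewrite -um => /(congr1 (@ssval _ _)); rewrite !ssval_value => e.
by apply: sat_L Lu.
Qed.

End FiniteCopy.

(** * Types and games *)

Section Types.
Variable A : finType.
Implicit Types (w : seq A) (s : bool -> nat) (a : A).

Definition between w i j : {set A} :=
  [set a | [exists k : 'I_(size w),
    [&& minn i j < k, k < maxn i j & onth w k == Some a]]]%SET.

Lemma betweenP w i j a :
  reflect (exists k, [/\ minn i j < k, k < maxn i j & onth w k = Some a])
    (a \in between w i j).
Proof.
rewrite inE; apply: (iffP existsP) => [[k /and3P[? ? /eqP ?]]|[k [ik kj ka]]].
  by exists k.
by exists (Ordinal (onth_size ka)); rewrite /= ik kj ka eqxx.
Qed.

Lemma betweenC w i j : between w i j = between w j i.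
Proof. by rewrite /between minnC maxnC. Qed.

Fixpoint ty n : finType :=
  if n is n'.+1 then {set ((bool * bool) * {set A} * ty n')} : finType
  else option A.

(* [tp n w i] determines which formulas of quantifier depth [n] with one free
   variable hold at the position [i] of [w]. *)
Fixpoint tp n w i : ty n :=
  match n return ty n with
  | 0 => onth w i
  | n'.+1 => [set ((i < j, j < i), between w i j, tp n' w j) | j : 'I_(size w)]%SET
  end.

Lemma tpS n w i : tp n.+1 w i =
  [set ((i < j, j < i), between w i j, tp n w j) | j : 'I_(size w)]%SET.
Proof. by []. Qed.

Definition matches n w w' i i' j j' :=
  [/\ j' < size w', (i < j) = (i' < j'), (j < i) = (j' < i'),
    between w i j = between w' i' j' & tp n w j = tp n w' j'].

Lemma tpS_forth n w w' i i' j : tp n.+1 w i = tp n.+1 w' i' -> j < size w ->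
  exists j', matches n w w' i i' j j'.
Proof.
move=> e jw.
rewrite !tpS in e.
have : ((i < j, j < i), between w i j, tp n w j) \in
    [set ((i < j, j < i), between w i j, tp n w j) | j : 'I_(size w)]%SET.
  by apply/imsetP; exists (Ordinal jw).
by rewrite e => /imsetP[j' _ [? ? ? ?]]; exists j'.
Qed.

Lemma tpS_eq n w w' i i' :
  (forall j, j < size w -> exists j', matches n w w' i i' j j') ->
  (forall j', j' < size w' -> exists j, matches n w' w i' i j' j) ->
  tp n.+1 w i = tp n.+1 w' i'.
Proof.
move=> forth back; rewrite !tpS; apply/setP => x; apply/imsetP/imsetP => -[j _ ->].
  have [j' [j'w e1 e2 e3 e4]] := forth j (ltn_ord j).
  by exists (Ordinal j'w) => //=; rewrite e1 e2 e3 e4.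
have [j' [j'w e1 e2 e3 e4]] := back j (ltn_ord j).
by exists (Ordinal j'w) => //=; rewrite e1 e2 e3 e4.
Qed.

(** The move that stays at [i] can only be answered by staying at [i']. *)
Lemma tp_pred n w w' i i' : i < size w ->
  tp n.+1 w i = tp n.+1 w' i' -> tp n w i = tp n w' i'.
Proof.
move=> iw /tpS_forth /(_ iw)[j' [_]]; rewrite ltnn.
move=> /esym/negbT j1 /esym/negbT j2 _; suff -> : j' = i' by [].
by lia.
Qed.

Lemma tp_le m n w w' i i' : m <= n -> i < size w ->
  tp n w i = tp n w' i' -> tp m w i = tp m w' i'.
Proof.
move=> mn iw; rewrite -(subnK mn); elim: (n - m) => // k IH.
by rewrite addSn => /(tp_pred iw).
Qed.

Lemma tp_letter n w w' i i' : i < size w ->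
  tp n w i = tp n w' i' -> onth w i = onth w' i'.
Proof. by move=> iw /(tp_le (leq0n n) iw). Qed.

Fixpoint depth (phi : fo2 A) : nat :=
  match phi with
  | Lt _ _ | Eq _ _ | Letter _ _ | Bet _ _ _ => 0
  | Not psi => depth psi
  | And p q | Or p q => maxn (depth p) (depth q)
  | Ex _ psi | All _ psi => (depth psi).+1
  end.

Definition similar n w s w' s' :=
  [/\ (forall v, s v < size w) /\ (forall v, s' v < size w'),
    (s false < s true) = (s' false < s' true),
    (s true < s false) = (s' true < s' false),
    between w (s false) (s true) = between w' (s' false) (s' true) &
    forall v, tp n w (s v) = tp n w' (s' v)].

Lemma similar_sym n w s w' s' : similar n w s w' s' -> similar n w' s' w s.
Proof. by move=> [[? ?] ? ? ? ?]; split. Qed.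

Lemma similar_ltn n w s w' s' u t : similar n w s w' s' ->
  (s u < s t) = (s' u < s' t).
Proof.
by move=> [_ lt_ft lt_tf _ _]; case: u t => [] [] //; rewrite ?ltnn.
Qed.

Lemma similar_between n w s w' s' u t : similar n w s w' s' ->
  between w (s u) (s t) = between w' (s' u) (s' t).
Proof.
move=> [_ _ _ e _]; case: u t => [] [] //.
- by rewrite /between; apply/setP => a; rewrite !inE; apply/existsP/existsP;
    move=> [k]; rewrite minnn maxnn; lia.
- by rewrite betweenC e betweenC.
- by rewrite /between; apply/setP => a; rewrite !inE; apply/existsP/existsP;
    move=> [k]; rewrite minnn maxnn; lia.
Qed.

Lemma similar_update n w s w' s' u k : similar n.+1 w s w' s' -> k < size w ->
  exists2 k', k' < size w' & similar n w (update s u k) w' (update s' u k').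
Proof.
move=> [[sw sw'] lt_ft lt_tf eb et] kw.
have [k' [k'w e1 e2 e3 e4]] := tpS_forth (et (~~ u)) kw.
exists k' => //; split.
- by split=> v; rewrite /update; case: ifP.
- by case: (u) e1 e2; rewrite /update /=.
- by case: (u) e1 e2; rewrite /update /=.
- by case: (u) e3; rewrite /update /= // => e3; rewrite betweenC e3 betweenC.
- by move=> v; rewrite /update; case: ifP => // _; apply: tp_pred => //; exact: et.
Qed.

Lemma sat_similar phi n w s w' s' : depth phi <= n -> similar n w s w' s' ->
  sat w s phi = sat w' s' phi.
Proof.
have betE w1 s1 a u t : sat w1 s1 (Bet a u t) = (s1 u < s1 t) && (a \in between w1 (s1 u) (s1 t)).
  apply/existsP/andP => [[k /and3P[uk kt /eqP ka]]|[ut /betweenP[k [uk kt ka]]]].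
    split; first exact: ltn_trans kt.
    by apply/betweenP; exists k; rewrite ka; split=> //; lia.
  by exists (Ordinal (onth_size ka)); apply/and3P; split=> /=; [lia|lia|rewrite ka].
have quant (w1 w2 : seq A) (P : nat -> bool) (Q : nat -> bool) :
    (forall k, k < size w1 -> exists2 k', k' < size w2 & P k = Q k') ->
    [exists k : 'I_(size w1), P k] -> [exists k : 'I_(size w2), Q k].
  move=> PQ /existsP[k Pk]; have [k' k'w e] := PQ k (ltn_ord k).
  by apply/existsP; exists (Ordinal k'w); rewrite /= -e.
elim: phi n s s' => [u t|u t|a u|a u t|psi IH|p IHp q IHq|p IHp q IHq
  |u psi IH|u psi IH] n s s'; rewrite ?betE /= => dn sim.
- exact: similar_ltn sim.
- rewrite !eqn_leq (leqNgt (s u)) (leqNgt (s t)) (leqNgt (s' u)) (leqNgt (s' t)).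
  by rewrite !(similar_ltn _ _ sim).
- by have [[sw _] _ _ _ /(_ u)/(tp_letter (sw u)) ->] := sim.
- by rewrite (similar_ltn _ _ sim) (similar_between _ _ sim).
- by rewrite (IH n s s').
- by move: dn; rewrite geq_max => /andP[dp dq]; rewrite (IHp n s s') ?(IHq n s s').
- by move: dn; rewrite geq_max => /andP[dp dq]; rewrite (IHp n s s') ?(IHq n s s').
- case: n => // n in dn sim *; apply/idP/idP.
    apply: (quant w w' (fun k => sat w (update s u k) psi)
      (fun k => sat w' (update s' u k) psi)) => k kw.
    have [k' k'w sim'] := similar_update u sim kw.
    by exists k' => //; exact: IH sim'.
  apply: (quant w' w (fun k => sat w' (update s' u k) psi)
      (fun k => sat w (update s u k) psi)) => k kw.
  have [k' k'w sim'] := similar_update u (similar_sym sim) kw.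
  by exists k' => //; apply/esym; apply: IH (similar_sym sim').
- case: n => // n in dn sim *; apply/negb_inj; rewrite !negb_forall; apply/idP/idP.
    apply: (quant w w' (fun k => ~~ sat w (update s u k) psi)
      (fun k => ~~ sat w' (update s' u k) psi)) => k kw.
    have [k' k'w sim'] := similar_update u sim kw.
    by exists k' => //; congr negb; exact: IH sim'.
  apply: (quant w' w (fun k => ~~ sat w' (update s' u k) psi)
      (fun k => ~~ sat w (update s u k) psi)) => k kw.
  have [k' k'w sim'] := similar_update u (similar_sym sim) kw.
  by exists k' => //; congr negb; apply/esym; apply: IH (similar_sym sim').
Qed.

Definition types n w := [set tp n w i | i : 'I_(size w)]%SET.

Lemma types_forth n w w' i : types n w = types n w' -> i < size w ->
  exists2 i', i' < size w' & tp n w i = tp n w' i'.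
Proof.
move=> e iw; have : tp n w i \in types n w by apply/imsetP; exists (Ordinal iw).
by rewrite e => /imsetP[i' _ ->]; exists i'.
Qed.

Lemma types_eq n w w' :
  (forall i, i < size w -> exists2 i', i' < size w' & tp n w i = tp n w' i') ->
  (forall i, i < size w' -> exists2 i', i' < size w & tp n w' i = tp n w i') ->
  types n w = types n w'.
Proof.
move=> h1 h2; apply/setP => x; apply/imsetP/imsetP => -[i _ ->].
  by have [i' i'w ->] := h1 i (ltn_ord i); exists (Ordinal i'w).
by have [i' i'w ->] := h2 i (ltn_ord i); exists (Ordinal i'w).
Qed.

Lemma models_types phi w w' : sentence phi ->
  types (depth phi) w = types (depth phi) w' -> models w phi = models w' phi.
Proof.
move=> closed e.
have free0 w1 s1 s2 : sat w1 s1 phi = sat w1 s2 phi.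
  by apply: sat_free => v vf; move: (closed v); rewrite vf.
(* The empty word has no position for a valuation, but it is the only word whose set of types is
   empty. *)
have [w0|w0] := posnP (size w).
  suff -> : w = w' by [].
  have [w'0|w'0] := posnP (size w'); first by rewrite (size0nil w0) (size0nil w'0).
  by have [i'] := types_forth (esym e) w'0; rewrite w0.
have [i' i'w ei] := types_forth e w0.
rewrite /models (free0 w' _ (fun=> i')).
apply: (@sat_similar _ (depth phi)) => //; split=> //=; rewrite ?ltnn //.
by apply/setP => a; apply/betweenP/betweenP => -[k]; rewrite minnn maxnn => -[]; lia.
Qed.

Lemma bisimulation w w' (R : nat -> nat -> nat -> Prop) :
  (forall n i i', R n i i' -> onth w i = onth w' i') ->
  (forall n i i' j, R n.+1 i i' -> j < size w -> exists j',
    [/\ j' < size w', (i < j) = (i' < j'), (j < i) = (j' < i'),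
      between w i j = between w' i' j' & R n j j']) ->
  (forall n i i' j', R n.+1 i i' -> j' < size w' -> exists j,
    [/\ j < size w, (i' < j') = (i < j), (j' < i') = (j < i),
      between w' i' j' = between w i j & R n j j']) ->
  forall n i i', R n i i' -> tp n w i = tp n w' i'.
Proof.
move=> letter forth back; elim=> [|n IH] i i' Ri; first exact: letter Ri.
apply: tpS_eq => j jw.
  by have [j' [? ? ? ? /IH ?]] := forth _ _ _ _ Ri jw; exists j'.
by have [j' [? ? ? ? /IH ?]] := back _ _ _ _ Ri jw; exists j'.
Qed.

Lemma between_catl w1 w2 i j : i < size w1 -> j < size w1 ->
  between (w1 ++ w2) i j = between w1 i j.
Proof.
move=> iw jw; apply/setP => a; apply/betweenP/betweenP => -[k [ik kj]].
  have kw : k < size w1 by lia.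
  by rewrite onth_cat kw => ka; exists k.
by move=> ka; exists k; rewrite onth_cat (onth_size ka).
Qed.

Lemma between_catr w1 w2 i j : size w1 <= i -> size w1 <= j ->
  between (w1 ++ w2) i j = between w2 (i - size w1) (j - size w1).
Proof.
move=> iw jw; apply/setP => a; apply/betweenP/betweenP => -[k [ik kj]].
  rewrite onth_cat ltnNge; have -> /= : size w1 <= k by lia.
  by move=> ka; exists (k - size w1); split=> //; lia.
move=> ka; exists (size w1 + k); split; [lia|lia|].
by rewrite onth_cat ltnNge leq_addr /= addKn.
Qed.

Lemma between_cat w1 w2 i j a : i < size w1 -> size w1 <= j ->
  a \in between (w1 ++ w2) i j <->
  (exists2 k, i < k & onth w1 k = Some a) \/
  (exists2 k, k < j - size w1 & onth w2 k = Some a).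
Proof.
move=> iw jw; split.
  move=> /betweenP[k [ik kj]]; rewrite onth_cat; case: ltnP => [kw|wk] ka.
    by left; exists k => //; lia.
  by right; exists (k - size w1) => //; lia.
move=> h; apply/betweenP; case: h => -[k hk ka].
  exists k; rewrite onth_cat (onth_size ka); split=> //; first by lia.
  by have := onth_size ka; lia.
exists (size w1 + k); split; [lia|lia|].
by rewrite onth_cat ltnNge leq_addr /= addKn.
Qed.

Lemma tp_after n w w' i i' a : i < size w -> tp n.+1 w i = tp n.+1 w' i' ->
  (exists2 k, i < k & onth w k = Some a) -> exists2 k, i' < k & onth w' k = Some a.
Proof.
move=> iw e [k ik ka]; have kw := onth_size ka.
have [k' [k'w e1 _ _ e4]] := tpS_forth e kw.
by exists k'; [rewrite -e1|rewrite -ka; apply/esym/(tp_letter kw e4)].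
Qed.

Lemma tp_before n w w' i i' a : i < size w -> tp n.+1 w i = tp n.+1 w' i' ->
  (exists2 k, k < i & onth w k = Some a) -> exists2 k, k < i' & onth w' k = Some a.
Proof.
move=> iw e [k ik ka]; have kw := onth_size ka.
have [k' [k'w _ e2 _ e4]] := tpS_forth e kw.
by exists k'; [rewrite -e2|rewrite -ka; apply/esym/(tp_letter kw e4)].
Qed.

Section Concatenation.
Variable N : nat.

(** Types are kept one level deeper than the number of rounds: the letters between positions on
    different sides are those after the one and before the other, and it takes one more round to see
    them. *)
Definition cat_rel w1 w2 w1' w2' n i i' := n <= N /\
  ([/\ i < size w1, i' < size w1' & tp n.+1 w1 i = tp n.+1 w1' i'] \/
   exists k k', [/\ i = size w1 + k, i' = size w1' + k', k < size w2,
     k' < size w2' & tp n.+1 w2 k = tp n.+1 w2' k']).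

Lemma cat_rel_sym w1 w2 w1' w2' n i i' :
  cat_rel w1 w2 w1' w2' n i i' -> cat_rel w1' w2' w1 w2 n i' i.
Proof.
move=> [nN [[? ? ?]|[k [k' [? ? ? ? ?]]]]]; split=> //; [left|right] => //.
by exists k', k.
Qed.

Lemma between_cat_sub w1 w2 w1' w2' n i i' k k' :
  i < size w1 -> i' < size w1' -> k < size w2 -> k' < size w2' ->
  tp n.+1 w1 i = tp n.+1 w1' i' -> tp n.+1 w2 k = tp n.+1 w2' k' ->
  {subset between (w1 ++ w2) i (size w1 + k)
     <= between (w1' ++ w2') i' (size w1' + k')}.
Proof.
move=> iw i'w kw k'w e1 e2 a.
move=> /(between_cat _ _ iw (leq_addr _ _)) h.
apply/(between_cat _ _ i'w (leq_addr _ _)); move: h; rewrite !addKn.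
by move=> [/(tp_after iw e1)|/(tp_before kw e2)]; [left|right].
Qed.

Lemma cat_rel_forth w1 w2 w1' w2' n i i' j :
  types N.+1 w1 = types N.+1 w1' -> types N.+1 w2 = types N.+1 w2' ->
  cat_rel w1 w2 w1' w2' n.+1 i i' -> j < size (w1 ++ w2) -> exists j',
    [/\ j' < size (w1' ++ w2'), (i < j) = (i' < j'), (j < i) = (j' < i'),
      between (w1 ++ w2) i j = between (w1' ++ w2') i' j' &
      cat_rel w1 w2 w1' w2' n j j'].
Proof.
move=> t1 t2 [nN h] jw; rewrite !size_cat in jw *.
have n1 : n.+1 <= N.+1 by lia.
have bet i0 i0' k k' : i0 < size w1 -> i0' < size w1' -> k < size w2 ->
    k' < size w2' -> tp n.+1 w1 i0 = tp n.+1 w1' i0' -> tp n.+1 w2 k = tp n.+1 w2' k' ->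
    between (w1 ++ w2) i0 (size w1 + k) = between (w1' ++ w2') i0' (size w1' + k').
  move=> iw iw' kw kw' e1 e2; apply/eqP; rewrite finset.eqEsubset; apply/andP.
  split; apply/fintype.subsetP; first exact: (between_cat_sub _ _ _ _ e1 e2).
  exact: (between_cat_sub _ _ _ _ (esym e1) (esym e2)).
have [jw1|w1j] := ltnP j (size w1); last have [k ej kw2] : exists2 k, j = size w1 + k & k < size w2.
- case: h => [[iw i'w e]|[k [k' [-> -> kw kw' e]]]].
    have [j' [j'w e1 e2 e3 e4]] := tpS_forth e jw1.
    exists j'; rewrite !between_catl //; split=> //; first by rewrite ltn_addr.
    by split; [lia|left].
  have [j' j'w e4] := types_forth t1 jw1; have {}e4 := tp_le n1 jw1 e4.
  exists j'; split; [by rewrite ltn_addr|lia|lia| |by split; [lia|left]].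
  rewrite betweenC [RHS]betweenC; apply: bet => //; exact: tp_pred e.
- by exists (j - size w1); lia.
- subst j; case: h => [[iw i'w e]|[l [l' [-> -> lw lw' e]]]].
    have [k' k'w e4] := types_forth t2 kw2; have {}e4 := tp_le n1 kw2 e4.
    exists (size w1' + k'); split; [by rewrite ltn_add2l|lia|lia| |].
      by apply: bet => //; exact: tp_pred e.
    by split; [lia|right; exists k, k'].
  have [k' [k'w e1 e2 e3 e4]] := tpS_forth e kw2.
  exists (size w1' + k'); rewrite !between_catr ?leq_addr // !addKn !ltn_add2l.
  by split=> //; split; [lia|right; exists k, k'].
Qed.

Lemma types_cat w1 w2 w1' w2' :
  types N.+1 w1 = types N.+1 w1' -> types N.+1 w2 = types N.+1 w2' ->
  types N (w1 ++ w2) = types N (w1' ++ w2').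
Proof.
have main v1 v2 v1' v2' : types N.+1 v1 = types N.+1 v1' ->
    types N.+1 v2 = types N.+1 v2' -> forall i, i < size (v1 ++ v2) ->
    exists2 i', i' < size (v1' ++ v2') & tp N (v1 ++ v2) i = tp N (v1' ++ v2') i'.
  move=> e1 e2 i iw.
  have bisim := @bisimulation (v1 ++ v2) (v1' ++ v2') (cat_rel v1 v2 v1' v2') _ _ _ N.
  have [i' [i'w Ri]] : exists i', i' < size (v1' ++ v2') /\ cat_rel v1 v2 v1' v2' N i i'.
    rewrite size_cat in iw; rewrite size_cat.
    have [iw1|w1i] := ltnP i (size v1).
      have [i' i'w e] := types_forth e1 iw1.
      by exists i'; rewrite ltn_addr //; split=> //; split=> //; left.
    have iw2 : i - size v1 < size v2 by lia.
    have [i' i'w e] := types_forth e2 iw2.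
    exists (size v1' + i'); rewrite ltn_add2l; split=> //; split=> //; right.
    by exists (i - size v1), i'; rewrite subnKC.
  exists i' => //; apply: bisim Ri.
  - move=> n k k' [_ [[kw k'w /(tp_letter kw)]|[l [l' [-> -> lw l'w /(tp_letter lw)]]]]].
      by rewrite !onth_cat kw k'w.
    by rewrite !onth_cat !ltnNge !leq_addr /= !addKn.
  - by move=> n k k' j; exact: cat_rel_forth.
  - move=> n k k' j /cat_rel_sym Rk jw.
    have [j' [? ? ? ? /cat_rel_sym ?]] := cat_rel_forth (esym e1) (esym e2) Rk jw.
    by exists j'.
move=> e1 e2; apply: types_eq => i iw; first exact: main.
by apply: main.
Qed.

End Concatenation.
End Types.

(** * The game on words with a homogeneous middle part *)

Section FramedWords.
Variable A : finType.
Implicit Types (W : seq A) (a : A).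

Definition same_window R W W' j j' := forall d, d <= R ->
  onth W (j + d) = onth W' (j' + d) /\ onth W (j - d) = onth W' (j' - d).

Variables (D : {set A}) (H N KL l x y : nat).

(* [W] has a middle part of length [p] between a prefix of length [x] and a
   suffix of length [y]. *)
Definition framed p W := [/\ size W = x + p + y, 2 * KL <= p,
  forall k a, x <= k -> k < x + p -> onth W k = Some a -> a \in D &
  forall i a, x <= i -> i + H <= x + p -> a \in D ->
    exists k, [/\ i <= k, k < i + H & onth W k = Some a]].

Definition same_ends p W p' W' :=
  (forall k, k < x + KL -> onth W k = onth W' k) /\
  (forall k, onth W (x + p - KL + k) = onth W' (x + p' - KL + k)).

(* The surroundings of every position in the middle of [W] also occur at any
   prescribed distance [c * l] from both ends of the middle part of [W'], up to an
   error of [l]. *)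
Definition copies p W p' W' := forall j c, x + l <= j -> j + l < x + p ->
  c * l + l <= KL ->
  (exists j', [/\ x + p' <= j' + (c * l + l), j' + c * l < x + p' &
     same_window (N * H) W W' j j']) /\
  (exists j', [/\ x + c * l <= j', j' < x + (c * l + l) &
     same_window (N * H) W W' j j']).

Hypotheses (lH : H <= l) (lNH : N * H <= l) (KLl : (2 * N + 6) * l <= KL).

(** A reply prescribed at distance [c * l] from an end may be off by [l], and it must stay more than
    [H] away from the previous position: this costs [2 * l] per round. [KLl] leaves [5 * l] beyond
    the margin for [N] rounds. *)
Let margin n := (2 * n + 1) * l.

(* The positions of the two words that Duplicator keeps paired when [n] rounds
   remain: equal near the left end or near the right end, and otherwise with
   equal surroundings, of radius [n * H]. *)
Definition frame_rel p W p' W' n i i' :=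
  [/\ n <= N, i < size W, i' < size W' &
  [\/ i = i' /\ i < x + margin n,
      i + p' = i' + p /\ x + p <= i + margin n |
      [/\ x + margin n <= i, i + margin n < x + p,
          x + margin n <= i', i' + margin n < x + p' &
          same_window (n * H) W W' i i']]].

Lemma frame_rel_sym p W p' W' n i i' :
  frame_rel p W p' W' n i i' -> frame_rel p' W' p W n i' i.
Proof.
move=> [nN iw iw' h]; split=> //; case: h.
- by move=> [-> ?]; constructor 1.
- by move=> [? ?]; constructor 2; split; lia.
- move=> [? ? ? ? sw]; constructor 3; split=> // d /sw[-> ->]; by [].
Qed.

Section Game.
Variables (p p' : nat) (W W' : seq A).
Hypotheses (fW : framed p W) (fW' : framed p' W').
Hypotheses (ends : same_ends p W p' W').

(** The interval contains [H] consecutive positions of the middle part, hence all of [D]; any other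
    letter lies in the prefix or the suffix, which the two words share. *)
Lemma far_between_sub i j i' j' :
  i + H < j -> x + H <= j -> i + H < x + p ->
  i' + H < j' -> x + H <= j' -> i' + H < x + p' ->
  i = i' \/ x <= i -> j + p' = j' + p \/ j <= x + p ->
  {subset between W i j <= between W' i' j'}.
Proof.
move=> ij xj ip ij' xj' ip' hi hj a /betweenP[k [ik kj ka]].
have [_ KLp inD _] := fW; have [_ KLp' _ dense] := fW'.
have [pre suf] := ends; apply/betweenP.
have [kx|xk] := ltnP k x.
  by exists k; rewrite -pre ?ka; [split=> //; lia|lia].
have [kp|pk] := ltnP k (x + p); last first.
  have e : k = x + p - KL + (k - (x + p - KL)) by lia.
  rewrite e suf in ka; exists (x + p' - KL + (k - (x + p - KL))).
  by split=> //; lia.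
have aD : a \in D := inD _ _ xk kp ka.
have [|k' [k1 k2 ka']] := dense (maxn i'.+1 x) a (leq_maxr _ _) _ aD; first lia.
by exists k'; split=> //; lia.
Qed.

Lemma prefix_between_sub i j : i < x + KL -> j < x + KL ->
  {subset between W i j <= between W' i j}.
Proof.
move=> ix jx a /betweenP[k [ik kj ka]]; apply/betweenP; exists k.
by split=> //; rewrite -ka; apply/esym; apply: ends.1; lia.
Qed.

Lemma suffix_between_sub i j i' j' : i + p' = i' + p -> j + p' = j' + p ->
  x + p - KL <= i -> x + p - KL <= j ->
  {subset between W i j <= between W' i' j'}.
Proof.
move=> ei ej ix jx a /betweenP[k [ik kj ka]]; apply/betweenP.
have [_ KLp _ _] := fW; have [_ KLp' _ _] := fW'.
have e : k = x + p - KL + (k - (x + p - KL)) by lia.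
rewrite e ends.2 in ka; exists (x + p' - KL + (k - (x + p - KL))).
by split=> //; lia.
Qed.

Lemma near_between_sub R i j i' j' : same_window R W W' i i' ->
  i <= j + R -> j <= i + R -> j + i' = i + j' ->
  i >= R -> i' >= R -> {subset between W i j <= between W' i' j'}.
Proof.
move=> sw ij ji e Ri Ri' a /betweenP[k [ik kj ka]]; apply/betweenP.
have [lt_ik|ki] := leqP i k.
  have [|e1 _] := sw (k - i); first lia.
  rewrite subnKC // ka in e1.
  by exists (i' + (k - i)); split=> //; lia.
have [|_ e1] := sw (i - k); first lia.
have ek : i - (i - k) = k by lia.
rewrite ek ka in e1.
by exists (i' - (i - k)); split=> //; lia.
Qed.

End Game.

Lemma subset_eq (T : finType) (X Y : {set T}) :
  {subset X <= Y} -> {subset Y <= X} -> X = Y.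
Proof.
by move=> XY YX; apply/eqP; rewrite finset.eqEsubset; apply/andP; split;
  apply/fintype.subsetP.
Qed.

Lemma same_ends_sym p W p' W' : same_ends p W p' W' -> same_ends p' W' p W.
Proof. by move=> [h1 h2]; split=> k => [/h1|]. Qed.

Lemma same_window_sym R W W' j j' : same_window R W W' j j' -> same_window R W' W j' j.
Proof. by move=> sw d /sw[]. Qed.

Lemma same_windowW R R' W W' j j' : R' <= R ->
  same_window R W W' j j' -> same_window R' W W' j j'.
Proof. by move=> RR sw d dR; apply: sw; exact: leq_trans RR. Qed.

(** Close to an end the reply is the same position counted from that end. Within distance [H] of a
    middle position the reply is the same shift, which uses up [H] of the radius. For a more distant
    [j] all of [D] lies in between anyway, so only its side and its surroundings matter, and
    [copies] provides them near the appropriate end. *)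
Lemma frame_forth p p' W W' : framed p W -> framed p' W' ->
  same_ends p W p' W' -> copies p W p' W' -> forall n i i' j,
  frame_rel p W p' W' n.+1 i i' -> j < size W -> exists j',
    [/\ j' < size W', (i < j) = (i' < j'), (j < i) = (j' < i'),
      between W i j = between W' i' j' & frame_rel p W p' W' n j j'].
Proof.
move=> fW fW' ends cp n i i' j [nN iW iW' hi] jW.
have ends' := same_ends_sym ends.
have [sW KLp _ _] := fW; have [sW' KLp' _ _] := fW'.
have [pre suf] := ends.
have far i0 j0 i0' j0' : i0 + H < j0 -> x + H <= j0 -> i0 + H < x + p ->
    i0' + H < j0' -> x + H <= j0' -> i0' + H < x + p' ->
    i0 = i0' \/ x <= i0 /\ x <= i0' ->
    j0 + p' = j0' + p \/ j0 <= x + p /\ j0' <= x + p' ->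
    between W i0 j0 = between W' i0' j0'.
  move=> h1 h2 h3 h4 h5 h6 h7 h8; apply: subset_eq.
    by apply: (far_between_sub fW fW' ends) => //; [case: h7 => [|[]]|case: h8 => [|[]]]; tauto.
  apply: (far_between_sub fW' fW ends') => //.
    by case: h7 => [->|[]]; tauto.
  by case: h8 => [->|[]]; tauto.
have mS : margin n.+1 = margin n + 2 * l by rewrite /margin; lia.
have ml : l <= margin n by rewrite /margin; nia.
have mKL : margin n + 5 * l <= KL.
  by apply: leq_trans KLl; rewrite /margin -mulnDl leq_mul2r; apply/orP; right; lia.
have HS : n.+1 * H = n * H + H by rewrite mulSn addnC.
have nHl : n * H <= N * H by rewrite leq_mul2r; apply/orP; right; lia.
have cm : (2 * n + 1) * l = margin n by [].
have cmKL : (2 * n + 1) * l + l <= KL by rewrite cm; lia.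
have nN' : n <= N by lia.
(* The inequalities above are all that is used about [margin]; hiding its body keeps the arithmetic
   linear. *)
clearbody margin.
rewrite mS HS in hi.
case: hi => [[ei ix]|[ei ip]|[xi ip xi' ip' sw]].
(* The same position is a valid answer as long as the window of radius [N * H] around it ends inside
   the common prefix. *)
- subst i'; have [jK|Kj] := ltnP j (x + KL - N * H).
    exists j; rewrite sW'; split=> //; first lia.
      by apply: subset_eq; [apply: (prefix_between_sub ends)|
        apply: (prefix_between_sub ends')]; lia.
    split=> //; first by rewrite sW'; lia.
    have [jm|mj] := ltnP j (x + margin n); first by constructor 1.
    constructor 3; split=> //; try lia.
    by move=> d dn; rewrite !pre //; lia.
  have [jm|mj] := ltnP (j + margin n) (x + p).
    (* With [c * l = margin n] the reply lies just outside the margin at the right end, far from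
       [i]. *)
    have [|||[j' [j1 j2 sw]] _] := cp j (2 * n + 1); try lia; rewrite cm in j1 j2.
    exists j'; rewrite sW'; split; [lia|lia|lia| |].
      by apply: far; lia.
    split=> //; [by rewrite sW'; lia|].
    constructor 3; split; try lia; exact: same_windowW sw.
  exists (j + p' - p); rewrite sW'; split; [lia|lia|lia| |].
    by apply: far; lia.
  by split=> //; [rewrite sW'; lia|constructor 2; lia].
- have [Kj|jK] := leqP (x + p - KL + N * H) j.
    exists (j + p' - p); rewrite sW'; split; [lia|lia|lia| |].
      by apply: subset_eq; [apply: (suffix_between_sub fW fW' ends)|
        apply: (suffix_between_sub fW' fW ends')]; lia.
    split=> //; [by rewrite sW'; lia|].
    have [jm|mj] := leqP (x + p) (j + margin n); first by constructor 2; lia.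
    constructor 3; split; try lia.
    move=> d dn; split.
      have -> : j + d = x + p - KL + (j + d - (x + p - KL)) by lia.
      by rewrite suf; congr onth; lia.
    have -> : j - d = x + p - KL + (j - d - (x + p - KL)) by lia.
    by rewrite suf; congr onth; lia.
  have [jm|mj] := leqP (x + margin n) j.
    have [|||_ [j' [j1 j2 sw]]] := cp j (2 * n + 1); try lia; rewrite cm in j1 j2.
    exists j'; rewrite sW'; split; [lia|lia|lia| |].
      by rewrite betweenC [RHS]betweenC; apply: far; lia.
    split=> //; [by rewrite sW'; lia|].
    constructor 3; split; try lia; exact: same_windowW sw.
  exists j; rewrite sW'; split; [lia|lia|lia| |].
    by rewrite betweenC [RHS]betweenC; apply: far; lia.
  by split=> //; [rewrite sW'; lia|constructor 1].
- have [/andP[near1 near2]|far_ij] := boolP ((i <= j + H) && (j <= i + H)).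
    exists (i' + j - i); rewrite sW'; split; [lia|lia|lia| |].
      apply: subset_eq; first by apply: (near_between_sub sw); lia.
      by apply: (near_between_sub (same_window_sym sw)); lia.
    split=> //; [by rewrite sW'; lia|].
    constructor 3; split; try lia.
    have lift k k' : i <= k + (n * H + H) -> k <= i + (n * H + H) -> k + i' = i + k' ->
        onth W k = onth W' k'.
      move=> h1 h2 h3; have [ik|ki] := leqP i k.
        have [|e1 _] := sw (k - i); first lia.
        by move: e1; rewrite subnKC // => ->; congr onth; lia.
      have [|_ e1] := sw (i - k); first lia.
      have ek : i - (i - k) = k by lia.
      by move: e1; rewrite ek => ->; congr onth; lia.
    by move=> d dn; split; apply: lift; lia.
  have [jm|mj] := ltnP j (x + margin n).
    exists j; rewrite sW'; split; [lia|lia|lia| |].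
      by rewrite betweenC [RHS]betweenC; apply: far; lia.
    by split=> //; [rewrite sW'; lia|constructor 1].
  have [jp|pj] := leqP (x + p) (j + margin n).
    exists (j + p' - p); rewrite sW'; split; [lia|lia|lia| |].
      by apply: far; lia.
    by split=> //; [rewrite sW'; lia|constructor 2; lia].
  have [|||[j' [j1 j2 swj]] [j'' [j3 j4 swj']]] := cp j (2 * n + 1); try lia.
  rewrite cm in j1 j2 j3 j4.
  have [ij|ji] := ltnP i j.
    exists j'; rewrite sW'; split; [lia|lia|lia| |].
      by apply: far; lia.
    split=> //; [by rewrite sW'; lia|].
    constructor 3; split; try lia; exact: same_windowW swj.
  exists j''; rewrite sW'; split; [lia|lia|lia| |].
    by rewrite betweenC [RHS]betweenC; apply: far; lia.
  split=> //; [by rewrite sW'; lia|].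
  constructor 3; split; try lia; exact: same_windowW swj'.
Qed.

Lemma frame_types_sub p p' W W' : framed p W -> framed p' W' ->
  same_ends p W p' W' -> copies p W p' W' -> copies p' W' p W ->
  forall i, i < size W -> exists2 i', i' < size W' & tp N W i = tp N W' i'.
Proof.
move=> fW fW' ends cp cp' i iW.
have [sW KLp _ _] := fW; have [sW' KLp' _ _] := fW'.
have mKL : margin N + 5 * l <= KL.
  by apply: leq_trans KLl; rewrite /margin -mulnDl leq_mul2r; apply/orP; right; lia.
have ml : l <= margin N by rewrite /margin; nia.
have [i' i'W Ri] : exists2 i', i' < size W' & frame_rel p W p' W' N i i'.
  have [im|mi] := ltnP i (x + margin N).
    by exists i; [lia|split=> //; [lia|constructor 1]].
  have [ip|pi] := leqP (x + p) (i + margin N).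
    by exists (i + p' - p); [lia|split=> //; [lia|constructor 2; lia]].
  have [|||[i' [i1 i2 sw]] _] := cp i (2 * N + 1); try lia.
  rewrite -/(margin N) in i1 i2.
  by exists i'; [lia|split=> //; [lia|constructor 3; split=> //; lia]].
exists i' => //; apply: (@bisimulation _ W W' (frame_rel p W p' W')) Ri.
- move=> n k k' [nN kW kW' [[<- km]|[ek kp]|[_ _ _ _ /(_ 0 (leq0n _))[]]]].
  + have mn : margin n <= margin N by rewrite /margin; nia.
    by apply: ends.1; lia.
  + have mn : margin n <= margin N by rewrite /margin; nia.
    have -> : k = x + p - KL + (k - (x + p - KL)) by lia.
    by rewrite ends.2; congr onth; lia.
  + by rewrite !addn0.
- by move=> n k k' j; exact: frame_forth.
- move=> n k k' j /frame_rel_sym Rk jW.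
  have [j' [? ? ? ? /frame_rel_sym ?]] := frame_forth fW' fW (same_ends_sym ends) cp' Rk jW.
  by exists j'.
Qed.

End FramedWords.

(** * Powers, density and words made of blocks *)

Section Words.
Variable A : finType.
Implicit Types (s t u v w x U Y Q : seq A) (a : A) (D : {set A}).

Definition pow Y k := flatten (nseq k Y).

Lemma powD Y j k : pow Y (j + k) = pow Y j ++ pow Y k.
Proof. by rewrite /pow nseqD flatten_cat. Qed.

Lemma powS Y k : pow Y k.+1 = Y ++ pow Y k.
Proof. by []. Qed.

Lemma size_pow Y k : size (pow Y k) = k * size Y.
Proof. by elim: k => // k IH; rewrite powS size_cat IH mulSn. Qed.

Lemma onth_mid u Y v k : k < size Y -> onth (u ++ Y ++ v) (size u + k) = onth Y k.
Proof. by move=> kY; rewrite onth_cat ltnNge leq_addr /= addKn onth_cat kY. Qed.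

Lemma cat_eq_split s t u v : s ++ t = u ++ v -> size s <= size u ->
  exists2 c, u = s ++ c & t = c ++ v.
Proof.
elim: s u => [|a s IH] [|b u] //=; first by move=> ->; exists [::].
  by move=> ->; exists (b :: u).
by move=> [-> /IH h] /h[c -> ->]; exists c.
Qed.

Lemma infix_cat_split s t v : infix v (s ++ t) -> exists v1 v2,
  [/\ v = v1 ++ v2, infix v1 s & prefix v2 t \/ v1 = [::] /\ infix v2 t].
Proof.
move=> /infixP[a [b e]]; have [sa|lt_as] := leqP (size s) (size a).
  have [c _ ->] := cat_eq_split e sa; exists [::], v.
  by split=> //; [exact: infix0s|right; split=> //; exact: infix_infix].
have [c es ev] := cat_eq_split (esym e) (ltnW lt_as).
have [vc|/ltnW cv] := leqP (size v) (size c).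
  have [d ec _] := cat_eq_split ev vc; exists v, [::]; rewrite cats0.
  by split=> //; [rewrite es ec; exact: infix_infix|left; exact: prefix0s].
have [d -> ->] := cat_eq_split (esym ev) cv; exists c, d.
by split=> //; [rewrite es; exact: suffix_infix|left; exact: prefix_prefix].
Qed.

Lemma infix_overlap u v s t : infix v (s ++ u ++ t) -> size v <= size u ->
  infix v (s ++ u) \/ infix v (u ++ t).
Proof.
move=> /infixP[a [b e]] vu; have [sa|/ltnW lt_as] := leqP (size s) (size a).
  by have [c _ ->] := cat_eq_split e sa; right; exact: infix_infix.
rewrite catA (catA a) in e.
have [|c -> _] := cat_eq_split (esym e); first by rewrite !size_cat leq_add.
by left; rewrite -catA; exact: infix_infix.
Qed.

Definition dense D n w := forall v, infix v w -> n <= size v -> {subset D <= v}.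

Lemma denseW D m n w : m <= n -> dense D m w -> dense D n w.
Proof. by move=> mn dw v vw nv; apply: dw => //; exact: leq_trans nv. Qed.

Lemma dense_cat D m n w w' : dense D m w -> dense D n w' -> dense D (m + n) (w ++ w').
Proof.
move=> dw dw' v /infix_cat_split[v1 [v2 [-> v1w v2w]]]; rewrite size_cat => mn.
have {}v2w : infix v2 w' by case: v2w => [/prefixW|[]].
have [m1|m1] := leqP m (size v1).
  by move=> a /(dw _ v1w m1) av; rewrite mem_cat av.
have n2 : n <= size v2 by lia.
by move=> a /(dw' _ v2w n2) av; rewrite mem_cat av orbT.
Qed.

Lemma dense_size D w : dense D (size w).+1 w.
Proof. by move=> v /size_infix vw; rewrite ltnNge vw. Qed.

(** A factor of this length contains an entire copy of [U]. *)
Lemma dense_pow D U k : {subset D <= U} -> dense D (2 * size U) (pow U k).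
Proof.
move=> DU; elim: k => [|k IH] v.
  move=> /size_infix; rewrite /= leqn0 => /eqP v0.
  rewrite v0 leqn0 muln_eq0 /= => /eqP/size0nil U0.
  by move=> a /DU; rewrite U0.
rewrite powS => /infix_cat_split[v1 [v2 [-> v1w [v2w|[v10 v2w]]]]]; last first.
  by rewrite v10 => h; exact: IH.
have h1 : size v1 <= size U := size_infix v1w; rewrite size_cat => h2.
have h3 : size U <= size v2 by lia.
case: k IH v2w => [|k] _.
  move=> /size_prefix; rewrite /= => h4.
  have U0 : size U = 0 by lia.
  by move=> a /DU; rewrite (size0nil U0).
rewrite powS => /prefixP[t e]; have [c -> _] := cat_eq_split e h3.
by move=> a /DU aU; rewrite !mem_cat aU orbT.
Qed.

(** Short factors of either word occur in [Y]. The surroundings of a middle position are therefore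
    found in each of the [K] copies of [Y] at both ends, which gives [copies] with error
    [size Y]. *)
Lemma types_frame D N H K s t Y Q Q' :
  let P := pow Y K ++ Q ++ pow Y K in let P' := pow Y K ++ Q' ++ pow Y K in
  H <= size Y -> N * H <= size Y -> 2 * N + 6 <= K ->
  {subset P <= D} -> {subset P' <= D} -> dense D H P -> dense D H P' ->
  (forall v, infix v P -> size v <= (2 * (N * H)).+1 -> infix v Y) ->
  (forall v, infix v P' -> size v <= (2 * (N * H)).+1 -> infix v Y) ->
  types N (s ++ P ++ t) = types N (s ++ P' ++ t).
Proof.
move=> P P' HY NHY KN PD PD' dP dP' iP iP'.
have fr R R' : R' = pow Y K ++ R ++ pow Y K -> {subset R' <= D} -> dense D H R' ->
    framed D H (K * size Y) (size s) (size t) (size R') (s ++ R' ++ t).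
  move=> eR RD dR; split.
  - by rewrite !size_cat addnA.
  - by rewrite eR !size_cat !size_pow; lia.
  - move=> k a sk ks; rewrite onth_cat ltnNge sk /= onth_cat.
    have -> : k - size s < size R' by lia.
    by move=> ka; apply: RD; apply/onthP; exists (k - size s).
  - move=> i a si iH aD.
    have [||k ka] := elimT onthP (dR (take H (drop (i - size s) R')) _ _ a aD).
    + exact: infix_trans (infix_take _ _) (infix_drop _ _).
    + by rewrite size_takel // size_drop; lia.
    move: ka; rewrite onth_take onth_drop; case: ltnP => // kH ka.
    exists (i + k); split; [lia|lia|].
    rewrite onth_cat ltnNge; have -> /= : size s <= i + k by lia.
    rewrite onth_cat; have -> : i + k - size s < size R' by lia.
    by rewrite -ka; congr onth; lia.
have ends R R' : same_ends (K * size Y) (size s)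
    (size (pow Y K ++ R ++ pow Y K)) (s ++ (pow Y K ++ R ++ pow Y K) ++ t)
    (size (pow Y K ++ R' ++ pow Y K)) (s ++ (pow Y K ++ R' ++ pow Y K) ++ t).
  split=> k.
    move=> ks; rewrite -!catA !(catA s) ![onth ((s ++ _) ++ _) _]onth_cat.
    by rewrite size_cat size_pow ks.
  have suf R0 : onth (s ++ (pow Y K ++ R0 ++ pow Y K) ++ t)
      (size s + size (pow Y K ++ R0 ++ pow Y K) - K * size Y + k) = onth (pow Y K ++ t) k.
    have -> : s ++ (pow Y K ++ R0 ++ pow Y K) ++ t = (s ++ pow Y K ++ R0) ++ pow Y K ++ t.
      by rewrite -!catA.
    rewrite onth_cat ltnNge !size_cat size_pow.
    have -> /= : size s + (K * size Y + size R0) <=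
      size s + (K * size Y + (size R0 + K * size Y)) - K * size Y + k by lia.
    by congr onth; lia.
  by rewrite !suf.
have cps R R' Z : Z = pow Y K ++ R ++ pow Y K ->
    (forall v, infix v Z -> size v <= (2 * (N * H)).+1 -> infix v Y) ->
    copies H N (K * size Y) (size Y) (size s) (size Z) (s ++ Z ++ t)
      (size (pow Y K ++ R' ++ pow Y K)) (s ++ (pow Y K ++ R' ++ pow Y K) ++ t).
  move=> eZ iZ j c sj js cK.
  pose v := take (2 * (N * H)).+1 (drop (j - size s - N * H) Z).
  have sv : size v = (2 * (N * H)).+1 by rewrite size_takel // size_drop; lia.
  have /infixP[y1 [y2 eY]] : infix v Y.
    apply: iZ; last by rewrite sv.
    exact: infix_trans (infix_take _ _) (infix_drop _ _).
  have sY : size Y = size y1 + ((2 * (N * H)).+1 + size y2).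
    by rewrite {1}eY !size_cat sv.
  have win W u u' : W = u ++ Y ++ u' ->
      same_window (N * H) (s ++ Z ++ t) W j (size u + (size y1 + N * H)).
    move=> eW.
    have h k : k < size v -> onth (s ++ Z ++ t) (j - N * H + k) =
        onth W (size u + (size y1 + k)).
      move=> kv; rewrite eW onth_mid; last by lia.
      rewrite eY onth_mid // onth_take -sv kv onth_drop.
      rewrite onth_cat ltnNge; have -> /= : size s <= j - N * H + k by lia.
      rewrite onth_cat; have -> : j - N * H + k - size s < size Z by lia.
      by congr onth; lia.
    move=> d dR; split.
      have -> : j + d = j - N * H + (N * H + d) by lia.
      by rewrite h ?sv; [congr onth|]; lia.
    have -> : j - d = j - N * H + (N * H - d) by lia.
    by rewrite h ?sv; [congr onth|]; lia.
  have cK' : c < K.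
    by rewrite ltnNge; apply/negP => Kc; have := leq_mul Kc (leqnn (size Y)); lia.
  have eK : K = K - c.+1 + c.+1 by lia.
  have sKc : (K - c.+1) * size Y = K * size Y - (c * size Y + size Y).
    by rewrite mulnBl mulSnr.
  split.
    pose u1 := s ++ pow Y K ++ R' ++ pow Y (K - c.+1).
    have su1 : size u1 = size s + (K * size Y + (size R' + (K * size Y - (c * size Y + size Y)))).
      by rewrite !size_cat !size_pow sKc.
    exists (size u1 + (size y1 + N * H)); split.
    + by rewrite su1 !size_cat !size_pow; lia.
    + by rewrite su1 !size_cat !size_pow; lia.
    + apply: (win _ u1 (pow Y c ++ t)).
      by rewrite {2}eK powD powS /u1 -!catA.
  pose u1 := s ++ pow Y c.
  have su1 : size u1 = size s + c * size Y by rewrite size_cat size_pow.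
  exists (size u1 + (size y1 + N * H)); split; try by rewrite su1; lia.
  apply: (win _ u1 (pow Y (K - c.+1) ++ R' ++ pow Y K ++ t)).
  have {1}-> : K = c + (K - c.+1).+1 by lia.
  by rewrite powD powS /u1 -!catA.
have KY : (2 * N + 6) * size Y <= K * size Y by rewrite leq_mul2r KN orbT.
apply: types_eq => i.
  apply: (frame_types_sub HY NHY KY (fr _ _ (erefl _) PD dP) (fr _ _ (erefl _) PD' dP')).
  - exact: ends.
  - exact: cps.
  - exact: cps.
apply: (frame_types_sub HY NHY KY (fr _ _ (erefl _) PD' dP') (fr _ _ (erefl _) PD dP)).
- exact: ends.
- exact: cps.
- exact: cps.
Qed.

Definition blocks U (xs : seq (seq A)) := flatten [seq U ++ x ++ U | x <- xs].

Lemma blocks_cat U xs ys : blocks U (xs ++ ys) = blocks U xs ++ blocks U ys.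
Proof. by rewrite /blocks map_cat flatten_cat. Qed.

Lemma blocks_pow U xs k : blocks U (flatten (nseq k xs)) = pow (blocks U xs) k.
Proof. by elim: k => // k IH; rewrite /= blocks_cat IH. Qed.

(** A factor no longer than [U] meets at most one word of [xs], as consecutive ones are separated by
    two copies of [U]. *)
Lemma infix_blocks U xs v : infix v (blocks U xs) -> size v <= size U ->
  [\/ v = [::], exists2 x, x \in xs & infix v (U ++ x ++ U) | infix v (U ++ U)].
Proof.
move=> + vU; elim: xs => [|x xs IH].
  by rewrite infixs0 => /eqP; constructor 1.
have -> : blocks U (x :: xs) = (U ++ x) ++ U ++ blocks U xs.
  by rewrite /blocks /= -!catA.
move=> /infix_overlap -/(_ vU)[vx|].
  by constructor 2; exists x; rewrite ?mem_head // catA.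
case: xs IH => [|x' xs] IH.
  rewrite cats0 => vx; constructor 3; exact: infix_catl.
have -> : U ++ blocks U (x' :: xs) = U ++ U ++ (x' ++ U ++ blocks U xs).
  by rewrite /blocks /= -!catA.
move=> /infix_overlap -/(_ vU)[vx|]; first by constructor 3.
have -> : U ++ x' ++ U ++ blocks U xs = blocks U (x' :: xs).
  by rewrite /blocks /= -!catA.
move=> /IH[]; [by constructor 1| |by constructor 3].
by move=> [z zxs zv]; constructor 2; exists z; rewrite // in_cons zxs orbT.
Qed.

(** [H] adds up the density bounds of the three parts of V x V: [2 * size U] for each V and
    [size x + 1] for x. The power V of [U] is made longer than [H] and than the windows of radius
    [N * H]. Doubling [nu] in Y ensures that V V occurs in Y even if [nu] is a single word. The
    bound [2 * N + 6] is that of [types_frame]. *)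
Lemma types_blocks D N (U : seq A) (nu xs : seq (seq A)) :
  U != [::] -> {subset U <= D} -> {subset D <= U} ->
  (forall x, x \in nu -> {subset x <= D}) -> nu != [::] -> {subset xs <= nu} ->
  exists k K, forall s t, let V := pow U k.+1 in let Y := blocks V (nu ++ nu) in
    types N (s ++ (pow Y K.+1 ++ blocks V xs ++ pow Y K.+1) ++ t) =
    types N (s ++ (pow Y K.+1 ++ [::] ++ pow Y K.+1) ++ t).
Proof.
move=> U0 UD DU nuD nu0 xsnu.
pose X := sumn [seq size x | x <- nu].
have sX x : x \in nu -> size x <= X.
  move=> xnu; rewrite /X; elim: (nu) xnu => //= z l IH.
  by rewrite in_cons => /orP[/eqP->|/IH]; lia.
pose H := 4 * size U + X + 1.
exists (2 * (N * H) + H), (2 * N + 6) => s t V Y.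
have U1 : 0 < size U by rewrite lt0n size_eq0.
have sV : 2 * (N * H) + H + 1 <= size V.
  by rewrite size_pow addn1 leq_pmulr.
have VD : {subset V <= D}.
  move=> a; rewrite /V /pow => /flattenP[u]; rewrite mem_nseq => /andP[_ /eqP->].
  exact: UD.
have dV : dense D (2 * size U) V by exact: dense_pow.
clearbody V; rewrite {}/Y; set Y := blocks V (nu ++ nu).
have bD ys : {subset ys <= nu} -> {subset blocks V ys <= D}.
  move=> ysnu a /flattenP[_ /mapP[x xys ->]]; rewrite !mem_cat.
  by move=> /or3P[/VD|/(nuD _ (ysnu _ xys))|/VD].
have dVxV x : x \in nu -> dense D H (V ++ x ++ V).
  move=> /sX xX; apply: denseW (dense_cat dV (dense_cat (@dense_size D x) dV)).
  by rewrite /H; lia.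
have dVV : dense D H (V ++ V).
  by apply: denseW (dense_cat dV dV); rewrite /H; lia.
have dblocks ys : {subset ys <= nu} -> dense D H (blocks V ys).
  move=> ysnu v vys Hv a aD.
  have sH : size (take H v) = H by rewrite size_takel.
  have tv : infix (take H v) (blocks V ys) := infix_trans (infix_take _ _) vys.
  have [||[x xys vx]|vV] := infix_blocks tv.
  - by rewrite sH; lia.
  - by move=> t0; move: sH; rewrite t0 /= /H; lia.
  - apply: mem_take; apply: (dVxV x (ysnu _ xys)) vx _ a aD; by rewrite sH.
  - apply: mem_take; apply: dVV vV _ a aD; by rewrite sH.
have nnY ys : {subset ys <= nu} -> forall v, infix v (blocks V ys) ->
    size v <= (2 * (N * H)).+1 -> infix v Y.
  move=> ysnu v vys vN; have [||[x xys vx]|vV] := infix_blocks vys.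
  - by rewrite /H in vN sV *; lia.
  - by move=> ->; exact: infix0s.
  - apply: infix_trans vx _; rewrite /Y blocks_cat; apply: infix_catr.
    have /splitPr[n1 n2] := ysnu _ xys.
    by rewrite blocks_cat; apply: infix_catl; apply: infix_catr; exact: infix_refl.
  - apply: infix_trans vV _; rewrite /Y blocks_cat.
    case: (nu) nu0 => // z l _; rewrite {2}/blocks /=.
    rewrite (lastI z l) /blocks map_rcons flatten_rcons /=.
    apply/infixP; exists (flatten [seq V ++ x ++ V | x <- belast z l] ++ V ++ last z l).
    by exists (z ++ V ++ flatten [seq V ++ x ++ V | x <- l]); rewrite -!catA.
have ePow ys : pow Y (2 * N + 6).+1 ++ blocks V ys ++ pow Y (2 * N + 6).+1 =
    blocks V (flatten (nseq (2 * N + 6).+1 (nu ++ nu)) ++ ys ++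
      flatten (nseq (2 * N + 6).+1 (nu ++ nu))).
  by rewrite blocks_cat (blocks_cat _ ys) blocks_pow.
have sub ys : {subset ys <= nu} -> {subset flatten (nseq (2 * N + 6).+1 (nu ++ nu)) ++ ys ++
      flatten (nseq (2 * N + 6).+1 (nu ++ nu)) <= nu}.
  have h : {subset flatten (nseq (2 * N + 6).+1 (nu ++ nu)) <= nu}.
    move=> x /flattenP[u]; rewrite mem_nseq => /andP[_ /eqP->].
    by rewrite mem_cat orbb.
  by move=> ysnu x; rewrite mem_cat => /orP[/h //|]; rewrite mem_cat => /orP[/ysnu|/h].
have sVY : size V <= size Y.
  rewrite /Y blocks_cat; case: (nu) nu0 => // z l _.
  by rewrite /blocks /= !size_cat; lia.
have nil_nu : {subset [::] <= nu} by [].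
apply: (@types_frame D N H _ s t Y (blocks V xs) (blocks V [::])); rewrite ?ePow.
- by lia.
- by lia.
- by lia.
- exact: bD (sub _ xsnu).
- exact: bD (sub _ nil_nu).
- exact: dblocks (sub _ xsnu).
- exact: dblocks (sub _ nil_nu).
- exact: nnY (sub _ xsnu).
- exact: nnY (sub _ nil_nu).
Qed.

End Words.

(** * The syntactic monoid *)

Lemma run_cat (A : Type) (X : dfa A) (q : state X) u v :
  run q (u ++ v) = run (run q u) v.
Proof. exact: foldl_cat. Qed.

Section SyntacticMorphism.
Local Open Scope group_scope.
Variables (A : Type) (L : set (seq A)).
Implicit Types (u v s t : seq A).

Let synt_subproof u :
  @transition A (minimal_dfa L) u \in range (@transition A (minimal_dfa L)).
Proof. by rewrite inE; exists u. Qed.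

Definition synt u : syntactic_monoid L := Sub (@transition A (minimal_dfa L) u) (synt_subproof u).

Lemma synt_nil : synt [::] = 1.
Proof. exact: val_inj. Qed.

Lemma synt_cat u v : synt (u ++ v) = synt u * synt v.
Proof. by apply: val_inj; apply/funext => q; exact: run_cat. Qed.

Lemma synt_surj m : exists u, synt u = m.
Proof. by case: m => f pf; case: (set_mem pf) => u _ uf; exists u; apply: val_inj. Qed.

Lemma lang_run u : L u <-> final (run (init (minimal_dfa L)) u).
Proof. by rewrite -{1}(lang_minimal L). Qed.

Lemma syntP u v : synt u = synt v <-> forall s t, L (s ++ u ++ t) <-> L (s ++ v ++ t).
Proof.
split=> [/(congr1 val) /= e s t|uv].
  rewrite !lang_run !run_cat.
  have eq_run (q : state (minimal_dfa L)) : run q u = run q v.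
    exact: (congr1 (fun f : state (minimal_dfa L) -> state (minimal_dfa L) => f q) e).
  by rewrite eq_run.
apply: val_inj; apply/funext => q; have [s <-] := minimal_reachable q.
apply: minimal_reduced => t; rewrite /transition -!run_cat -!lang_run.
exact: uv.
Qed.

End SyntacticMorphism.

(** * Definable implies M_eDA *)

Section Necessity.
Local Open Scope group_scope.
Variables (A : finType) (L : set (seq A)) (phi : fo2 A).
Hypotheses (phi_closed : sentence phi) (phiP : forall w, L w <-> models w phi).
Local Notation M := (syntactic_monoid L).
Local Notation mu := (synt L).
Implicit Types (u v w x : seq A).

Lemma synt_types u v :
  (forall s t, types (depth phi) (s ++ u ++ t) = types (depth phi) (s ++ v ++ t)) ->
  mu u = mu v.
Proof.
by move=> uv; apply/syntP => s t; rewrite !phiP (models_types phi_closed (uv s t)).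
Qed.

Lemma finite_syntactic_monoid : finite_set [set: M].
Proof.
have /choice[g hg] : forall X : {set ty A (depth phi).+2}, exists m : M,
    forall w, types (depth phi).+2 w = X -> mu w = m.
  move=> X; have [[w wX]|nex] := pselect (exists w, types (depth phi).+2 w = X).
    exists (mu w) => v vX; apply: synt_types => s t.
    (* Each of the two concatenations costs one level, hence [(depth phi).+2]. *)
    apply: types_cat => //; apply: types_cat => //; by rewrite vX wX.
  by exists 1 => w wX; case: nex; exists w.
have fin : finite_set [set: {set ty A (depth phi).+2}]%classic by exact: finite_finset.
apply: sub_finite_set (finite_image g fin) => m _.
have [w <-] := synt_surj m; exists (types (depth phi).+2 w) => //.
by rewrite (hg _ w erefl).
Qed.

Section LocalMonoids.
Variables (e : M) (ee : e * e = e) (f : local_monoid ee) (ff : f * f = f).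

(** A word with value J-above [e] has only letters with this property, so the values of these
    letters generate M_e. *)
Let D : {set A} := [set a | `[<leJ e (mu [:: a])>]]%SET.

Local Notation over := (over D).

Let over_cat u v : over u -> over v -> over (u ++ v).
Proof. by move=> ou ov a; rewrite mem_cat => /orP[/ou|/ov]. Qed.

Lemma over_leJ v : leJ e (mu v) -> over v.
Proof.
move=> [r [t er]] a av; case/splitPr: av er => v1 v2 er.
rewrite inE; apply: asboolT.
exists (r * mu v1), (mu v2 * t).
by rewrite er -cat1s !synt_cat !mulgA.
Qed.

Lemma gen_above_word m : gen_above e m -> exists2 v, over v & mu v = m.
Proof.
move=> /(_ [set m | exists2 v, over v & mu v = m]%classic) [].
  split; first split.
  - by exists [::] => //; exact: synt_nil.
  - move=> _ _ [u ou <-] [v ov <-]; exists (u ++ v); first exact: over_cat.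
    exact: synt_cat.
  - move=> m' em'; have [v ev] := synt_surj m'; exists v => //.
    by apply: over_leJ; rewrite ev.
by move=> v ov <-; exists v.
Qed.

Lemma local_word (z : local_monoid ee) : exists2 v, over v & val z = e * mu v * e.
Proof.
have [m em ez] := set_mem (valP z); have [v ov ev] := gen_above_word em.
by exists v => //; rewrite ev ez.
Qed.

(** The product in e M_e e, except that the empty product is [1], as it has to be for the value of
    an empty word of blocks. *)
Let gamma (xs : seq (seq A)) : M := foldr (fun v m => e * mu v * e * m) 1 xs.

Lemma gamma_cat xs ys : gamma (xs ++ ys) = gamma xs * gamma ys.
Proof. by elim: xs => [|x xs IH]; rewrite /= ?mul1g // IH !mulgA. Qed.

Lemma gamma_absorb xs : e * gamma xs * e = e * gamma xs.
Proof.
elim: xs => [|x xs IH] /=; first by rewrite mulg1 ee.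
by rewrite !mulgA ee -!(mulgA (e * mu x)) IH.
Qed.

Lemma synt_blocks V xs : mu V = e -> mu (blocks V xs) = gamma xs.
Proof.
move=> eV; elim: xs => [|x xs IH]; first exact: synt_nil.
by rewrite /blocks /= -/(blocks V xs) !synt_cat IH eV !mulgA.
Qed.

Lemma synt_pow Y k (m : M) : mu Y = m -> m * m = m -> mu (pow Y k.+1) = m.
Proof.
move=> eY mm; elim: k => [|k IH]; first by rewrite powS cats0.
by rewrite powS synt_cat IH eY.
Qed.

(** For each [a] in [D], [leJ e (mu [:: a])] yields a word of value [e] that contains [a]; as [e] is
    idempotent, these words can be concatenated. *)
Lemma full_word : exists U, [/\ over U, {subset D <= U} & mu U = e].
Proof.
have [u0 eu0] := synt_surj e.
have ou0 : over u0 by apply: over_leJ; rewrite eu0; exact: leJ_refl.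
suff [U [oU DU eU]] : exists U, [/\ over U, {subset enum D <= U} & mu U = e].
  by exists U; split=> // a aD; apply: DU; rewrite mem_enum.
have : {subset enum D <= D} by move=> a; rewrite mem_enum.
elim: (enum D) => [|a l IH] lD; first by exists u0.
have [|U [oU lU eU]] := IH; first by move=> b bl; apply: lD; rewrite in_cons bl orbT.
have : a \in D by apply: lD; rewrite mem_head.
rewrite inE => /asboolW[r [t er]].
have [v ev] := synt_surj r; have [v' ev'] := synt_surj t.
have eva : mu (v ++ a :: v') = e by rewrite -cat1s !synt_cat ev ev' mulgA.
have oa : over (v ++ a :: v') by apply: over_leJ; rewrite eva; exact: leJ_refl.
exists ((v ++ a :: v') ++ U); split; first exact: over_cat.
  move=> b; rewrite in_cons => /orP[/eqP->|/lU bU]; rewrite !mem_cat ?mem_head ?orbT //.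
  by rewrite bU orbT.
by rewrite synt_cat eva eU.
Qed.

(** Words for the generators of the submonoid attached to f in e M_e e. The multipliers are given by
    words too, since they will become entries of [nu]. *)
Definition divides x := over x /\ exists r r', [/\ over r, over r' &
  val f = e * mu r * e * (e * mu x * e) * (e * mu r' * e)].

Lemma gen_above_gamma n : gen_above f n ->
  exists2 xs : seq (seq A), (forall x, x \in xs -> divides x) & val n = e * gamma xs.
Proof.
move=> /(_ [set n | exists2 xs : seq (seq A), (forall x, x \in xs -> divides x) &
  val n = e * gamma xs]%classic); apply; split; first split.
- by exists [::]; rewrite //= mulg1.
- move=> z z' [xs hxs ez] [ys hys ez']; exists (xs ++ ys).
    by move=> x; rewrite mem_cat => /orP[/hxs|/hys].
  rewrite gamma_cat mulgA -(gamma_absorb xs) -mulgA -ez'.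
  by have -> : val (z * z') = val z * val z' by []; rewrite ez.
- move=> z [r [r' er]].
  have [x ox ex] := local_word z; have [y oy ey] := local_word r.
  have [y' oy' ey'] := local_word r'.
  exists [:: x]; last by rewrite /= ex mulg1 !mulgA ee.
  move=> _ /[1!inE] /eqP ->; split=> //; exists y, y'; split=> //.
  by rewrite -ex -ey -ey' er.
Qed.

(** Each [x] contributes the entries r, x, r' with product f, so that idempotence keeps the total
    equal to f; the word [v0] for f makes the list nonempty. *)
Lemma divides_list (xs : seq (seq A)) : (forall x, x \in xs -> divides x) ->
  exists nu : seq (seq A), [/\ forall x, x \in nu -> over x, nu != [::], {subset xs <= nu} &
    gamma nu = val f].
Proof.
have fff : val f * val f = val f := congr1 val ff.
have [v0 ov0 ev0] := local_word f.
elim: xs => [_|x xs IH hx].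
  exists [:: v0]; split=> //; last by rewrite /= mulg1.
  by move=> x; rewrite inE => /eqP->.
have [|nu [onu nu0 sub enu]] := IH.
  by move=> y yxs; apply: hx; rewrite in_cons yxs orbT.
have [ox [r [r' [or or' er]]]] := hx x (mem_head _ _).
exists [:: r, x, r' & nu]; split=> //.
- by move=> y; rewrite !in_cons => /or4P[/eqP->|/eqP->|/eqP->|/onu].
- by move=> y; rewrite !in_cons => /orP[->|/sub ->]; rewrite ?orbT.
- by rewrite /= enu -[RHS]fff {2}er !mulgA.
Qed.

Lemma local_idempotent n : gen_above f n -> f * n * f = f.
Proof.
move=> /gen_above_gamma[xs hxs en]; apply: val_inj.
have fff : val f * val f = val f := congr1 val ff.
have [nu [onu nu0 xsnu enu]] := divides_list hxs.
have [U [oU DU eU]] := full_word.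
have vfnf : val (f * n * f) = val f * val n * val f by [].
have [ef fe] := val_local_absorb f.
(* [types_blocks] asks for a nonempty [U]. If [U] is empty, then so is [D], and e M_e e is
   trivial. *)
have [U0|U0] := eqVneq U [::].
  have over_nil v : over v -> v = [::].
    by case: v => // a v /(_ a (mem_head _ _)) /DU; rewrite U0.
  have e1 : e = 1 by rewrite -eU U0 synt_nil.
  have val1 (z : local_monoid ee) : val z = 1.
    have [v /over_nil -> ->] := local_word z.
    by rewrite synt_nil e1 !mulg1.
  by rewrite !val1.
have [k [K types_eq]] := types_blocks (depth phi) U0 oU DU onu nu0 xsnu.
set V := pow U k.+1 in types_eq; set Y := blocks V (nu ++ nu) in types_eq.
have eV : mu V = e by apply: synt_pow.
have eY : mu Y = val f by rewrite synt_blocks // gamma_cat enu.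
have eYK : mu (pow Y K.+1) = val f by apply: synt_pow.
have := synt_types types_eq; rewrite !(@synt_cat A L (pow Y K.+1)) (@synt_cat A L (blocks V xs)).
rewrite (@synt_cat A L [::]) synt_nil eYK mul1g fff synt_blocks //.
by move=> e1; rewrite vfnf en mulgA fe -mulgA.
Qed.

End LocalMonoids.

Lemma MeDA_syntactic_monoid : MeDA M.
Proof.
split=> [|e ee]; first exact: finite_syntactic_monoid.
split=> [|f ff]; first exact: finite_local finite_syntactic_monoid.
apply/seteqP; split=> // z _; apply: val_inj.
have [n fn <-] := set_mem (valP z); exact: local_idempotent.
Qed.

End Necessity.

Theorem theorem6p1 (A : finType) (L : set (seq A)) :
  fo2_bet_definable L <-> MeDA (syntactic_monoid L).
Proof.
split=> [[phi phi_closed phiP]|MDA]; first exact: MeDA_syntactic_monoid phi_closed phiP.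
have [fin _] := MDA; have /finite_seqP[s es] := fin.
have sT (x : syntactic_monoid L) : x \in s.
  by have : [set: syntactic_monoid L]%classic x by []; rewrite es.
apply: (MeDA_definable sT (synt_nil L) (@synt_cat _ L) MDA) => u v /syntP uv.
by have := uv [::] [::]; rewrite !cats0 => -[].
Qed.
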